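(* Let $K$ be a number field, let $A$ be an abelian variety over $K$ (with origin $O$), let $X$ be a smooth projective variety over $K$ whose automorphism group $\mathrm{Aut}_K(X)$ contains a finite group $G$, and let $f:X\to A$ be a morphism defined over $K$. Suppose that the quotient $X/G$ is isomorphic over $K$ to the projective space $\mathbb{P}^d$ (for some $d\ge 1$), and that the vanishing condition \[\sum_{g\in G} f(g\cdot P)=O\quad\text{for all } P\in X(\overline{K})\] holds. Let $p$ be a prime and let $\sigma\in G$ be an element of order $p$. Consider the two conditions: (NC1) the morphism $f+f\circ\sigma+\cdots+f\circ\sigma^{p-1}:X\to A$ is non-constant; (NC2) the morphism $f-f\circ\sigma:X\to A$ is non-constant. Then: (a) if both (NC1) and (NC2) hold, there exist infinitely many linearly disjoint (over $K$) $G$-extensions $L_1,L_2,\ldots$ of $K$ such that $\mathrm{rank}\,A(L_i)\ge \mathrm{rank}\,A(K)+p$ for every $i$; (b) if only (NC2) holds, there exist infinitely many linearly disjoint (over $K$) $G$-extensions $L_1,L_2,\ldots$ of $K$ such that $\mathrm{rank}\,A(L_i)\ge \mathrm{rank}\,A(K)+p-1$ for every $i$.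
   Context: A $G$-extension of $K$ is a finite Galois extension $L/K$ with $\mathrm{Gal}(L/K)\cong G$. For a field $L\supseteq K$, $\mathrm{rank}\,A(L)$ denotes the rank of the finitely generated abelian group $A(L)$ (Mordell–Weil). Sums of morphisms to $A$ are taken pointwise using the group law of $A$; a variety is identified with its set of $\overline{K}$-points, and $g\cdot P$ denotes the action of $g\in G\subseteq \mathrm{Aut}_K(X)$ on $P$. *)

(* Defs.v *)
From HB Require Import structures.
From mathcomp Require Import all_boot all_order all_fingroup all_algebra all_solvable all_field.
From mathcomp Require Import mpoly.

Set Implicit Arguments.
Unset Strict Implicit.
Unset Printing Implicit Defensive.

Import GRing.Theory.
Local Open Scope ring_scope.

(* Classical varieties.  A number field K is a finite extension of rat, and
   Kbar = C is an algebraically closed field with an algebraic embedding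
   iota : K -> C.  A projective variety is a type T of Kbar-points with an
   injection e : T -> P^(n-1)(C) onto an irreducible Zariski closed subset
   whose ideal is generated by homogeneous polynomials over K. *)

(* P^(n-1)(C), as the set of lines of C^n: note the shift in the index. *)
Definition pspace (C : fieldType) (n : nat) :=
  {U : {vspace 'rV[C]_n} | \dim U == 1%N}.

Definition coords (C : fieldType) n (P : pspace C n) (x : 'rV[C]_n) : Prop :=
  val P = <[x]>%VS.

Lemma coords_pick (C : fieldType) n (P : pspace C n) : coords P (vpick (val P)).
Proof.
have d1 := eqP (valP P); apply/esym/eqP.
rewrite eqEdim -memvE memv_pick d1 dim_vline vpick0 -dimv_eq0 d1; by [].
Qed.

Lemma coords_neq0 (C : fieldType) n (P : pspace C n) x : coords P x -> x != 0.
Proof.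
move=> Px; have := valP P; rewrite /coords in Px.
by rewrite Px dim_vline; case: (x =P 0).
Qed.

(* Segre coordinates (x_i y_j)_(i,j). *)
Definition segre_coords (C : fieldType) m n (x : 'rV[C]_m) (y : 'rV[C]_n) :
  'rV[C]_(m * n) := mxvec (x^T *m y).

Lemma segre_coords_neq0 (C : fieldType) m n (x : 'rV[C]_m) (y : 'rV[C]_n) :
  x != 0 -> y != 0 -> segre_coords x y != 0.
Proof.
move=> /rV0Pn[i xi] /rV0Pn[j yj]; apply/eqP => /rowP/(_ (mxvec_index i j)).
rewrite mxvecE !mxE big_ord1 !mxE => /eqP.
by rewrite mulf_eq0 (negPf xi) (negPf yj).
Qed.

Lemma segre_subproof (C : fieldType) m n (P : pspace C m) (Q : pspace C n) :
  \dim <[segre_coords (vpick (val P)) (vpick (val Q))]> == 1%N.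
Proof.
by rewrite dim_vline segre_coords_neq0 // (coords_neq0 (coords_pick _)).
Qed.

Definition segre (C : fieldType) m n (P : pspace C m) (Q : pspace C n) :
  pspace C (m * n) := exist (fun U => \dim U == 1%N) _ (segre_subproof P Q).

Lemma segreE (C : fieldType) m n (P : pspace C m) (Q : pspace C n) x y :
  coords P x -> coords Q y -> coords (segre P Q) (segre_coords x y).
Proof.
move=> Px Qy; rewrite /coords /segre /=; apply/eqP.
rewrite eqEdim !dim_vline !segre_coords_neq0 ?(coords_neq0 (coords_pick _)) //;
  try by [apply: coords_neq0 Px | apply: coords_neq0 Qy].
have /vlineP[a ->] : vpick (val P) \in <[x]>%VS by rewrite -Px memv_pick.
have /vlineP[b ->] : vpick (val Q) \in <[y]>%VS by rewrite -Qy memv_pick.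
rewrite andbT -memvE /segre_coords [(a *: x)^T]linearZ /= -scalemxAl -scalemxAr !linearZ /=.
by rewrite !memvZ // memv_line.
Qed.

Definition meval_row (C : fieldType) n (F : {mpoly C[n]}) (x : 'rV[C]_n) : C :=
  F.@[fun i => x 0 i].

Definition vanishes (C : fieldType) n (F : {mpoly C[n]}) (P : pspace C n) :
  Prop := forall x, coords P x -> meval_row F x = 0.

Definition homogeneous (C : fieldType) n (F : {mpoly C[n]}) : Prop :=
  exists d : nat, F \is d.-homog.

(* The Zariski topology on T induced by e : T -> P^(n-1)(C). *)
Definition zclosed (C : fieldType) T n (e : T -> pspace C n) (Z : T -> Prop) :
  Prop :=
  exists2 S : {mpoly C[n]} -> Prop, (forall F, S F -> homogeneous F) &
    forall P, Z P <-> (forall F, S F -> vanishes F (e P)).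

Definition zopen (C : fieldType) T n (e : T -> pspace C n) (U : T -> Prop) :
  Prop := zclosed e (fun P => ~ U P).

Definition zirreducible (C : fieldType) T n (e : T -> pspace C n)
    (Z : T -> Prop) : Prop :=
  (exists P, Z P) /\
  forall Z1 Z2, zclosed e Z1 -> zclosed e Z2 ->
    (forall P, Z P -> Z1 P \/ Z2 P) ->
    (forall P, Z P -> Z1 P) \/ (forall P, Z P -> Z2 P).

(* As C is infinite, the polynomials vanishing on all homogeneous coordinates
   of all points of T form the homogeneous ideal of T. *)
Definition in_ideal (C : fieldType) T n (e : T -> pspace C n)
  (F : {mpoly C[n]}) : Prop := forall P, vanishes F (e P).

Definition generates_ideal (C : fieldType) T n (e : T -> pspace C n)
    m (F : 'I_m -> {mpoly C[n]}) : Prop :=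
  (forall i, in_ideal e (F i)) /\
  (forall H, in_ideal e H ->
     exists h : 'I_m -> {mpoly C[n]}, H = \sum_i h i * F i).

Definition defined_over (K C : fieldType) (iota : {rmorphism K -> C})
    T n (e : T -> pspace C n) : Prop :=
  exists m (F : 'I_m -> {mpoly K[n]}),
    (forall i, homogeneous (F i)) /\
    generates_ideal e (fun i => map_mpoly iota (F i)).

Record projective_variety (K C : fieldType) (iota : {rmorphism K -> C})
    T n (e : T -> pspace C n) : Prop := ProjectiveVariety {
  pv_inj : injective e;
  pv_closed : zclosed (@id (pspace C n)) (fun Q => exists P, Q = e P);
  pv_irreducible : zirreducible e (fun _ => True);
  pv_defined : defined_over iota e }.

(* There is a chain of d + 1 irreducible closed subsets of T. *)
Definition krull_dim_ge (C : fieldType) T n (e : T -> pspace C n) (d : nat) :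
  Prop :=
  exists Z : nat -> T -> Prop,
    (forall i, (i <= d)%N -> zclosed e (Z i) /\ zirreducible e (Z i)) /\
    (forall i, (i < d)%N ->
       (forall P, Z i P -> Z i.+1 P) /\ exists P, Z i.+1 P /\ ~ Z i P).

Definition has_dim (C : fieldType) T n (e : T -> pspace C n) (d : nat) : Prop :=
  krull_dim_ge e d /\ ~ krull_dim_ge e d.+1.

Definition jacobian (C : fieldType) m n (F : 'I_m -> {mpoly C[n]})
    (x : 'rV[C]_n) : 'M[C]_(m, n) :=
  \matrix_(i, j) meval_row (mderiv j (F i)) x.

(* Jacobian criterion: the rank is (n - 1) - d at every point of T. *)
Definition smooth (C : fieldType) T n (e : T -> pspace C n) : Prop :=
  exists d m (F : 'I_m -> {mpoly C[n]}),
    [/\ has_dim e d, generates_ideal e F &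
     forall P x, coords (e P) x -> (\rank (jacobian F x) + d).+1 = n].

Definition meval_rows (K C : fieldType) (iota : {rmorphism K -> C}) m n
    (F : 'I_m -> {mpoly K[n]}) (x : 'rV[C]_n) : 'rV[C]_m :=
  \row_i meval_row (map_mpoly iota (F i)) x.

(* Around each point, f is given by homogeneous polynomials over K of the
   same degree with no common zero at that point. *)
Definition morphism_over (K C : fieldType) (iota : {rmorphism K -> C})
    T n (e : T -> pspace C n) T' n' (e' : T' -> pspace C n') (f : T -> T') :
  Prop :=
  forall P : T, exists (d : nat) (F : 'I_n' -> {mpoly K[n]}),
    [/\ forall i, F i \is d.-homog,
        forall x, coords (e P) x -> meval_rows iota F x != 0 &
        forall Q x, coords (e Q) x -> meval_rows iota F x != 0 ->
          coords (e' (f Q)) (meval_rows iota F x)].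

Definition isomorphic_over (K C : fieldType) (iota : {rmorphism K -> C})
    T n (e : T -> pspace C n) T' n' (e' : T' -> pspace C n') : Prop :=
  exists (u : T -> T') (v : T' -> T),
    [/\ morphism_over iota e e' u, morphism_over iota e' e v,
        cancel u v & cancel v u].

(* Regular functions on an open U, i.e. sections over U of the structure sheaf
   of the variety over C; the values of h outside U are irrelevant. *)
Definition regular_on (C : fieldType) T n (e : T -> pspace C n)
    (U : T -> Prop) (h : T -> C) : Prop :=
  forall P, U P -> exists (d : nat) (N D : {mpoly C[n]}),
    [/\ N \is d.-homog, D \is d.-homog,
        forall x, coords (e P) x -> meval_row D x != 0 &
        forall Q x, U Q -> coords (e Q) x -> meval_row D x != 0 ->
          h Q = meval_row N x / meval_row D x].

(* G is a subgroup of Aut_K(X); the inverse of act g is act g^-1. *)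
Record automorphism_subgroup (K C : fieldType) (iota : {rmorphism K -> C})
    T n (e : T -> pspace C n) (gT : finGroupType) (act : gT -> T -> T) : Prop :=
  AutomorphismSubgroup {
  aut_morphism : forall g, morphism_over iota e e (act g);
  aut_one : forall P, act 1%g P = P;
  aut_mul : forall g h P, act (g * h)%g P = act g (act h P);
  aut_faithful : forall g, (forall P, act g P = P) -> g = 1%g }.

(* pi : T -> T' is the quotient of T by G: its fibres are the G-orbits, T' has
   the quotient topology, and the regular functions on an open U of T' are the
   G-invariant regular functions on the preimage of U.  These conditions are
   over Kbar; as pi is a morphism over K and forming the quotient commutes with
   extension of the base field, they characterize T/G over K. *)
Record group_quotient (K C : fieldType) (iota : {rmorphism K -> C})
    T n (e : T -> pspace C n) (gT : finGroupType) (act : gT -> T -> T)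
    T' n' (e' : T' -> pspace C n') (pi : T -> T') : Prop := GroupQuotient {
  quo_morphism : morphism_over iota e e' pi;
  quo_surjective : forall Q, exists P, pi P = Q;
  quo_orbits : forall P P', pi P = pi P' <-> exists g, P' = act g P;
  quo_topology : forall Z, zclosed e' Z <-> zclosed e (fun P => Z (pi P));
  quo_functions : forall (U : T' -> Prop) (h : T -> C), zopen e' U ->
    regular_on e (fun P => U (pi P)) h ->
    (forall g P, U (pi P) -> h (act g P) = h P) ->
    exists2 h' : T' -> C, regular_on e' U h' &
      forall P, U (pi P) -> h P = h' (pi P) }.

Definition rational_point (L C : fieldType) (j : {rmorphism L -> C})
    T n (e : T -> pspace C n) (P : T) : Prop :=
  exists2 y : 'rV[L]_n, y != 0 & coords (e P) (map_mx j y).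

(* The zmodType structure of A is the group law on the Kbar-points; A * A is a
   variety through the Segre embedding. *)
Record abelian_variety (K C : fieldType) (iota : {rmorphism K -> C})
    (A : zmodType) n (e : A -> pspace C n) : Prop := AbelianVariety {
  av_variety : projective_variety iota e;
  av_smooth : smooth e;
  av_zero : rational_point iota e 0;
  av_opp : morphism_over iota e e (fun P => - P);
  av_add : morphism_over iota
    (fun PQ : A * A => segre (e PQ.1) (e PQ.2)) e (fun PQ => PQ.1 + PQ.2) }.

Definition is_constant T T' (f : T -> T') : Prop := exists a, forall P, f P = a.

(* rank S >= r, for S a subgroup of A: there are r points of S that are
   linearly independent over Z. *)
Definition rank_ge (A : zmodType) (S : A -> Prop) (r : nat) : Prop :=
  exists v : 'I_r -> A, (forall i, S (v i)) /\
    forall c : 'I_r -> int, \sum_i v i *~ c i = 0 -> forall i, c i = 0.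

(* rank S' >= rank S + k.  For subgroups of finite rank (as are all groups A(L),
   by Mordell-Weil) this is the inequality between the two natural numbers. *)
Definition rank_ge_add (A : zmodType) (S' S : A -> Prop) (k : nat) : Prop :=
  forall r, rank_ge S r -> rank_ge S' (r + k).

Definition is_G_extension (K : fieldType) (L : splittingFieldType K)
    (gT : finGroupType) : Prop :=
  galois 1%AS {:L} /\ 'Gal({:L} / 1%AS) \isog [set: gT].

Definition extends (K C : fieldType) (iota : {rmorphism K -> C})
    (L : fieldExtType K) (j : {rmorphism L -> C}) : Prop :=
  forall a : K, j a%:A = iota a.

(* The subfield of C generated by K and the images of L_0, ..., L_(n-1). *)
Definition in_compositum (K C : fieldType) (iota : {rmorphism K -> C})
    (L : nat -> splittingFieldType K) (j : forall i, {rmorphism L i -> C})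
    (n : nat) (x : C) : Prop :=
  forall S : {pred C}, divring_closed S -> (forall a, iota a \in S) ->
    (forall i (y : L i), (i < n)%N -> j i y \in S) -> x \in S.

Definition linearly_disjoint (K C : fieldType) (L : fieldExtType K)
    (j : {rmorphism L -> C}) (F : C -> Prop) : Prop :=
  forall m (v : m.-tuple L), free v ->
    forall b : 'I_m -> C, (forall i, F (b i)) ->
      \sum_i b i * j (tnth v i) = 0 -> forall i, b i = 0.

Definition linearly_disjoint_family (K C : fieldType)
    (iota : {rmorphism K -> C}) (L : nat -> splittingFieldType K)
    (j : forall i, {rmorphism L i -> C}) : Prop :=
  forall n, linearly_disjoint (j n) (in_compositum iota j n).

Definition infinitely_many_rank_gains (K C : fieldType)
    (iota : {rmorphism K -> C}) (gT : finGroupType)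
    (A : zmodType) n (e : A -> pspace C n) (k : nat) : Prop :=
  exists (L : nat -> splittingFieldType K) (j : forall i, {rmorphism L i -> C}),
    [/\ forall i, is_G_extension (L i) gT,
        forall i, extends iota (j i),
        linearly_disjoint_family iota j &
        forall i, rank_ge_add (rational_point (j i) e)
                              (rational_point iota e) k].

(* Main.v *)
(** Let rho : X -> P^d be the quotient map.  The fibre over x is described by a
    monic polynomial chi_x(Z) = prod_g (Z - D(x) theta(gP)), where theta is a
    ratio of linear forms separating a general orbit, and the coordinates of gP
    are polynomials in x and the corresponding root.  As X is irreducible, chi
    has no factor over C[x].

    Fix a valuation ring of C = Kbar above a prime l.  Near the origin of A the
    group law is z + w + O(|z||w|), so that a small ball contains no torsion.
    Hence the torsion values of a morphism X -> A in a small ball are all equal,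
    and a nonconstant morphism has only nontorsion values in a smaller ball.

    On a suitable line through an integral point of P^d the polynomial chi stays
    irreducible over C, and Hilbert's irreducibility theorem, over a Galois
    number field F containing all the previously constructed extensions, gives
    integral points of the line, l-adically as close to the centre as desired,
    over which chi is irreducible over F.  If P lies over such a point, then
    L = K(gP : g in G) is a G-extension linearly disjoint from F, and
    Gal(L/K) acts on the orbit of P through right translations of G.

    A linear relation between points of A(K) and the f(sigma^j P) can be
    transported by Gal(L/K).  Summing over G kills the second part, by the
    vanishing condition, so that the relation is one between the f(sigma^j P).
    Such relations form an ideal of Z[T] containing T^p - 1; as the cyclotomic
    polynomial Phi_p is irreducible and f(P) - f(sigma P) is not torsion, all
    the coefficients are equal. *)

Require Import Defs.
From HB Require Import structures.
From mathcomp Require Import all_boot all_order all_fingroup all_algebra all_solvable all_field.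
From mathcomp Require Import mpoly ring zify polyXY.
From mathcomp Require boolp classical_sets.

Set Implicit Arguments.
Unset Strict Implicit.
Unset Printing Implicit Defensive.

Import Order.TTheory GRing.Theory Num.Theory.
Local Open Scope ring_scope.

(** * Valuation rings above a prime *)

(** Kbar is not completed: there are no limits and no formal logarithm. Branches of chi are
    polynomials known modulo a power of T, and the group law of A is controlled by explicit powers
    of l. Hilbert's theorem is wanted over a field F that grows with the construction, because
    irreducibility over F yields both [L:K] = |G| and disjointness from the earlier fields. F is
    taken Galois over the rationals, so that an algebraic integer divisible by a high power of l
    under every embedding can be killed through its norm. The prime used in that argument depends on
    F; the prime that measures smallness on A is fixed once and for all. Closeness to the centre is
    built in before specializing, by replacing the parameter T of the line by l^k T. A nonconstant
    morphism may well take a torsion value at the first centre; the centre is then moved slightly,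
    off the fibre of the only torsion value possible nearby. Part (a) needs two nontorsion values at
    the same point, whence a pair of morphisms throughout. Instead of automorphisms of Kbar acting
    on points, two embeddings of L into Kbar are compared. *)

Definition alg_integer (C : fieldType) (x : C) := integralOver (intr : int -> C) x.

(** The value group of Kbar is divisible, so there is no uniformizer and powers of [l] serve as
    radii. [vr_arch] makes them cofinal: the balls [l ^ k O] shrink to 0, and a power of [l] clears
    any given denominator. *)
Record valuation_ring (C : fieldType) (l : nat) (O : C -> Prop) : Prop :=
  ValuationRing {
  vr1 : O 1;
  vrB : forall x y, O x -> O y -> O (x - y);
  vrM : forall x y, O x -> O y -> O (x * y);
  vrV : forall x, O x \/ O x^-1;
  vr_neq0 : l%:R != 0 :> C;
  vr_Nl : ~ O l%:R^-1;
  vr_arch : forall x, exists k, O (l%:R ^+ k * x) }.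

Section MaximalSubring.
Variables (C : fieldType) (l : nat).
Hypothesis l0 : l%:R != 0 :> C.

(** The condition on 1 is relative to a member of [A] so that the empty set qualifies, being the
    union of the empty chain in Zorn's lemma. A maximal set is nonempty as soon as the integers
    avoid [1 / l]. *)
Let avoids (A : C -> Prop) := 
  [/\ forall x, A x -> A 1, forall x y, A x -> A y -> A (x - y),
      forall x y, A x -> A y -> A (x * y) & ~ A l%:R^-1].

Lemma maximal_avoiding : ~ avoids (fun x => exists z : int, x = z%:~R) \/
  exists A, [/\ avoids A, A 1 &
    forall B, avoids B -> (forall x, A x -> B x) -> forall x, B x -> A x].
Proof.
have [aZ|] := boolp.EM (avoids (fun x => exists z : int, x = z%:~R)); last by left.
right; have [F FA totF|A [aA maxA]] := @classical_sets.Zorn_bigcup C avoids.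
  split.
  - by move=> x [S FS Sx]; exists S => //; have [h _ _ _] := FA _ FS; apply: h Sx.
  - move=> x y [S FS Sx] [T FT Ty]; have [ST|TS] := totF _ _ FS FT.
      by exists T => //; have [_ h _ _] := FA _ FT; apply: h => //; apply: ST.
    by exists S => //; have [_ h _ _] := FA _ FS; apply: h => //; apply: TS.
  - move=> x y [S FS Sx] [T FT Ty]; have [ST|TS] := totF _ _ FS FT.
      by exists T => //; have [_ _ h _] := FA _ FT; apply: h => //; apply: ST.
    by exists S => //; have [_ _ h _] := FA _ FS; apply: h => //; apply: TS.
  - by move=> [S FS]; have [_ _ _ h] := FA _ FS.
have maxA' B : avoids B -> (forall x, A x -> B x) -> forall x, B x -> A x.
  move=> aB AB x Bx; apply: boolp.contrapT => nAx; apply: (maxA B) => //.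
  by split=> // BA; apply: nAx; apply: BA.
exists A; split=> //.
have [[x Ax]|nA] := boolp.EM (exists x, A x); first by have [h _ _ _] := aA; apply: h Ax.
apply: (maxA' _ aZ) => [x Ax|]; first by case: nA; exists x.
by exists 1.
Qed.

Variable A : C -> Prop.
Hypotheses (aA : avoids A) (A1 : A 1).
Hypothesis maxA : forall B, avoids B -> (forall x, A x -> B x) -> forall x, B x -> A x.

Let AB x y : A x -> A y -> A (x - y). Proof. by case: aA => _ h _ _; apply: h. Qed.
Let AM x y : A x -> A y -> A (x * y). Proof. by case: aA => _ _ h _; apply: h. Qed.
Let Al : ~ A l%:R^-1. Proof. by case: aA. Qed.
Let A0 : A 0. Proof. by rewrite -(subrr 1); apply: AB. Qed.
Let AN x : A x -> A (- x). Proof. by move=> Ax; rewrite -sub0r; apply: AB. Qed.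
Let AD x y : A x -> A y -> A (x + y).
Proof. by move=> Ax Ay; rewrite -[y]opprK; apply: AB => //; apply: AN. Qed.
Let AX x n : A x -> A (x ^+ n).
Proof. by move=> Ax; elim: n => [|n IH]; rewrite ?expr0 // exprS; apply: AM. Qed.
Let An (n : nat) : A n%:R.
Proof. by elim: n => [|n IH]; rewrite ?mulr0n // -natr1; apply: AD. Qed.
Let Asum (I : Type) (r : seq I) (P : pred I) (F : I -> C) :
  (forall i, P i -> A (F i)) -> A (\sum_(i <- r | P i) F i).
Proof. by move=> h; elim/big_ind: _ => //; apply: AD. Qed.

Let linv (a : C) : 1 = l%:R * a -> l%:R^-1 = a.
Proof. by move=> e; apply: (mulfI l0); rewrite mulfV. Qed.

(** Localize [A] at the powers of [u = 1 - l a]. As [u ^ n] is 1 modulo [l A], the localization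
    still avoids [1 / l], so that it equals [A] by maximality. *)
Lemma max_avoiding_unit a : A a -> A (1 - l%:R * a)^-1.
Proof.
move=> Aa; set u := 1 - _.
have Au : A u by apply: AB => //; apply: AM => //.
have u0 : u != 0.
  rewrite /u subr_eq0; apply/eqP => e; apply: Al.
  by rewrite (linv e).
have uX n : exists2 c, A c & u ^+ n = 1 + l%:R * c.
  elim: n => [|n [c Ac e]]; first by exists 0; rewrite ?mulr0 ?addr0.
  exists (c - a - l%:R * c * a); last by rewrite exprSr e /u; ring.
  by apply: AB; [apply: AB|apply: AM => //; apply: AM].
apply: (maxA (B := fun x => exists n, A (x * u ^+ n))); last first.
- by exists 1%N; rewrite expr1 mulVf.
- by move=> x Ax; exists 0%N; rewrite expr0 mulr1.
split.
- by move=> _ _; exists 0%N; rewrite expr0 mulr1.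
- move=> x y [n Hx] [k Hy]; exists (n + k)%N.
  have -> : (x - y) * u ^+ (n + k) = x * u ^+ n * u ^+ k - y * u ^+ k * u ^+ n.
    by rewrite exprD; ring.
  by apply: AB; apply: AM => //; apply: AX.
- move=> x y [n Hx] [k Hy]; exists (n + k)%N.
  have -> : (x * y) * u ^+ (n + k) = x * u ^+ n * (y * u ^+ k) by rewrite exprD; ring.
  exact: AM.
- move=> [n]; have [c Ac ->] := uX n.
  rewrite mulrDr mulr1 mulKf // => h; apply: Al.
  by rewrite -[_^-1](addrK c); apply: AB.
Qed.

Let poly_over (p : {poly C}) := forall i, A p`_i.

(** The ring [A[x]] is strictly larger than [A], hence contains [1 / l]. *)
Lemma max_avoiding_adjoin x : ~ A x -> exists2 p, poly_over p & l%:R * p.[x] = 1.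
Proof.
move=> nAx; apply: boolp.contrapT => nex; apply: nAx.
apply: (maxA (B := fun y => exists2 p, poly_over p & y = p.[x])); last first.
- by exists 'X; rewrite ?hornerX // => i; rewrite coefX; case: eqP.
- move=> y Ay; exists y%:P; rewrite ?hornerC // => i; rewrite coefC; by case: eqP.
split.
- by move=> _ _; exists 1; rewrite ?hornerC // => i; rewrite coef1; case: eqP.
- move=> _ _ [p Ap ->] [q Aq ->]; exists (p - q); rewrite ?hornerD ?hornerN // => i.
  by rewrite coefB; apply: AB.
- move=> _ _ [p Ap ->] [q Aq ->]; exists (p * q); rewrite ?hornerM // => i.
  by rewrite coefM; apply: Asum => j _; apply: AM.
- by move=> [p Ap e]; apply: nex; exists p; rewrite // -e mulfV.
Qed.

(* Chevalley's argument: of the two relations, the one of larger degree can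
   be shortened by means of the other one. *)
Lemma max_avoiding_valuation x : A x \/ A x^-1.
Proof.
have [->|x0] := eqVneq x 0; first by left.
apply: boolp.contrapT => /boolp.not_orP[nAx nAV].
have [p0 Ap0 e0] := max_avoiding_adjoin nAx.
have [q0 Aq0 f0] := max_avoiding_adjoin nAV.
have [N] := ubnP (size p0 + size q0).
elim: N x p0 q0 x0 {nAx nAV} Ap0 e0 Aq0 f0 => // N IH x p q x0 Ap ep Aq eq leN.
have red : forall y p q, y != 0 -> poly_over p -> l%:R * p.[y] = 1 ->
    poly_over q -> l%:R * q.[y^-1] = 1 -> (size q <= size p)%N ->
    exists2 p', poly_over p' & l%:R * p'.[y] = 1 /\ (size p' < size p)%N.
  move=> {IH x p q x0 Ap ep Aq eq leN} y p q y0 Ap ep Aq eq le.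
  have [n sp] : exists n, size p = n.+2.
    case sp: (size p) => [|[|n]]; last by exists n.
      by move/eqP: sp; rewrite size_poly_eq0 => /eqP p0; move: ep; rewrite p0 horner0 mulr0 => /esym/eqP;
          rewrite oner_eq0.
    have /size_poly1P[c _ pc] : size p == 1%N by rewrite sp.
    case: Al; rewrite (linv (esym ep)) pc hornerC.
    by have := Ap 0%N; rewrite pc coefC.
  set a := p`_n.+1; set u := (1 - l%:R * q`_0)^-1.
  have Au : A u by apply: max_avoiding_unit; apply: Aq.
  have eu : u * (l%:R * \sum_(j < n.+1) q`_j.+1 * y^-1 ^+ j.+1) = 1.
    rewrite /u; have <- : 1 - l%:R * q`_0 = l%:R * \sum_(j < n.+1) q`_j.+1 * y^-1 ^+ j.+1.
      rewrite -{1}eq (@horner_coef_wide _ n.+2) ?big_ord_recl; last by rewrite -sp.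
      by rewrite expr0 mulr1 mulrDr addrAC subrr add0r.
    rewrite mulVf //; apply/eqP => /eqP; rewrite subr_eq0 => /eqP h; case: Al.
    by rewrite (linv h); apply: Aq.
  (* The leading term [a y^(n+1)] is multiplied by the expression of 1 in [eu]. Since [q] is no
     longer than [p], the products with negative powers of [y] are polynomial in [y], of degree at
     most [n]. *)
  pose p' := \poly_(i < n.+1) (p`_i + l%:R * (a * u * q`_(n - i).+1)).
  exists p'.
    move=> i; rewrite coef_poly; case: ifP => // _.
    apply: AD => //; apply: AM => //; apply: AM => //; apply: AM => //; exact: Ap.
  split; last by rewrite sp ltnS; apply: size_poly.
  transitivity (l%:R * p.[y]) => //; congr (_ * _).
  rewrite (@horner_coef_wide _ n.+2 p) ?sp // big_ord_recr /= -/a.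
  rewrite /p' horner_poly.
  transitivity (\sum_(i < n.+1) (p`_i * y ^+ i + l%:R * (a * u * q`_(n - i).+1) * y ^+ i)).
    by apply: eq_bigr => i _; rewrite -mulrDl.
  rewrite big_split /=; congr (_ + _).
  transitivity (a * y ^+ n.+1 * (u * (l%:R * \sum_(j < n.+1) q`_j.+1 * y^-1 ^+ j.+1))).
    rewrite (reindex_inj rev_ord_inj) /= !mulr_sumr; apply: eq_bigr => j _.
    have le' : (j <= n)%N by rewrite -ltnS.
    rewrite !subSS subKn //.
    have yE : y ^+ n.+1 * y^-1 ^+ j.+1 = y ^+ (n - j).
      by rewrite -{1}(subnK le') -addnS exprD exprVn mulfK // expf_neq0.
    rewrite -yE; ring.
  by rewrite eu mulr1.
have [le|/ltnW le] := leqP (size q) (size p).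
  have [p' Ap' [ep' lt']] := red x p q x0 Ap ep Aq eq le.
  by apply: (IH x p' q) => //; move: leN lt'; lia.
have xK : x = (x^-1)^-1 by rewrite invrK.
rewrite xK in ep.
have [q' Aq' [eq' lt']] := red x^-1 q p (invr_neq0 x0) Aq eq Ap ep le.
apply: (IH x p q') => //; first by rewrite xK.
by move: leN lt'; lia.
Qed.

(** If [x^-1] is in [A], dividing the monic equation of degree n+1 by [x ^ n] writes [x] as an
    integral polynomial in [x^-1]. *)
Lemma max_avoiding_int x : alg_integer x -> A x.
Proof.
move=> [p mp /rootP px].
have [//|AV] := max_avoiding_valuation x.
have [->//|x0] := eqVneq x 0.
have sp : (size p).-1.+1 = size p by rewrite prednK // size_poly_gt0 monic_neq0.
have Az (z : int) : A z%:~R by case: (intP z) => [|n|n]; rewrite ?mulrNz //; [apply: (An n.+1)|apply/AN/(An n.+1)].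
case sp' : (size p).-1 sp => [|n] sp.
  move: px; rewrite (@size1_polyC _ p) -?sp // map_polyC hornerC /=.
  have -> : p`_0 = 1 by rewrite -(monicP mp) lead_coefE sp'.
  by move/eqP; rewrite oner_eq0.
move: px; rewrite (@horner_coef_wide _ n.+2); last by rewrite (leq_trans (size_poly _ _)) // -sp.
rewrite big_ord_recr /= coef_map /=.
have -> : p`_n.+1 = 1 by rewrite -(monicP mp) lead_coefE sp'.
rewrite mul1r addrC => /eqP; rewrite addr_eq0 => /eqP e.
have -> : x = x ^+ n.+1 * x^-1 ^+ n by rewrite exprS exprVn mulfK // expf_neq0.
rewrite e mulNr; apply: AN; rewrite mulr_suml; apply: Asum => i _.
rewrite coef_map -mulrA; apply: AM => //=.
have le : (i <= n)%N by rewrite -ltnS.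
have -> : x^-1 ^+ n = x^-1 ^+ (n - i) * x^-1 ^+ i by rewrite -exprD subnK.
by rewrite mulrCA -exprMn mulfV // expr1n mulr1; apply: AX.
Qed.

Lemma max_avoiding_coprime n : coprime n l -> A n%:R^-1.
Proof.
move=> co; have [n0|n0] := posnP n.
  by rewrite n0 mulr0n invr0.
have [a b e _] := egcdnP l n0; rewrite (eqP co) in e.
have e' : 1 - l%:R * - b%:R = a%:R * n%:R :> C.
  by rewrite mulrN opprK -!natrM e natrD [(l * b)%N]mulnC addrC.
have := max_avoiding_unit (AN (An b)); rewrite e' => h.
have [nz|nz] := eqVneq (a%:R * n%:R : C) 0; last first.
  have -> : n%:R^-1 = a%:R * (a%:R * n%:R)^-1 :> C.
    by move: nz; rewrite mulf_eq0 negb_or => /andP[a0 n0']; rewrite invfM mulVKf.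
  exact: AM.
case: Al; move: e'; rewrite nz => /eqP; rewrite subr_eq0 => /eqP e1.
by rewrite (linv e1); apply: AN.
Qed.

Lemma max_avoiding_valuation_ring : prime l ->
  (forall n, (0 < n)%N -> n%:R != 0 :> C) ->
  (forall x : C, exists2 n, (0 < n)%N & alg_integer (n%:R * x)) ->
  valuation_ring l A.
Proof.
move=> pl nat0 alg; split=> //; first exact: max_avoiding_valuation.
move=> x; have [n n0 intn] := alg x.
have [m co e] := pfactor_coprime pl n0; exists (logn l n).
have m0 : m%:R != 0 :> C by apply: nat0; move: n0; rewrite e muln_gt0 => /andP[].
have -> : l%:R ^+ logn l n * x = m%:R^-1 * (n%:R * x).
  by rewrite {2}e natrM natrX mulrA mulKf.
apply: AM; first by apply: max_avoiding_coprime; rewrite coprime_sym.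
exact: max_avoiding_int.
Qed.

End MaximalSubring.

Lemma valuation_ring_exists (C : fieldType) (l : nat) :
  [pchar C] =i pred0 -> prime l ->
  (forall x : C, exists2 n, (0 < n)%N & alg_integer (n%:R * x)) ->
  exists O : C -> Prop, [/\ valuation_ring l O, forall x, alg_integer x -> O x &
    forall n, coprime n l -> O n%:R^-1].
Proof.
move=> char0 pl alg.
have nat0 n : (0 < n)%N -> n%:R != 0 :> C.
  by move=> n0; rewrite ((pcharf0P C).1 char0) -lt0n.
have l0 := nat0 l (prime_gt0 pl).
have [[]|[A [aA A1 maxA]]] := maximal_avoiding C l; last first.
  exists A; split; first exact: (max_avoiding_valuation_ring l0 aA A1 maxA).
    by move=> x; apply: (max_avoiding_int l0 aA A1 maxA).
  by move=> k; apply: (max_avoiding_coprime l0 aA A1 maxA).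
split.
- by move=> _ _; exists 1; rewrite mulr1z.
- by move=> _ _ [a ->] [b ->]; exists (a - b); rewrite rmorphB.
- by move=> _ _ [a ->] [b ->]; exists (a * b); rewrite rmorphM.
- move=> [z e]; have {}e : 1 = l%:R * z%:~R :> C by rewrite -e mulfV.
  case: (intP z) e => [|n|n].
  + by rewrite mulr0 => /eqP; rewrite oner_eq0.
  + rewrite -[_%:~R]/(n.+1%:R) -natrM => /eqP e.
    have lt1 : (1 < l * n.+1)%N by rewrite (leq_trans (prime_gt1 pl)) ?leq_pmulr.
    have := nat0 (l * n.+1 - 1)%N; rewrite subn_gt0 lt1 natrB 1?ltnW //.
    by rewrite subr_eq0 eq_sym e => /(_ isT).
  + rewrite mulrNz -[_%:~R]/(n.+1%:R) mulrN -natrM => /eqP.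
    by rewrite -addr_eq0 addrC natr1; apply/negP/nat0.
Qed.

(** * Subrings as predicates, and polynomials with coefficients in them *)

Record subring (R : pzRingType) (O : R -> Prop) : Prop := Subring {
  sr1 : O 1;
  srB : forall x y, O x -> O y -> O (x - y);
  srM : forall x y, O x -> O y -> O (x * y) }.

Section SubringTheory.
Variables (R : nzRingType) (O : R -> Prop).
Hypothesis sO : subring O.

Lemma sr0 : O 0. Proof. by rewrite -(subrr 1); apply: (srB sO); apply: (sr1 sO). Qed.

Lemma srN x : O x -> O (- x).
Proof. by move=> Ox; rewrite -sub0r; apply: (srB sO) => //; apply: sr0. Qed.

Lemma srD x y : O x -> O y -> O (x + y).
Proof. by move=> Ox Oy; rewrite -[y]opprK; apply: (srB sO) => //; apply: srN. Qed.

Lemma srX x n : O x -> O (x ^+ n).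
Proof.
move=> Ox; elim: n => [|n IH]; rewrite ?expr0 ?exprS; first exact: (sr1 sO).
exact: (srM sO).
Qed.

Lemma sr_nat n : O n%:R.
Proof.
elim: n => [|n IH]; first exact: sr0.
by rewrite -natr1; apply: srD => //; apply: (sr1 sO).
Qed.

Lemma sr_int (z : int) : O z%:~R.
Proof.
case: (intP z) => [|n|n]; rewrite ?mulrNz; first exact: sr0.
  exact: (sr_nat n.+1).
by apply/srN/(sr_nat n.+1).
Qed.

Lemma sr_sum (I : Type) (r : seq I) (P : pred I) (f : I -> R) :
  (forall i, P i -> O (f i)) -> O (\sum_(i <- r | P i) f i).
Proof. by move=> h; elim/big_ind: _ => //; [apply: sr0|apply: srD]. Qed.

Lemma sr_prod (I : Type) (r : seq I) (P : pred I) (f : I -> R) :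
  (forall i, P i -> O (f i)) -> O (\prod_(i <- r | P i) f i).
Proof. by move=> h; elim/big_ind: _ => //; [apply: (sr1 sO)|apply: (srM sO)]. Qed.

Definition coefs_in (p : {poly R}) := forall i, O p`_i.

Lemma subring_poly : subring coefs_in.
Proof.
split=> [i|p q Op Oq i|p q Op Oq i].
- by rewrite coef1; case: eqP => _; [apply: (sr1 sO)|apply: sr0].
- by rewrite coefB; apply: (srB sO).
- by rewrite coefM; apply: sr_sum => j _; apply: (srM sO).
Qed.

Lemma coefs_inC c : O c -> coefs_in c%:P.
Proof. by move=> Oc i; rewrite coefC; case: eqP => // _; apply: sr0. Qed.

Lemma coefs_inX : coefs_in 'X.
Proof. by move=> i; rewrite coefX; case: eqP => _; [apply: (sr1 sO)|apply: sr0]. Qed.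

Lemma sr_horner p x : coefs_in p -> O x -> O p.[x].
Proof.
move=> Op Ox; rewrite horner_coef; apply: sr_sum => i _.
by apply: (srM sO) => //; apply: srX.
Qed.

End SubringTheory.

Lemma subring_vr (C : fieldType) l (O : C -> Prop) : valuation_ring l O -> subring O.
Proof. by move=> [? ? ? _ _ _ _]; split. Qed.

Lemma subring_alg_integer (C : fieldType) : subring (@alg_integer C).
Proof.
split; first exact: integral1; first by move=> x y; apply: integral_sub.
by move=> x y; apply: integral_mul.
Qed.

(** * Hensel lifting and factorization modulo powers of the variable *)

Lemma horner_add_expansion (R : comNzRingType) (p : {poly R}) (x h : R) :
  exists q, p.[x + h] = p.[x] + h * p^`().[x] + h ^+ 2 * q.
Proof.
elim/poly_ind: p => [|p c [q IH]]; first by exists 0; rewrite deriv0 !horner0; ring.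
exists (p^`().[x] + q * (x + h)); rewrite derivMXaddC !hornerE IH; ring.
Qed.

Lemma poly_divX (R : nzRingType) (p : {poly R}) : p.[0] = 0 -> exists q, p = q * 'X.
Proof. by move/rootP/factor_theorem => [q ->]; exists q; rewrite subr0. Qed.

(** Newton's iteration, one power of ['X] at a time, with polynomials as truncated power series.
    Only the derivative at the starting root has to be a unit, so that [R] may itself be a
    polynomial ring, as for the generic line. The induction keeps [phi] equal to [y] modulo ['X],
    hence the derivative at 0 does not change. *)
Lemma hensel_root (R : comUnitRingType) (chi : {poly {poly R}}) (y : R) m :
  chi.[y%:P].[0] = 0 -> chi^`().[y%:P].[0] \is a GRing.unit ->
  exists phi : {poly R}, phi.[0] = y /\ exists q, chi.[phi] = q * 'X ^+ m.
Proof.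
move=> e0 u0; case: m => [|m]; first by exists y%:P; rewrite hornerC; split=> //; exists (chi.[y%:P]); rewrite mulr1.
suff [phi [e1 [phi1 e2] [q e3]]] : exists phi : {poly R}, [/\ phi.[0] = y, 
    exists f, phi = y%:P + f * 'X & exists q, chi.[phi] = q * 'X ^+ m.+1].
  by exists phi; split=> //; exists q.
elim: m => [|m [phi [e1 [f e2] [q eq]]]].
  exists y%:P; split; rewrite ?hornerC //; first by exists 0; rewrite mul0r addr0.
  by have [q ->] := poly_divX e0; exists q.
set d := chi^`().[y%:P].[0] in u0.
have ed : chi^`().[phi].[0] = d.
  have [g eg] := horner_add_expansion chi^`() y%:P (f * 'X).
  by rewrite e2 eg expr2 !(hornerD, hornerM, hornerX) !(mulr0, mul0r) !addr0.
have [g eg] := horner_add_expansion chi phi ((- (q.[0] / d))%:P * 'X ^+ m.+1).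
have [r er] : exists r, q + (- (q.[0] / d))%:P * chi^`().[phi] = r * 'X.
  by apply: poly_divX; rewrite !hornerE ed mulNr divrK // subrr.
exists (phi + (- (q.[0] / d))%:P * 'X ^+ m.+1); split.
- by rewrite hornerD e1 exprS !hornerM hornerX mul0r mulr0 addr0.
- by exists (f + (- (q.[0] / d))%:P * 'X ^+ m); rewrite {1}e2 exprSr; ring.
- rewrite eg eq; exists (r + (- (q.[0] / d))%:P ^+ 2 * 'X ^+ m * g).
  rewrite exprMn -!exprM -mulrA.
  have -> : ('X : {poly R}) ^+ (m.+1 * 2) = 'X ^+ m * 'X ^+ m.+2 by rewrite -exprD; congr (_ ^+ _); lia.
  have -> : ('X : {poly R}) ^+ m.+2 = 'X * 'X ^+ m.+1 by rewrite exprS.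
  transitivity ((q + (- (q.[0] / d))%:P * chi^`().[phi]) * 'X ^+ m.+1 +
    (- (q.[0] / d))%:P ^+ 2 * 'X ^+ m * g * ('X * 'X ^+ m.+1)); first by ring.
  by rewrite er; ring.
Qed.

Lemma poly_rem_linear (S : comNzRingType) (p : {poly S}) a :
  exists q, p = q * ('X - a%:P) + p.[a]%:P.
Proof.
have /factor_theorem[q e] : root (p - p.[a]%:P) a by rewrite rootE hornerD hornerN hornerC subrr.
by exists q; rewrite -e subrK.
Qed.

Definition regular_mod (S : comNzRingType) (t e : S) : Prop :=
  forall c, (exists d, c * e = d * t) -> exists d, c = d * t.

(* Modulo t, a monic polynomial is determined by as many roots as its degree,
   provided that the differences of the roots are not zero divisors mod t. *)
Lemma congr_prod_XsubC (S : comNzRingType) (t : S) (s : seq S) (p : {poly S}) :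
  pairwise (fun a b => boolp.asbool (regular_mod t (b - a))) s ->
  p \is monic -> size p = (size s).+1 ->
  (forall a, a \in s -> exists d, p.[a] = d * t) ->
  exists E, p = \prod_(a <- s) ('X - a%:P) + t%:P * E.
Proof.
elim: s p => [|a s IH] p /=.
  move=> _ mp /eqP/size_poly1P[c c0 ep] _; exists 0.
  by rewrite big_nil mulr0 addr0; move: mp; rewrite ep monicE lead_coefC => /eqP ->.
move=> /andP[/allP pa ps] mp sp rt.
have [d ed] := rt _ (mem_head _ _).
have [q eq] := poly_rem_linear p a.
have sq0 : (size (p.[a]%:P)%R < size p)%N by rewrite sp (leq_ltn_trans (size_polyC_leq1 _)).
have mq : q \is monic.
  have mpa : p - p.[a]%:P \is monic by rewrite monicE lead_coefDl ?size_polyN // -monicE.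
  by rewrite -(monicMr q (monicXsubC a)) -[_ * _](addrK (p.[a]%:P)) -eq.
have sq : size q = (size s).+1.
  have : size (q * ('X - a%:P)) = size p.
    by rewrite -[q * _](addrK (p.[a]%:P)) -eq size_polyDl ?size_polyN.
  by rewrite sp size_Mmonic ?monic_neq0 ?monicXsubC // size_XsubC addn2 /= => -[].
have [b sb|E eE] := IH q ps mq sq.
  have /boolp.asboolP := pa _ sb; apply.
  have [|d' ed'] := rt b; first by rewrite inE sb orbT.
  exists (d' - d); rewrite mulrBl -ed -ed' eq !hornerE; ring.
exists (E * ('X - a%:P) + d%:P); rewrite eq eE ed big_cons polyCM; ring.
Qed.

Lemma regular_mod_Xn (R : idomainType) m (e : {poly R}) :
  e.[0] != 0 -> regular_mod ('X ^+ m) e.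
Proof.
move=> e0; elim: m => [|m IH] c [d ed]; first by exists c; rewrite mulr1.
have /poly_divX[c' ec'] : c.[0] = 0.
  have /eqP := congr1 (fun p => p.[0]) ed.
  by rewrite exprSr mulrA !hornerM hornerX !mulr0 mulf_eq0 (negPf e0) orbF => /eqP.
have [|d' ed'] := IH c'; last by exists d'; rewrite ec' ed' exprSr mulrA.
exists d; apply: (@mulIf _ 'X); first by rewrite polyX_eq0.
by rewrite -mulrA [e * _]mulrC mulrA -ec' ed exprSr mulrA.
Qed.

(** * Hilbert irreducibility over a Galois number field *)

Lemma interpolation (F : fieldType) (T : eqType) (pt eta : T -> F) (s : seq T) :
  injective pt -> uniq s ->
  exists2 q : {poly F}, (size q <= size s)%N & forall x, x \in s -> q.[pt x] = eta x.
Proof.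
move=> injpt; elim: s => [|a s IH] /=; first by exists 0; rewrite ?size_poly0.
move=> /andP[nas /IH[q sq eq]]; pose w := \prod_(b <- map pt s) ('X - b%:P).
have wa : w.[pt a] != 0 by rewrite -[_ == 0]/(root w _) root_prod_XsubC mem_map.
exists (q + ((eta a - q.[pt a]) / w.[pt a]) *: w).
  rewrite (leq_trans (size_polyD _ _)) // geq_max (leq_trans sq) //=.
  by rewrite (leq_trans (size_scale_leq _ _)) // size_prod_XsubC size_map.
move=> x; rewrite inE hornerD hornerZ => /orP[/eqP ->|xs].
  by rewrite divfK // addrC subrK.
have -> : w.[pt x] = 0 by apply/eqP; rewrite -[_ == 0]/(root w _) root_prod_XsubC map_f.
by rewrite mulr0 addr0 eq.
Qed.

(* The cofactors of the last column of a Vandermonde matrix give the integer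
   combinations that annihilate all polynomials of degree < A. *)
Definition diff_coef A (x : {ffun 'I_A.+1 -> int}) (i : 'I_A.+1) : int :=
  cofactor (\matrix_(i, j < A.+1) x i ^+ j) i ord_max.

Lemma diff_coef_poly A (x : {ffun 'I_A.+1 -> int}) (F : fieldType) (q : {poly F}) :
  (size q <= A)%N -> \sum_i (diff_coef x i)%:~R * q.[(x i)%:~R] = 0.
Proof.
move=> sq; pose V := \matrix_(i, j < A.+1) x i ^+ j.
have ann (j : 'I_A.+1) : j != ord_max -> \sum_i diff_coef x i * x i ^+ j = 0.
  move=> jm; have := congr1 (fun M : 'M_A.+1 => M ord_max j) (mul_adj_mx V).
  rewrite !mxE eq_sym (negPf jm) mulr0n => e; rewrite -[RHS]e; apply: eq_bigr => i _.
  by rewrite !mxE.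
transitivity (\sum_(j < A.+1) q`_j * (\sum_i diff_coef x i * x i ^+ j)%:~R).
  under eq_bigr => i _ do rewrite (@horner_coef_wide _ A.+1) ?(leq_trans sq) // mulr_sumr.
  rewrite exchange_big; apply: eq_bigr => j _; rewrite rmorph_sum mulr_sumr.
  by apply: eq_bigr => i _; rewrite rmorphM rmorphXn /= mulrCA.
apply: big1 => j _; have [->|jm] := eqVneq j ord_max; last by rewrite ann // mulr0.
by rewrite nth_default ?mul0r // sq.
Qed.

Lemma diff_coef_max A (x : {ffun 'I_A.+1 -> int}) : injective x ->
  diff_coef x ord_max != 0.
Proof.
move=> injx; rewrite /diff_coef /cofactor mulf_neq0 ?expf_neq0 ?oppr_eq0 ?oner_eq0 //.
set M := row' _ _.
have -> : M = (Vandermonde A (\row_i x (lift ord_max i)))^T.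
  by apply/matrixP => i j; rewrite !mxE lift_max.
rewrite det_tr det_Vandermonde; apply/prodf_neq0 => i _; apply/prodf_neq0 => j ij.
rewrite !mxE subr_eq0 (inj_eq injx) (inj_eq lift_inj) eq_sym.
by rewrite -(inj_eq val_inj) /= neq_ltn ij.
Qed.

(** Interpolate at the first [A] nodes. For any other node the relation on these [A + 1] nodes holds
    both for [eta] and for the interpolant, and the coefficient at the new node is a nonzero
    Vandermonde determinant. *)
Lemma interpolation_of_relations (F : fieldType) A (s : seq int) (eta : int -> F) :
  [pchar F] =i pred0 -> uniq s ->
  (forall x : {ffun 'I_A.+1 -> int}, injective x -> (forall i, x i \in s) ->
     \sum_i (diff_coef x i)%:~R * eta (x i) = 0) ->
  exists2 q : {poly F}, (size q <= A)%N & forall u, u \in s -> q.[u%:~R] = eta u.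
Proof.
move=> char0 us rel; pose s1 := take A s.
have injR : injective (intr : int -> F).
  move=> a b /eqP; rewrite -subr_eq0 -rmorphB /= => /eqP h; apply/eqP; rewrite -subr_eq0; apply/eqP; move: h.
  case: (intP (a - b)) => [//|n|n]; rewrite ?mulrNz => /eqP.
    by rewrite -[_%:~R]/(n.+1%:R) ((pcharf0P F).1 char0).
  by rewrite oppr_eq0 -[_%:~R]/(n.+1%:R) ((pcharf0P F).1 char0).
have [q sq eq] := interpolation eta injR (take_uniq A us).
have {}sq : (size q <= A)%N by rewrite (leq_trans sq) // size_take; case: ltnP.
exists q => // u us_; have [u1|u1] := boolP (u \in s1).
  by rewrite eq.
have sA : (A < size s)%N.
  by rewrite ltnNge; apply: contra u1 => le; rewrite /s1 take_oversize.
have ss1 : size s1 = A by rewrite size_take sA.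
(* As [s1] has size [A], the default value of [nth] puts [u] at the last index. *)
pose x := [ffun i : 'I_A.+1 => nth u s1 i].
have xl (i : 'I_A.+1) : i != ord_max -> x i \in s1.
  move=> im; rewrite ffunE mem_nth // ss1 ltn_neqAle -ltnS ltn_ord andbT.
  by apply: contra im => /eqP im; apply/eqP/val_inj.
have xm : x ord_max = u by rewrite ffunE nth_default ?ss1.
have injx : injective x.
  move=> i j; have [->|im] := eqVneq i ord_max; have [->|jm] := eqVneq j ord_max => //.
  - by rewrite xm => e; move: u1; rewrite e xl.
  - by rewrite xm => e; move: u1; rewrite -e xl.
  - have lt k : k != ord_max :> 'I_A.+1 -> (k < size s1)%N.
      move=> km; rewrite ss1 ltn_neqAle -ltnS ltn_ord andbT.
      by apply: contra km => /eqP im'; apply/eqP/val_inj.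
    rewrite !ffunE => /eqP; rewrite nth_uniq ?lt ?take_uniq // => /eqP; exact: val_inj.
have /(rel x injx) r0 : forall i, x i \in s.
  move=> i; have [->|im] := eqVneq i ord_max; first by rewrite xm.
  by have /mem_take := xl i im.
have := congr2 (fun a b => a - b) r0 (diff_coef_poly x sq); rewrite subrr -sumrB.
rewrite (bigD1 ord_max) //= big1 ?addr0 => [|i im].
  rewrite -mulrBr xm => /eqP; rewrite mulf_eq0 subr_eq0 => /orP[|/eqP //].
  by rewrite (_ : 0 = 0%:~R) // (inj_eq injR) (negPf (diff_coef_max injx)).
by rewrite -mulrBr eq ?subrr ?mulr0 // xl.
Qed.

(** * Divisibility by powers of l in the valuation ring *)

Definition vdiv (C : fieldType) (l : nat) (O : C -> Prop) (m : nat) (x : C) :=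
  exists2 b, O b & x = l%:R ^+ m * b.

Section VDiv.
Variables (C : fieldType) (l : nat) (O : C -> Prop).
Hypothesis vO : valuation_ring l O.
Let sO := subring_vr vO.

Lemma vdiv0 m : vdiv l O m 0.
Proof. by exists 0; [apply: sr0|rewrite mulr0]. Qed.

Lemma vdivB m x y : vdiv l O m x -> vdiv l O m y -> vdiv l O m (x - y).
Proof. by move=> [b Ob ->] [c Oc ->]; exists (b - c); [apply: srB|rewrite mulrBr]. Qed.

Lemma vdivN m x : vdiv l O m x -> vdiv l O m (- x).
Proof. by move=> [b Ob ->]; exists (- b); [apply: srN|rewrite mulrN]. Qed.

Lemma vdivD m x y : vdiv l O m x -> vdiv l O m y -> vdiv l O m (x + y).
Proof. by move=> [b Ob ->] [c Oc ->]; exists (b + c); [apply: srD|rewrite mulrDr]. Qed.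

Lemma vdivMl m x y : O x -> vdiv l O m y -> vdiv l O m (x * y).
Proof. by move=> Ox [c Oc ->]; exists (x * c); [apply: srM|rewrite mulrCA]. Qed.

Lemma vdivMr m x y : vdiv l O m x -> O y -> vdiv l O m (x * y).
Proof. by move=> vx Oy; rewrite mulrC; apply: vdivMl. Qed.

Lemma vdiv_sum m (I : Type) (r : seq I) (P : pred I) (f : I -> C) :
  (forall i, P i -> vdiv l O m (f i)) -> vdiv l O m (\sum_(i <- r | P i) f i).
Proof. by move=> h; elim/big_ind: _ => //; [apply: vdiv0|apply: vdivD]. Qed.

Lemma vdivO m x : vdiv l O m x -> O x.
Proof. by move=> [b Ob ->]; apply: srM => //; apply: srX => //; apply: sr_nat. Qed.

Lemma vdiv_le m m' x : (m' <= m)%N -> vdiv l O m x -> vdiv l O m' x.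
Proof.
move=> le [b Ob ->]; exists (l%:R ^+ (m - m') * b); last by rewrite mulrA -exprD subnKC.
by apply: srM => //; apply: srX => //; apply: sr_nat.
Qed.

Lemma vdiv1 m : (0 < m)%N -> ~ vdiv l O m 1.
Proof.
case: m => // m _ [b Ob e]; apply: (vr_Nl vO).
have -> : l%:R^-1 = l%:R ^+ m * b.
  by apply: (mulfI (vr_neq0 vO)); rewrite mulfV ?(vr_neq0 vO) // mulrA -exprS.
by apply: srM => //; apply: srX => //; apply: sr_nat.
Qed.

(* A valuation ring is local. *)
Lemma vr_unit_sub x y : O (x - y)^-1 -> x - y != 0 -> O x -> O y ->
  x != 0 /\ O x^-1 \/ y != 0 /\ O y^-1.
Proof.
have wlog_ : forall x y, O (x - y)^-1 -> x - y != 0 -> O x -> O y -> O (x / y) -> y != 0 ->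
    O y^-1.
  move=> {}x {}y OV xy Ox Oy Oxy y0.
  have -> : y^-1 = (x - y)^-1 * (x / y - 1).
    by apply: (mulfI xy); rewrite mulVKf // mulrBl mulfV.
  by apply: srM => //; apply: srB => //; apply: sr1.
move=> OV xy Ox Oy.
have [y0|y0] := eqVneq y 0; first by left; move: xy OV; rewrite y0 subr0.
have [x0|x0] := eqVneq x 0.
  by right; split=> //; move: OV; rewrite x0 sub0r invrN => /(srN sO); rewrite opprK.
have [Oxy|] := vrV vO (x / y); first by right; split=> //; apply: (wlog_ x y).
rewrite invf_div => Oyx; left; split=> //; apply: (wlog_ y x) => //; last by rewrite -opprB oppr_eq0.
by rewrite -opprB invrN; apply: srN.
Qed.

(** The differences are units, so at most one factor is a nonunit (the ring is local) and this one
    carries the whole divisibility of the product. *)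
Lemma vdiv_prod_factor m (s : seq C) : (0 < m)%N ->
  (forall x, x \in s -> O x) ->
  pairwise (fun x y => (x != y) && boolp.asbool (O (x - y)^-1)) s ->
  vdiv l O m (\prod_(x <- s) x) -> exists2 x, x \in s & vdiv l O m x.
Proof.
move=> m0; elim: s => [|x s IH] Os /=.
  by rewrite big_nil => _ /(vdiv1 m0).
rewrite big_cons => /andP[/allP px ps] v.
have Ox := Os x (mem_head _ _).
have Os' y : y \in s -> O y by move=> ys; apply: Os; rewrite inE ys orbT.
have [[x0 OV]|nx] := boolp.EM (x != 0 /\ O x^-1).
  have [|y ys vy] := IH Os' ps; last by exists y => //; rewrite inE ys orbT.
  by rewrite -[\prod_(_ <- _) _](mulKf x0); apply: vdivMl.
exists x; first exact: mem_head.
have us : forall y, y \in s -> y != 0 /\ O y^-1.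
  move=> y ys; have /andP[xy /boolp.asboolP OV] := px y ys.
  by have [||] := @vr_unit_sub x y OV _ Ox (Os' y ys); rewrite ?subr_eq0.
have p0 : \prod_(y <- s) y != 0.
  by rewrite prodf_seq_neq0; apply/allP => y /us[].
rewrite -[x](mulfK p0); apply: vdivMr => //.
by rewrite -prodfV big_seq; apply: sr_prod => // y /us[].
Qed.

End VDiv.

(** A prime above all the denominators is coprime to them, and their inverses lie in [O]. *)
Lemma good_prime (C : fieldType) (xs : seq C) : [pchar C] =i pred0 ->
  (forall x : C, exists2 n, (0 < n)%N & alg_integer (n%:R * x)) ->
  exists l O, [/\ prime l, @valuation_ring C l O, forall x, alg_integer x -> O x &
    forall x, x \in xs -> O x].
Proof.
move=> char0 alg; have [N N0 hN] : exists2 N, (0 < N)%N &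
    forall x, x \in xs -> exists2 n, (0 < n <= N)%N & alg_integer (n%:R * x).
  elim: xs => [|x xs [N N0 IH]]; first by exists 1%N.
  have [n n0 int] := alg x; exists (n + N)%N; first by lia.
  move=> y; rewrite inE => /orP[/eqP ->|/IH[k kN inty]].
    by exists n => //; lia.
  by exists k => //; lia.
have [l Nl pl] := prime_above N.
have [O [vO intO cop]] := valuation_ring_exists char0 pl alg.
exists l, O; split=> // x /hN[n nN intx].
have n0 : n%:R != 0 :> C by rewrite ((pcharf0P C).1 char0) -lt0n; lia.
rewrite -[x](mulKf n0); apply: (vrM vO); last exact: intO.
apply: cop; rewrite coprime_sym prime_coprime //; apply/negP => /dvdn_leq; lia.
Qed.

Lemma coefs_in_mem (C : nzRingType) (O : C -> Prop) (p : {poly C}) : O 0 ->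
  (forall x, x \in (p : seq C) -> O x) -> coefs_in O p.
Proof.
move=> O0 h i; have [lt|le] := ltnP i (size p); first exact/h/mem_nth.
by rewrite nth_default.
Qed.

(** The polynomial [r] is [a^d p(Z / a)]; it is monic with the integral coefficients [a^(d - i) p_i]
    and has the root [a y]. *)
Lemma integral_scale (C : fieldType) (p : {poly C}) (a y : C) : p \is monic ->
  alg_integer a -> (forall j, alg_integer (a * p`_j)) -> root p y ->
  alg_integer (a * y).
Proof.
move=> mp ia ip py; have sA := subring_alg_integer C.
have [d sp] : exists d, size p = d.+1.
  by exists (size p).-1; rewrite prednK // size_poly_gt0 monic_neq0.
have pd : p`_d = 1 by have := monicP mp; rewrite lead_coefE sp.
pose r := \poly_(i < d.+1) (a ^+ (d - i) * p`_i).
have rd : r`_d = 1 by rewrite coef_poly ltnSn subnn mul1r.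
have mr : r \is monic.
  have sr : size r = d.+1.
    apply/eqP; rewrite eqn_leq size_poly /= ltnNge; apply/negP => /leq_sizeP/(_ d (leqnn _)).
    by rewrite rd => /eqP; rewrite oner_eq0.
  by rewrite monicE lead_coefE sr rd.
apply: (integral_root_monic mr).
  rewrite rootE horner_poly; apply/eqP; have /rootP := py.
  rewrite horner_coef sp => /(congr1 (fun z => a ^+ d * z)); rewrite mulr0 mulr_sumr => e.
  rewrite -[RHS]e; apply: eq_bigr => i _.
  have le : (i <= d)%N by rewrite -ltnS.
  have -> : a ^+ d = a ^+ (d - i) * a ^+ i by rewrite -exprD subnK.
  by rewrite exprMn; ring.
move=> _ /(nthP 0)[i lt <-]; rewrite coef_poly; case: ifP => lid; last exact: (sr0 sA).
have [->|ne] := eqVneq i d; first by rewrite subnn mul1r pd; apply: (sr1 sA).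
have -> : (d - i = (d - i).-1.+1)%N by rewrite prednK // subn_gt0 ltn_neqAle ne -ltnS.
by rewrite exprSr -mulrA; apply: (srM sA) => //; apply: (srX sA).
Qed.

Lemma natr_absz_sign (R : pzRingType) (c : int) :
  `|c|%N%:R = (-1) ^+ (c < 0)%R * c%:~R :> R.
Proof. by rewrite -rmorphMsign -normrEsign -abszE pmulrn. Qed.

Lemma algebraic_integral_multiple (C : fieldType) (i : {rmorphism rat -> C}) x :
  algebraicOver i x -> exists2 n, (0 < n)%N & alg_integer (n%:R * x).
Proof.
move=> [p p0 px]; have sA := subring_alg_integer C.
have [q [a a0 e]] := rat_poly_scale p.
have iz (z : int) : i z%:~R = z%:~R by rewrite rmorph_int.
have zi (z : int) : z != 0 -> z%:~R != 0 :> C.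
  by move=> z0; rewrite -iz fmorph_eq0 intr_eq0.
have qx : root (map_poly intr q) x.
  move: px; rewrite e map_polyZ rootZ ?fmorph_eq0 ?invr_eq0 ?intr_eq0 // -map_poly_comp.
  by rewrite (eq_map_poly iz).
have q0 : q != 0 by apply: contraNneq p0 => q0; rewrite e q0 map_poly0 scaler0.
set c := lead_coef q; have c0 : c%:~R != 0 :> C by rewrite zi // lead_coef_eq0.
have lq : lead_coef (map_poly intr q : {poly C}) = c%:~R.
  by rewrite lead_coef_map_eq // -/c.
have ic : alg_integer (c%:~R * x).
  apply: (@integral_scale _ (c%:~R^-1 *: map_poly intr q)).
  - by rewrite monicE lead_coefZ lq mulVf.
  - exact: sr_int.
  - by move=> j; rewrite coefZ mulVKf // coef_map; apply: sr_int.
  - by rewrite rootZ // invr_eq0.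
exists `|c|%N; first by rewrite absz_gt0 lead_coef_eq0.
have -> : `|c|%N%:R * x = (-1) ^+ (c < 0)%R * (c%:~R * x) :> C.
  by rewrite natr_absz_sign mulrA.
by apply: (srM sA) => //; apply: srX => //; apply: srN => //; apply: sr1.
Qed.

Lemma algC_integral_multiple (x : algC) : exists2 n, (0 < n)%N & alg_integer (n%:R * x).
Proof.
apply: (@algebraic_integral_multiple _ (@ratr algC)); apply/integral_algebraic.
exact: Algebraics.Implementation.algebraic.
Qed.

Lemma alg_integer_Aint (x : algC) : alg_integer x -> x \in Aint.
Proof.
move=> [p mp px]; apply: root_monic_Aint px _ _; first exact: monic_map.
by apply/polyOverP => i; rewrite coef_map /= intr_int.
Qed.

Lemma alg_integer_rmorph (F C : fieldType) (f : {rmorphism F -> C}) x :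
  alg_integer x -> alg_integer (f x).
Proof.
move=> /(integral_rmorph f)[p mp px]; exists p => //; move: px.
by rewrite (@eq_map_poly _ _ _ intr) // => z; rewrite /= rmorph_int.
Qed.

(** * Integers of a Galois number field that are small at all places *)

Section SmallNorm.
Variables (F : splittingFieldType rat) (nu : {rmorphism F -> algC}).
Hypothesis galF : galois 1%AS {:F}.
Variables (l : nat) (O : algC -> Prop).
Hypotheses (pl : prime l) (vO : valuation_ring l O).

(** By Bezout the gcd of [z] and [l ^ m] is divisible by [l ^ m] in [O]. It is a power [l ^ b], and
    [b < m] would make 1 divisible by [l]. *)
Lemma vdiv_int_eq0 m (z : int) : vdiv l O m z%:~R -> (`|z| < l ^ m)%N -> z = 0.
Proof.
move=> vz lt; apply/eqP; rewrite -absz_eq0; apply/negPn/negP; rewrite -lt0n => z0.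
have sO := subring_vr vO.
have vd : vdiv l O m (gcdn `|z| (l ^ m))%:R.
  have [a c e _] := egcdnP (l ^ m) z0.
  have -> : (gcdn `|z| (l ^ m))%:R = a%:R * `|z|%N%:R - c%:R * (l%:R ^+ m) :> algC.
    by rewrite -natrX -!natrM e natrD addrAC subrr add0r.
  apply: (vdivB vO); last by apply: vdivMl => //; [apply: sr_nat|exists 1; [apply: sr1|rewrite mulr1]].
  apply: vdivMl => //; first exact: sr_nat.
  by rewrite natr_absz_sign; apply: vdivMl => //; apply: srX => //; apply: srN => //; apply: sr1.
have /(dvdn_pfactor _ _ pl)[b _ eb] := dvdn_gcdr `|z| (l ^ m).
have ltb : (b < m)%N.
  rewrite -(ltn_exp2l _ _ (prime_gt1 pl)) -eb (leq_ltn_trans _ lt) //.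
  by apply: dvdn_leq => //; apply: dvdn_gcdl.
move: vd; rewrite eb natrX => -[c Oc e]; apply: (@vdiv1 _ _ _ vO (m - b)); first by rewrite subn_gt0.
exists c => //; apply: (mulfI (expf_neq0 b (vr_neq0 vO))).
by rewrite mulr1 mulrA -exprD subnKC // ltnW.
Qed.

(** Product formula: the norm is an integer divisible by [l ^ (m * #|Gal|)] and smaller than this
    number. A single ring [O] suffices because its pull-backs along the embeddings [nu \o tau]
    account for all the places above [l]. *)
Lemma galois_small_eq0 m (delta : F) : alg_integer delta ->
  (forall tau : gal_of {:F}, vdiv l O m (nu (tau delta))) ->
  (forall tau : gal_of {:F}, `|nu (tau delta)| < (l ^ m)%:R) -> delta = 0.
Proof.
move=> idelta vdelta lt; have sO := subring_vr vO.
set N := galNorm 1%AS {:F} delta; set Gal := 'Gal({:F} / 1)%g.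
have Nfix : N \in 1%VS.
  by rewrite -((galois_fixedField galF)) galNorm_fixedField // memvf.
have eN : nu N = \prod_(tau in Gal) nu (tau delta) by rewrite rmorph_prod.
have [z ez] : exists z : int, nu N = z%:~R.
  apply/intrP/Cint_rat_Aint.
    by have /vlineP[r ->] := Nfix; rewrite rmorphZ_num rmorph1 mulr1 Crat_rat.
  apply: alg_integer_Aint; rewrite eN; apply: (sr_prod (subring_alg_integer _)) => tau _.
  by do 2!apply: alg_integer_rmorph.
have vN : vdiv l O (m * #|Gal|) (nu N).
  rewrite eN -sum1_card; elim/big_rec2: _ => [|tau y k _ IH].
    by rewrite muln0; exists 1; [apply: sr1|rewrite mulr1].
  have [c Oc ec] := IH; have [b Ob eb] := vdelta tau.
  by exists (b * c); [apply: srM|rewrite ec eb mulnDr muln1 exprD; ring].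
have Gal0 : (0 < #|Gal|)%N by rewrite cardG_gt0.
have ltN : `|nu N| < (l ^ (m * #|Gal|))%:R.
  rewrite eN normr_prod expnM natrX -prodr_const.
  apply: ltr_prod => [|tau _]; last by rewrite normr_ge0 lt.
  by apply/hasP; exists 1%g; rewrite ?mem_index_enum ?group1.
have z0 : z = 0.
  apply: (@vdiv_int_eq0 (m * #|Gal|)); first by rewrite -ez.
  by rewrite -(ltr_nat algC) (le_lt_trans _ ltN) // ez natr_absz intr_norm.
by apply/eqP; rewrite -(galNorm_eq0 1%AS {:F}) -(fmorph_eq0 nu) -/N ez z0.
Qed.
End SmallNorm.

(** Convention: [chi] is chi(T, Z) with Z outside and T inside the coefficients; [evp t] sets T =
    t. *)
Definition evp (R : comNzRingType) (t : R) (chi : {poly {poly R}}) : {poly R} :=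
  map_poly (horner_eval t) chi.

Lemma evp_horner (R : comNzRingType) (t y : R) chi : chi.[y%:P].[t] = (evp t chi).[y].
Proof. by rewrite -[LHS]/(horner_eval t _) -horner_map /= /horner_eval hornerC. Qed.

Lemma evp_monic (R : comNzRingType) (t : R) chi : chi \is monic -> evp t chi \is monic.
Proof. exact: monic_map. Qed.

Lemma size_evp (R : comNzRingType) (t : R) chi : chi \is monic -> size (evp t chi) = size chi.
Proof. by move=> m; rewrite size_map_poly_id0 // (monicP m) rmorph1 oner_eq0. Qed.

Lemma evp_prod (R : comNzRingType) (t : R) (I : Type) (s : seq I) (phi : I -> {poly R}) :
  evp t (\prod_(i <- s) ('X - (phi i)%:P)) = \prod_(i <- s) ('X - ((phi i).[t])%:P).
Proof.
rewrite /evp rmorph_prod; apply: eq_bigr => i _.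
by rewrite rmorphB /= map_polyX map_polyC.
Qed.

Lemma evpD (R : comNzRingType) (t : R) p q : evp t (p + q) = evp t p + evp t q.
Proof. exact: rmorphD. Qed.

Lemma evpM (R : comNzRingType) (t : R) p q : evp t (p * q) = evp t p * evp t q.
Proof. exact: rmorphM. Qed.

Lemma evpC (R : comNzRingType) (t : R) c : evp t c%:P = (c.[t])%:P.
Proof. exact: map_polyC. Qed.

Lemma evp_map (R S : comNzRingType) (f : {rmorphism R -> S}) (t : R) chi :
  map_poly f (evp t chi) = evp (f t) (map_poly (map_poly f) chi).
Proof.
rewrite /evp -!map_poly_comp; apply: eq_map_poly => c /=.
by rewrite /horner_eval horner_map.
Qed.

Lemma root_bound (p : {poly algC}) w : p \is monic -> root p w ->
  `|w| <= 1 + \sum_(i < (size p).-1) `|p`_i|.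
Proof.
move=> mp pw; have S0 : 0 <= \sum_(i < (size p).-1) `|p`_i| by apply: sumr_ge0.
have [le|lt] := real_leP (normr_real w) (@real1 algC).
  by rewrite (le_trans le) // lerDl.
apply: (@le_trans _ _ (\sum_(i < (size p).-1) `|p`_i|)); last by rewrite lerDr ler01.
have sp : (size p).-1.+1 = size p by rewrite prednK // size_poly_gt0 monic_neq0.
have w0 : 0 < `|w| by rewrite (lt_trans ltr01).
case: (size p).-1 (mp) sp S0 => [|d] mp' sp S0.
  move: pw; rewrite (@size1_polyC _ p) -?sp // rootC.
  have -> : p`_0 = 1 by rewrite -(monicP mp) lead_coefE -sp.
  by rewrite oner_eq0.
have pd : p`_d.+1 = 1 by rewrite -(monicP mp) lead_coefE -sp.
move: pw => /rootP; rewrite horner_coef -sp big_ord_recr /= pd mul1r => /eqP.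
rewrite addrC addr_eq0 => /eqP/(congr1 Num.norm).
rewrite normrX normrN => e.
rewrite -(ler_pM2r (exprn_gt0 d w0)) -exprS e (le_trans (ler_norm_sum _ _ _)) //.
rewrite mulr_suml; apply: ler_sum => i _; rewrite normrM normrX.
by rewrite ler_wpM2l // ler_weXn2l ?ltW // -ltnS.
Qed.

Lemma coef_prod_bound (s : seq algC) W j : (forall w, w \in s -> `|w| <= W) ->
  `|(\prod_(w <- s) ('X - w%:P))`_j| <= (1 + W) ^+ size s.
Proof.
elim: s j => [|w s IH] j h; rewrite ?big_nil ?big_cons.
  by rewrite coef1; case: eqP; rewrite ?normr1 ?normr0 ?ler01.
have h' v : v \in s -> `|v| <= W by move=> vs; rewrite h // inE vs orbT.
have W0 : 0 <= W by rewrite (le_trans (normr_ge0 w)) // h ?mem_head.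
rewrite mulrBl coefB coefXM mul_polyC coefZ exprS mulrDl mul1r.
rewrite (le_trans (ler_normB _ _)) // lerD //.
  by case: eqP => _; rewrite ?normr0 ?exprn_ge0 ?addr_ge0 ?ler01 ?IH.
by rewrite normrM ler_pM // ?IH // h ?mem_head.
Qed.

Lemma horner_nat_bound (c : {poly algC}) D (t : nat) : (0 < t)%N -> (size c <= D.+1)%N ->
  `|c.[t%:R]| <= (\sum_(i < D.+1) `|c`_i|) * t%:R ^+ D.
Proof.
move=> t0 sc; rewrite (horner_coef_wide _ sc) (le_trans (ler_norm_sum _ _ _)) //.
rewrite mulr_suml; apply: ler_sum => i _; rewrite normrM normrX normr_nat.
by rewrite ler_wpM2l // ler_weXn2l ?ler1n // -ltnS.
Qed.

(** Each of the distinct roots of chi(0, Z) lifts to a branch modulo T^A by [hensel_root], and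
    distinct constant terms make the branches independent enough for [congr_prod_XsubC]. *)
Lemma local_factorization (C : closedFieldType) (chi : {poly {poly C}}) A :
  chi \is monic -> separable_poly (evp 0 chi) -> (0 < A)%N ->
  exists phis E, [/\ uniq [seq f.[0] | f : {poly C} <- phis], (size phis).+1 = size chi &
    chi = \prod_(f <- phis) ('X - f%:P) + ('X ^+ A)%:P * E].
Proof.
move=> mchi sep A0; have [ys eys] := closed_field_poly_normal (evp 0 chi).
rewrite (monicP (evp_monic 0 mchi)) scale1r in eys.
have uys : uniq ys by rewrite -separable_prod_XsubC -eys.
have H y : y \in ys -> exists f : {poly C}, f.[0] = y /\ exists q, chi.[f] = q * 'X ^+ A.
  move=> yys; apply: hensel_root.
    by rewrite evp_horner; apply/rootP; rewrite eys root_prod_XsubC.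
  have ry : root (evp 0 chi) y by rewrite eys root_prod_XsubC.
  rewrite evp_horner /evp -deriv_map -/(evp 0 chi) unitfE.
  have /factor_theorem[q eq] := ry; rewrite eq in sep *.
  move: sep; rewrite separable_root => /andP[_ nq].
  by rewrite derivM derivXsubC !hornerE subrr mulr0 add0r.
have H' y : exists f : {poly C}, y \in ys -> f.[0] = y /\ exists q, chi.[f] = q * 'X ^+ A.
  have [yys|nys] := boolP (y \in ys); last by exists 0.
  by have [f hf] := H y yys; exists f.
have [f ef] := boolp.choice H'.
exists (map f ys).
have e0 : [seq g.[0] | g : {poly C} <- map f ys] = ys.
  by rewrite -map_comp -[RHS]map_id; apply/eq_in_map => y /ef[].
have sz : (size (map f ys)).+1 = size chi.
  by rewrite size_map -(size_evp 0 mchi) eys size_prod_XsubC.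
have [||||E eE] := @congr_prod_XsubC _ ('X ^+ A) (map f ys) chi.
- rewrite pairwise_map; apply: (@sub_in_pairwise _ (mem ys) (fun a b => a != b)) => //; last first.
    by rewrite -uniq_pairwise.
  move=> a b as_ bs ab; apply/boolp.asboolP/regular_mod_Xn.
  have [[ea _] [eb _]] := (ef a as_, ef b bs).
  by rewrite hornerD hornerN ea eb subr_eq0 eq_sym.
- exact: mchi.
- by rewrite sz.
- by move=> _ /mapP[y yys ->]; have [_] := ef y yys.
- by exists E; split; rewrite ?e0.
Qed.

(** * Approximation of the factors of chi(T, Z) for T divisible by a power of l *)

Section Approximation.
Variables (C : closedFieldType) (l : nat) (O : C -> Prop).
Hypothesis vO : valuation_ring l O.
Let sO := subring_vr vO.

Lemma vr_unit_1 c : O c -> 1 - l%:R * c != 0 /\ O (1 - l%:R * c)^-1.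
Proof.
move=> Oc; have [||||//|[n0 h]] := @vr_unit_sub _ _ _ vO (1 - l%:R * c) (- (l%:R * c)).
- by rewrite opprK subrK invr1; apply: sr1.
- by rewrite opprK subrK oner_eq0.
- by apply: srB => //; [apply: sr1|apply: srM => //; apply: sr_nat].
- by apply: srN => //; apply: srM => //; apply: sr_nat.
case: (vr_Nl vO); have c0 : c != 0 by apply: contraNneq n0 => ->; rewrite mulr0 oppr0.
have -> : l%:R^-1 = - c * (- (l%:R * c))^-1.
  by rewrite invrN mulrNN invfM mulrCA mulfV // mulr1.
by apply: srM => //; apply: srN.
Qed.

Lemma vr_unit_congr x y : O x -> x != 0 -> O x^-1 -> vdiv l O 1 (y - x) -> y != 0 /\ O y^-1.
Proof.
move=> Ox x0 OV [b Ob e]; have [n0 ON] := vr_unit_1 (srM sO (srN sO Ob) OV).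
have -> : y = x * (1 - l%:R * (- b / x)).
  rewrite mulrBr mulr1 mulrCA [x * _]mulrC divfK // mulrN opprK.
  by rewrite -[l%:R]expr1 -e addrC subrK.
by rewrite mulf_neq0 // invfM; split=> //; apply: srM.
Qed.

Lemma vdiv_horner (f : {poly C}) m x y : coefs_in O f -> O x -> O y ->
  vdiv l O m (x - y) -> vdiv l O m (f.[x] - f.[y]).
Proof.
move=> Of Ox Oy v; rewrite !horner_coef -sumrB; apply: (vdiv_sum vO) => i _.
rewrite -mulrBr; apply: vdivMl => //; rewrite subrXX; apply: vdivMr => //.
by apply: sr_sum => // j _; apply: srM => //; apply: srX.
Qed.

Variables (chi : {poly {poly C}}) (phis : seq {poly C}) (E : {poly {poly C}}) (A : nat).
Hypotheses (A0 : (0 < A)%N) (Ophis : forall f, f \in phis -> coefs_in O f).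
Hypothesis Uphis : pairwise (fun f g : {poly C} =>
  (f.[0] != g.[0]) && boolp.asbool (O (f.[0] - g.[0])^-1)) phis.
Hypotheses (OE : coefs_in (coefs_in O) E)
  (eChi : chi = \prod_(f <- phis) ('X - f%:P) + ('X ^+ A)%:P * E).
Variables (k u : nat).
Hypothesis k0 : (0 < k)%N.
Let T : C := (l ^ k * u)%:R.

Lemma vdivT : vdiv l O k T.
Proof. by exists u%:R; [apply: sr_nat|rewrite /T natrM natrX]. Qed.

Lemma vdivTX m : vdiv l O (k * m) (T ^+ m).
Proof.
exists (u%:R ^+ m); first by apply: srX => //; apply: sr_nat.
by rewrite /T natrM exprMn natrX -exprM.
Qed.

Let OT : O T. Proof. exact: sr_nat. Qed.

(** At a root [w] the product of the [w - f(T)] equals [- T^A E(T, w)], which is divisible by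
    [l ^ (k A)]. As [f(T)] and [f(0)] agree modulo [l], the differences of the branches remain units
    at T and [vdiv_prod_factor] applies. *)
Lemma root_near w : O w -> root (evp T chi) w ->
  exists2 f, f \in phis & vdiv l O (k * A) (w - f.[T]).
Proof.
move=> Ow rw; have e : \prod_(f <- phis) (w - f.[T]) = - (T ^+ A * (evp T E).[w]).
  have /rootP := rw; rewrite eChi evpD evpM evpC evp_prod hornerXn !hornerE horner_prod.
  move/eqP; rewrite addr_eq0 => /eqP <-.
  by apply: eq_bigr => f _; rewrite !hornerE.
have [||||_ /mapP[f fs ->] v] := @vdiv_prod_factor _ _ _ vO (k * A) [seq w - f.[T] | f : {poly C} <- phis].
- by rewrite muln_gt0 k0.
- move=> _ /mapP[f fs ->]; apply: srB => //; apply: sr_horner => //; exact: Ophis.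
- rewrite pairwise_map; apply: (sub_in_pairwise (P := mem phis)) Uphis; last by apply/allP.
  move=> f g fs gs /andP[fg /boolp.asboolP OV] /=.
  have O0 h : h \in phis -> O h.[0].
    by move=> hs; apply: sr_horner => //; [apply: Ophis|apply: sr0].
  have v1 (h : {poly C}) : h \in phis -> vdiv l O 1 (h.[T] - h.[0]).
    move=> hs; apply: vdiv_horner => //; [exact: Ophis|exact: sr0|].
    by rewrite subr0; apply: vdiv_le k0 vdivT.
  have [] := @vr_unit_congr (g.[0] - f.[0]) (g.[T] - f.[T]).
  + by apply: srB => //; apply: O0.
  + by rewrite subr_eq0 eq_sym.
  + by rewrite -opprB invrN; apply: srN.
  + have -> : forall a b c d : C, a - b - (c - d) = (a - c) - (b - d) by move=> *; ring.
    by apply: vdivB => //; apply: v1.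
  + move=> n0 On; rewrite -subr_eq0.
    have -> : w - f.[T] - (w - g.[T]) = g.[T] - f.[T] by ring.
    by rewrite n0; apply/boolp.asboolP.
- by rewrite big_map e; apply: vdivN => //; apply: vdivMr; [|exact: vdivTX|
    apply: sr_horner => // i; rewrite coef_map; apply: sr_horner].
by exists f.
Qed.

(** Up to [l ^ (k A)] a factor depends on T only through the choice [gs] of branches, for which
    there are finitely many possibilities. Truncation to degree below [A] costs nothing, since T^A
    is itself divisible by [l ^ (k A)]. *)
Lemma approx_factor (s : seq C) : (forall w, w \in s -> O w /\ root (evp T chi) w) ->
  exists gs : seq 'I_(size phis), size gs = size s /\ forall j, vdiv l O (k * A)
    ((\prod_(w <- s) ('X - w%:P))`_j - (take_poly A (\prod_(i <- gs) ('X - (phis`_i)%:P))`_j).[T]).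
Proof.
move=> hs; have [gs [sgs hgs]] : exists gs : seq 'I_(size phis), size gs = size s /\
  forall j, vdiv l O (k * A)
    ((\prod_(w <- s) ('X - w%:P))`_j - (\prod_(i <- gs) ('X - (phis`_i).[T]%:P))`_j).
  elim: s hs => [|w s IH] hs.
    by exists [::]; split=> // j; rewrite !big_nil subrr; apply: vdiv0.
  have [|gs [sgs hgs]] := IH; first by move=> v vs; apply: hs; rewrite inE vs orbT.
  have [Ow rw] := hs w (mem_head _ _).
  have [f fs vf] := root_near Ow rw; have fi : (index f phis < size phis)%N by rewrite index_mem.
  exists (Ordinal fi :: gs); split=> [|j]; first by rewrite /= sgs.
  rewrite !big_cons /= nth_index //; set P := \prod_(_ <- s) _; set Q := \prod_(_ <- gs) _.
  have -> : (('X - w%:P) * P)`_j - (('X - (f.[T])%:P) * Q)`_j =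
      (if j == 0%N then 0 else P`_j.-1 - Q`_j.-1) - w * (P`_j - Q`_j) - (w - f.[T]) * Q`_j.
    rewrite !mulrBl !coefB !coefXM !mul_polyC !coefZ; case: eqP => _; ring.
  apply: vdivB => //; last first.
    apply: vdivMr => //; have : coefs_in O Q; last exact.
    rewrite /Q; elim: (gs) => [|i r IHr]; first by rewrite big_nil; apply: (sr1 (subring_poly sO)).
    rewrite big_cons; apply: (srM (subring_poly sO)) => //.
    apply: (srB (subring_poly sO)); first exact: coefs_inX.
    by apply: coefs_inC => //; apply: sr_horner => //; apply/Ophis/mem_nth.
  apply: vdivB => //; last exact: vdivMl.
  by case: eqP => _; [apply: vdiv0|].
exists gs; split=> // j; set R := \prod_(i <- gs) _.
have -> : (\prod_(w <- s) ('X - w%:P))`_j - (take_poly A R`_j).[T] =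
  ((\prod_(w <- s) ('X - w%:P))`_j - (R`_j).[T]) + ((R`_j).[T] - (take_poly A R`_j).[T]) by ring.
apply: vdivD => //.
  have -> : (R`_j).[T] = (evp T R)`_j by rewrite coef_map.
  by rewrite /R evp_prod.
rewrite -{1}[R`_j](poly_take_drop A) hornerD addrAC subrr add0r hornerM hornerXn.
apply: vdivMl => //; last exact: vdivTX.
apply: sr_horner => // i; rewrite coef_drop_poly; move: (i + A)%N; move: {i}j.
have : coefs_in (coefs_in O) R; last exact.
rewrite /R; elim: (gs) => [|a r IHr]; first by rewrite big_nil; apply: (sr1 (subring_poly (subring_poly sO))).
rewrite big_cons; apply: (srM (subring_poly (subring_poly sO))) => //.
apply: (srB (subring_poly (subring_poly sO))); first exact: (coefs_inX (subring_poly sO)).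
by apply: (coefs_inC (subring_poly sO)); apply/Ophis/mem_nth.
Qed.

End Approximation.

Lemma monic_factor (F : fieldType) (p : {poly F}) : p \is monic -> (1 < size p)%N ->
  ~ irreducible_poly p -> exists p1 p2,
  [/\ p1 \is monic, p2 \is monic, p1 * p2 = p & (1 < size p1)%N && (1 < size p2)%N].
Proof.
move=> mp sp nirr; apply: boolp.contrapT => nex; apply: nirr; split=> // q sq qp.
apply: boolp.contrapT => nqp; apply: nex.
have p0 := monic_neq0 mp; have q0 : q != 0 by apply: contraNneq p0 => q0; rewrite q0 dvd0p in qp.
have lq : lead_coef q != 0 by rewrite lead_coef_eq0.
pose p1 := (lead_coef q)^-1 *: q.
have m1 : p1 \is monic by rewrite monicE lead_coefZ mulVf.
have d1 : p1 %| p by rewrite dvdpZl // invr_eq0.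
have e : p1 * (p %/ p1) = p by rewrite mulrC divpK.
have s1 : size p1 = size q by rewrite size_scale // invr_eq0.
have m2 : p %/ p1 \is monic by rewrite -(monicMr _ m1) mulrC e.
exists p1, (p %/ p1); split=> //; apply/andP; split.
  by rewrite s1 ltn_neqAle eq_sym sq size_poly_gt0.
rewrite ltnNge; apply/negP => s2; apply: nqp.
have s2' : size (p %/ p1) == 1%N by rewrite eqn_leq s2 size_poly_gt0 monic_neq0.
have /size_poly1P[c c0 ec] := s2'.
have c1 : c = 1 by move: m2; rewrite ec monicE lead_coefC => /eqP.
by rewrite -e ec c1 mulr1 eqp_sym eqp_scale // invr_eq0.
Qed.

(** The combinations are taken at the nodes [u <= M] and not at [l ^ k * u], so that this bound is
    independent of [k], which is chosen after it. *)
Definition diff_coef_bound A M : nat :=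
  (\sum_(y : {ffun 'I_A.+1 -> 'I_M.+1}) \sum_i `|diff_coef [ffun i => Posz (y i)] i|)%N.

Lemma diff_coef_boundP A M (x : {ffun 'I_A.+1 -> int}) :
  (forall i, exists2 u : nat, (u <= M)%N & x i = u) ->
  (\sum_i `|diff_coef x i| <= diff_coef_bound A M)%N.
Proof.
move=> hx; pose y := [ffun i => inord `|x i| : 'I_M.+1].
have -> : x = [ffun i => Posz (y i)].
  by apply/ffunP => i; rewrite !ffunE; have [u le ->] := hx i; rewrite absz_nat inordK.
by rewrite /diff_coef_bound (bigD1 y) //= leq_addr.
Qed.

Lemma pigeonhole (T : finType) M B (cl : 'I_M -> T) : (#|T| * B < M)%N ->
  exists t, (B < #|[set u | cl u == t]|)%N.
Proof.
move=> lt; apply: boolp.contrapT => nex.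
have h t : (#|[set u | cl u == t]| <= B)%N.
  by rewrite leqNgt; apply/negP => lt'; apply: nex; exists t.
move: lt; rewrite ltnNge => /negP; apply.
rewrite -[X in (X <= _)%N]card_ord -sum1_card (partition_big cl predT) //=.
rewrite -sum_nat_const; apply: leq_sum => t _.
rewrite sum1_card; apply: leq_trans (h t).
by apply/eq_leq/eq_card => u; rewrite inE.
Qed.

Lemma alg_integer_fmorph (F C : fieldType) (f : {rmorphism F -> C}) x :
  alg_integer (f x) -> alg_integer x.
Proof.
move=> [p mp px]; exists p => //; rewrite -(fmorph_root f) -map_poly_comp.
by rewrite (@eq_map_poly _ _ _ intr) // => z; rewrite /= rmorph_int.
Qed.

Lemma pchar_number_field (F : fieldExtType rat) : [pchar F] =i pred0.
Proof. by move=> x; rewrite pchar_lalg pchar_num. Qed.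

Lemma size_comp_scaleX (F : fieldType) (c : F) (p : {poly F}) :
  (size (p \Po (c *: 'X)) <= size p)%N.
Proof.
have [->|p0] := eqVneq p 0; first by rewrite comp_poly0 size_poly0.
rewrite (leq_trans (size_comp_poly_leq _ _)) //.
have sp : (0 < size p)%N by rewrite size_poly_gt0.
have sc := leq_trans (size_scale_leq c 'X) (eq_leq (size_polyX F)).
by rewrite -[X in (_ <= X)%N](prednK sp) ltnS -[X in (_ <= X)%N]muln1 leq_mul2l -[1%N]/(2.-1) -!subn1 leq_sub2r ?orbT.
Qed.

Section Interpolate.
Variables (F : splittingFieldType rat) (nu : {rmorphism F -> algC}).
Hypothesis galF : galois 1%AS {:F}.
Variables (l : nat) (O : algC -> Prop).
Hypotheses (pl : prime l) (vO : valuation_ring l O).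

(** The combination with coefficients [diff_coef] annihilates [Psi(l^k u)], of degree below [A] in
    [u], and thus sees [eta] only through an error divisible by [l ^ (k A)]. After multiplication by
    the common denominator [b] the result is an algebraic integer to which [galois_small_eq0]
    applies. *)
Lemma coef_interpolation (A k M b N : nat) (S : seq nat) (eta : nat -> F)
  (Psi : gal_of {:F} -> {poly algC}) :
  (0 < b)%N -> uniq S -> (forall u, u \in S -> (u <= M)%N) ->
  (forall u, u \in S -> alg_integer (b%:R * eta u)) ->
  (forall tau, (size (Psi tau) <= A)%N) ->
  (forall u (tau : gal_of {:F}), u \in S ->
     vdiv l O (k * A) (nu (tau (eta u)) - (Psi tau).[(l ^ k * u)%:R])) ->
  (forall u (tau : gal_of {:F}), u \in S -> `|nu (tau (eta u))| <= N%:R) ->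
  (b * (diff_coef_bound A M * N) < l ^ (k * A))%N ->
  exists2 q : {poly F}, (size q <= A)%N & forall u, u \in S -> q.[(l ^ k * u)%:R] = eta u.
Proof.
move=> b_gt0 uS SM inte sPsi near bnd lt; have sO := subring_vr vO.
have char0 := @pchar_number_field F.
have nat0 m : (0 < m)%N -> m%:R != 0 :> F by move=> m0; rewrite ((pcharf0P F).1 char0) -lt0n.
have uPS : uniq (map Posz S) by rewrite map_inj_uniq // => ? ? [].
have [x injx xS|q sq eq] := @interpolation_of_relations F A (map Posz S) (fun z => eta `|z|%N) char0 uPS.
- set delta := \sum_i _; apply/eqP; rewrite -(mulrI_eq0 _ (mulfI (nat0 b b_gt0))); apply/eqP.
  have xu i : exists2 u : nat, u \in S & x i = u by have /mapP[u uS' e] := xS i; exists u.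
  have embE (tau : gal_of {:F}) : nu (tau (b%:R * delta)) =
      b%:R * \sum_i (diff_coef x i)%:~R * nu (tau (eta `|x i|%N)).
    rewrite !rmorphM !rmorph_nat; congr (_ * _); rewrite !rmorph_sum.
    by apply: eq_bigr => i _; rewrite !rmorphM !rmorph_int.
  apply: (@galois_small_eq0 F nu galF l O pl vO (k * A)) => [|tau|tau].
  + rewrite mulr_sumr; apply: (sr_sum (subring_alg_integer F)) => i _.
    rewrite mulrCA; apply: (srM (subring_alg_integer F)); first exact: (sr_int (subring_alg_integer F)).
    by have [u uS' ->] := xu i; rewrite absz_nat; apply: inte.
  + rewrite embE; apply: vdivMl => //; first exact: sr_nat.
    have sq := leq_trans (size_comp_scaleX (l ^ k)%:R (Psi tau)) (sPsi tau).
    rewrite -[X in vdiv _ _ _ X]subr0 -[X in _ - X](diff_coef_poly x sq).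
    rewrite -sumrB; apply: (vdiv_sum vO) => i _; rewrite -mulrBr.
    apply: vdivMl => //; first exact: sr_int.
    have [u uS' ->] := xu i; rewrite absz_nat horner_comp hornerZ hornerX.
    by rewrite -[(Posz u)%:~R]/(u%:R) -natrM; apply: near.
  + rewrite embE normrM normr_nat.
    have le : `|\sum_i (diff_coef x i)%:~R * nu (tau (eta `|x i|%N))| <= (diff_coef_bound A M * N)%:R.
      rewrite (le_trans (ler_norm_sum _ _ _)) //.
      apply: (@le_trans _ _ ((\sum_i `|diff_coef x i|)%N%:R * N%:R)); last first.
        rewrite -natrM ler_nat leq_mul2r diff_coef_boundP ?orbT // => i.
        by have [u uS' ->] := xu i; exists u => //; apply: SM.
      rewrite natr_sum mulr_suml; apply: ler_sum => i _; rewrite normrM natr_absz intr_norm.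
      by apply: ler_wpM2l => //; have [u uS' ->] := xu i; rewrite absz_nat; apply: bnd.
    rewrite (le_lt_trans (ler_wpM2l (ler0n _ b) le)) // -natrM ltr_nat //.
(* The interpolant was built in the variable [u]; it is rescaled to the variable [l ^ k * u]. *)
exists (q \Po ((l ^ k)%:R^-1 *: 'X)).
  exact: leq_trans (size_comp_scaleX _ _) sq.
move=> u uS'; rewrite horner_comp hornerZ hornerX natrM mulKf; last first.
  by rewrite nat0 // expn_gt0 prime_gt0.
by have := eq (Posz u) (map_f _ uS').
Qed.
End Interpolate.

Lemma uniform_root_bound (chi : {poly {poly algC}}) D : chi \is monic ->
  (forall i, (size (chi`_i)%R <= D.+1)%N) ->
  exists W : nat, forall (t : nat) w, (0 < t)%N -> root (evp t%:R chi) w ->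
    `|w| <= W%:R * t%:R ^+ D.
Proof.
move=> mchi sc; pose S := 1 + \sum_(i < (size chi).-1) \sum_(j < D.+1) `|chi`_i`_j|.
have S0 : 0 <= S by rewrite addr_ge0 ?ler01 // sumr_ge0 // => i _; apply: sumr_ge0.
exists (Num.bound S) => t w t0 rw.
have tD : 1 <= t%:R ^+ D :> algC by rewrite -natrX ler1n expn_gt0 t0.
have := root_bound (evp_monic _ mchi) rw; rewrite size_evp // => h.
apply: (le_trans h); apply: (@le_trans _ _ (S * t%:R ^+ D)).
  rewrite mulrDl mul1r lerD // mulr_suml; apply: ler_sum => i _.
  rewrite coef_map /= /horner_eval; exact: horner_nat_bound.
by rewrite ler_wpM2r ?(le_trans ler01) // ltW // archi_boundP.
Qed.

Lemma common_multiple (F : fieldType) (xs : seq F) :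
  (forall x : F, exists2 n, (0 < n)%N & alg_integer (n%:R * x)) ->
  exists2 a, (0 < a)%N & forall x, x \in xs -> alg_integer (a%:R * x).
Proof.
move=> alg; elim: xs => [|x xs [a a0 IH]]; first by exists 1%N.
have [n n0 intn] := alg x; exists (a * n)%N; first by rewrite muln_gt0 a0.
have sA := subring_alg_integer F.
move=> y; rewrite inE natrM => /orP[/eqP ->|/IH h]; first by rewrite -mulrA; apply: (srM sA) => //; apply: sr_nat.
by rewrite mulrAC; apply: (srM sA) => //; apply: sr_nat.
Qed.

Lemma integral_coef_prod (C : fieldType) (a : nat) (s : seq C) j :
  (forall w, w \in s -> alg_integer (a%:R * w)) ->
  alg_integer (a%:R ^+ size s * (\prod_(w <- s) ('X - w%:P))`_j).
Proof.
have sA := subring_alg_integer C.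
elim: s j => [|w s IH] j h.
  rewrite big_nil mul1r coef1; case: eqP => _; [exact: (sr1 sA)|exact: (sr0 sA)].
have {}IH i : alg_integer (a%:R ^+ size s * (\prod_(w <- s) ('X - w%:P))`_i).
  by apply: IH => v vs; apply: h; rewrite inE vs orbT.
rewrite big_cons mulrBl coefB coefXM mul_polyC coefZ /= exprS.
have -> : forall a b c d e : C, a * b * (c - d * e) = a * (b * c) - (a * d) * (b * e) by move=> *; ring.
apply: (srB sA); apply: (srM sA) => //; first exact: sr_nat.
- by case: eqP => _; rewrite ?mulr0; [apply: sr0|].
- by apply: h; rewrite mem_head.
Qed.

Lemma leq_expl m1 m2 e : (m1 <= m2)%N -> (m1 ^ e <= m2 ^ e)%N.
Proof. by move=> le; elim: e => // e IH; rewrite !expnS leq_mul. Qed.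

(** * The irreducibility theorem *)

Section HilbertIrreducibility.
Variables (F : splittingFieldType rat) (nu : {rmorphism F -> algC}).
Hypothesis galF : galois 1%AS {:F}.
Variable chi : {poly {poly F}}.
Hypotheses (mchi : chi \is monic) (schi : (1 < size chi)%N).
Hypothesis sep0 : separable_poly (evp 0 chi).

Let emb (tau : gal_of {:F}) : {rmorphism F -> algC} := (nu \o (tau : F -> F)).
Let chiT tau := map_poly (map_poly (emb tau)) chi.
Let n := (size chi).-1.

Let mchiT tau : chiT tau \is monic. Proof. exact: monic_map. Qed.

Let evpT tau (t : nat) : evp t%:R (chiT tau) = map_poly (emb tau) (evp t%:R chi).
Proof. by rewrite evp_map rmorph_nat. Qed.

Let sepT tau : separable_poly (evp 0 (chiT tau)).
Proof. by rewrite -(rmorph0 (emb tau)) -evp_map separable_map. Qed.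

Let D := \max_(i < size chi) size (chi`_i)%R.

Let sD i : (size (chi`_i)%R <= D)%N.
Proof.
have [lt|le] := ltnP i (size chi); last by rewrite nth_default // size_poly0.
by rewrite (leq_bigmax (Ordinal lt)).
Qed.

Let sDT tau i : (size ((chiT tau)`_i)%R <= D.+1)%N.
Proof. by rewrite coef_map size_map_poly leqW. Qed.

(** At T = l^k u the coefficients of a factor are at most a constant times l^(k D n). The precision
    l^(k A) then leaves one spare factor l^k to absorb all the constants. *)
Let A := (D * n).+1.

Let F_alg (x : F) : exists2 n, (0 < n)%N & alg_integer (n%:R * x).
Proof.
have [k k0 h] := algC_integral_multiple (nu x); exists k => //.
by apply: (@alg_integer_fmorph _ _ nu); rewrite rmorphM rmorph_nat.
Qed.

(* Uniform in all the places of F above l *)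
Lemma hit_places : exists (a l : nat) (O : algC -> Prop) phis E,
  [/\ [/\ (0 < a)%N, prime l, valuation_ring l O & forall x, alg_integer x -> O x],
   O a%:R^-1, forall i j, alg_integer (a%:R * chi`_i`_j) &
   forall tau, [/\ size (phis tau) = n, forall f : {poly algC}, f \in phis tau -> coefs_in O f,
     pairwise (fun f g : {poly algC} => (f.[0] != g.[0]) && boolp.asbool (O (f.[0] - g.[0])^-1)) (phis tau),
     coefs_in (coefs_in O) (E tau) &
     chiT tau = \prod_(f <- phis tau) ('X - f%:P) + ('X ^+ A)%:P * E tau]].
Proof.
have [a a0 ha] := common_multiple (flatten [seq (c : seq F) | c : {poly F} <- (chi : seq {poly F})]) F_alg.
have loc tau := local_factorization (mchiT tau) (sepT tau) (ltn0Sn (D * n)).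
have [phis {}loc] := boolp.choice loc; have [E {}loc] := boolp.choice loc.
pose coefs (p : {poly {poly algC}}) := flatten [seq (c : seq algC) | c : {poly algC} <- (p : seq {poly algC})].
(* The finitely many numbers required to lie in [O]: the coefficients of the branches and of the
   error terms, and the inverse differences of the branches at T = 0. *)
pose xs tau := flatten [seq (f : seq algC) | f : {poly algC} <- phis tau] ++ coefs (E tau) ++
  [seq (f.[0] - g.[0])^-1 | f : {poly algC} <- phis tau, g : {poly algC} <- phis tau].
have [l [O [pl vO intO hxs]]] := good_prime (a%:R^-1 :: flatten [seq xs tau | tau <- enum {: gal_of {:F}}])
  (@pchar_num algC) algC_integral_multiple.
have sO := subring_vr vO.
have Oa : O a%:R^-1 by apply: hxs; rewrite mem_head.
have {}hxs tau x : x \in xs tau -> O x.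
  move=> xx; apply: hxs; rewrite inE; apply/orP; right; apply/flattenP; exists (xs tau) => //.
  by rewrite map_f // mem_enum.
exists a, l, O, phis, E; split=> //.
- move=> i j; have [lt|le] := ltnP j (size (chi`_i)%R); last by rewrite nth_default // mulr0; apply: (sr0 (subring_alg_integer F)).
  apply: ha; apply/flattenP; exists (chi`_i : seq F); last exact: mem_nth.
  apply/map_f/mem_nth; rewrite ltnNge; apply: contraL lt => le.
  by rewrite nth_default // size_poly0.
move=> tau; have [uphis sphis ephis] := loc tau; split=> //.
- by apply: succn_inj; rewrite sphis /n prednK ?(ltnW schi) // /chiT size_map_poly_id0 // (monicP mchi) rmorph1 oner_eq0.
- move=> f ff; apply: coefs_in_mem; first exact: sr0.
  move=> x xf; apply: (hxs tau); rewrite mem_cat; apply/orP; left.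
  by apply/flattenP; exists (f : seq algC) => //; apply: map_f.
- move: uphis; rewrite uniq_pairwise pairwise_map; apply: (sub_in_pairwise (P := mem (phis tau))); last exact/allP.
  move=> f g ff gg /= ->; apply/boolp.asboolP; apply: (hxs tau).
  by rewrite !mem_cat; do 2!(apply/orP; right); apply/allpairsP; exists (f, g).
- apply: coefs_in_mem; first exact: (sr0 (subring_poly sO)).
  move=> c cE; apply: coefs_in_mem; first exact: sr0.
  move=> x xc; apply: (hxs tau); rewrite !mem_cat; apply/orP; right; apply/orP; left.
  by apply/flattenP; exists (c : seq algC) => //; apply: map_f.
Qed.


Section Factors.
Variables (a l k M W : nat) (O : algC -> Prop).
Variables (phis : gal_of {:F} -> seq {poly algC}) (E : gal_of {:F} -> {poly {poly algC}}).
Hypotheses (a0 : (0 < a)%N) (pl : prime l) (vO : valuation_ring l O).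
Hypotheses (intO : forall x, alg_integer x -> O x) (Oa : O a%:R^-1).
Hypothesis ha : forall i j, alg_integer (a%:R * chi`_i`_j).
Hypothesis loc : forall tau,
  [/\ size (phis tau) = n, forall f : {poly algC}, f \in phis tau -> coefs_in O f,
     pairwise (fun f g : {poly algC} => (f.[0] != g.[0]) && boolp.asbool (O (f.[0] - g.[0])^-1)) (phis tau),
     coefs_in (coefs_in O) (E tau) &
     chiT tau = \prod_(f <- phis tau) ('X - f%:P) + ('X ^+ A)%:P * E tau].
Hypothesis hW : forall tau t w, (0 < t)%N -> root (evp t%:R (chiT tau)) w ->
  `|w| <= W%:R * t%:R ^+ D.
Hypothesis k0 : (0 < k)%N.

Let Psi tau (gs : seq 'I_n) j : {poly algC} :=
  take_poly A (\prod_(i <- gs) ('X - ((phis tau)`_i)%:P))`_j.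
Let N := (((1 + W) * (l ^ k * M) ^ D) ^ n)%N.

(** The roots of a factor are among those of chi(T, Z), for which integrality, size and closeness to
    the branches are known; these pass to the coefficients as symmetric functions of the roots. *)
Lemma hit_factor u (p q : {poly F}) : (0 < u <= M)%N -> p \is monic ->
  p * q = evp (l ^ k * u)%:R chi ->
  [/\ forall j, alg_integer ((a ^ n)%:R * p`_j),
     forall tau j, `|emb tau p`_j| <= N%:R &
     forall tau, exists gs : n.-bseq 'I_n, size gs = (size p).-1 /\
       forall j, vdiv l O (k * A) (emb tau p`_j - (Psi tau gs j).[(l ^ k * u)%:R])].
Proof.
move=> /andP[u0 uM] mp epq; have sA := subring_alg_integer algC; have sO := subring_vr vO.
have T0 : (0 < l ^ k * u)%N by rewrite muln_gt0 u0 expn_gt0 prime_gt0.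
have H tau : exists s, [/\ map_poly (emb tau) p = \prod_(w <- s) ('X - w%:P), (size s = (size p).-1)%N,
    (size s <= n)%N & forall w, w \in s -> [/\ root (evp (l ^ k * u)%:R (chiT tau)) w,
      alg_integer (a%:R * w) & O w]].
  have [s es] := closed_field_poly_normal (map_poly (emb tau) p).
  have mp' : map_poly (emb tau) p \is monic by apply: monic_map.
  rewrite (monicP mp') scale1r in es.
  have ss : size s = (size p).-1.
    by rewrite -(size_map_poly_id0 (f := emb tau) (p := p)) ?es ?size_prod_XsubC // (monicP mp) rmorph1 oner_eq0.
  have sn : (size s <= n)%N.
    rewrite ss /n -!subn1 leq_sub2r // -(size_evp (l ^ k * u)%:R mchi) -epq.
    have mq : q \is monic by rewrite -(monicMr _ mp) mulrC epq evp_monic.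
    rewrite size_Mmonic ?monic_neq0 //.
    have sq : (0 < size q)%N by rewrite size_poly_gt0 monic_neq0.
    by rewrite -(prednK sq) addnS /= leq_addr.
  exists s; split=> // w ws.
  have rw : root (evp (l ^ k * u)%:R (chiT tau)) w.
    by rewrite evpT -epq rmorphM /= rootM es root_prod_XsubC ws.
  have iw : alg_integer (a%:R * w).
    have hc i j : alg_integer (a%:R * ((chiT tau)`_i)`_j).
      by rewrite /chiT coef_map /= coef_map -(rmorph_nat (emb tau)) -rmorphM; apply: alg_integer_rmorph.
    apply: (integral_scale (evp_monic _ (mchiT tau)) _ _ rw); first exact: sr_nat.
    move=> i; rewrite coef_map /= /horner_eval horner_coef mulr_sumr; apply: (sr_sum sA) => j _.
    rewrite mulrA; apply: (srM sA); last by apply: (srX sA); apply: sr_nat.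
    exact: hc.
  split=> //; have an0 : a%:R != 0 :> algC by rewrite pnatr_eq0 -lt0n.
  by rewrite -[w](mulKf an0); apply: srM => //; apply: intO.
split=> [j|tau j|tau].
- have [s [es ss sn hs]] := H 1%g.
  apply: (@alg_integer_fmorph _ _ (emb 1%g)); rewrite rmorphM rmorph_nat -coef_map es.
  rewrite -(subnK sn) natrX exprD -mulrA; apply: (srM sA); first by apply: (srX sA); apply: sr_nat.
  by apply: integral_coef_prod => w /hs[].
- have [s [es ss sn hs]] := H tau.
  rewrite -coef_map es; have hs' w : w \in s -> `|w| <= W%:R * (l ^ k * u)%:R ^+ D.
    by move=> /hs[rw _ _]; apply: hW T0 rw.
  apply: (le_trans (coef_prod_bound _ hs')).
  have le1 : 1 + W%:R * (l ^ k * u)%:R ^+ D <= ((1 + W) * (l ^ k * M) ^ D)%:R :> algC.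
    rewrite -natrX -natrM -[1](mulr1n 1) -natrD ler_nat mulnDl mul1n leq_add //.
      by rewrite expn_gt0 muln_gt0 expn_gt0 prime_gt0 // (leq_trans u0).
    by rewrite leq_mul2l leq_expl ?orbT // leq_mul2l uM orbT.
  have g0 : 0 <= 1 + W%:R * (l ^ k * u)%:R ^+ D :> algC by rewrite -natrX -natrM -[1](mulr1n 1) -natrD ler0n.
  apply: (@le_trans _ _ ((((1 + W) * (l ^ k * M) ^ D)%:R) ^+ size s)).
    by rewrite lerXn2r // ?nnegrE ?ler0n.
  have N0 : (0 < (1 + W) * (l ^ k * M) ^ D)%N.
    by rewrite muln_gt0 add1n /= expn_gt0 muln_gt0 expn_gt0 prime_gt0 // (leq_trans u0).
  by rewrite /N natrX ler_weXn2l // ler1n.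
- have [sphi Ophis Uphis OE eChi] := loc tau; have [s [es ss sn hs]] := H tau.
  have [|gs [sgs hgs]] := @approx_factor _ _ _ vO _ _ _ A (ltn0Sn _) Ophis Uphis OE eChi k u k0 s.
    by move=> w /hs[].
  have sz : (size (map (cast_ord sphi) gs) <= n)%N by rewrite size_map sgs.
  exists (Bseq sz); split=> [|j]; first by rewrite /= size_map sgs.
  by rewrite -coef_map es /Psi /= big_map; apply: hgs.
Qed.
End Factors.

(* If chi(T, Z) were reducible over F for all T = l^k u with u <= M, then two
   factors of the same type would interpolate: the divided differences of their
   coefficients are divisible by a high power of l at all the places of F above
   l and bounded at the infinite ones, hence vanish. *)
Theorem hilbert_irreducibility :
  (forall P Q, P \is monic -> Q \is monic -> P * Q = chi -> size P = 1%N \/ size Q = 1%N) ->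
  exists t : nat, irreducible_poly (evp t%:R chi).
Proof.
move=> nofac; apply: boolp.contrapT => nex.
have [a [l [O [phis [E [[a0 pl vO intO] Oa ha loc]]]]]] := hit_places.
have [Wf hWf] := boolp.choice (fun tau => uniform_root_bound (mchiT tau) (sDT tau)).
pose W := (\sum_tau Wf tau)%N.
have hW tau t w : (0 < t)%N -> root (evp t%:R (chiT tau)) w -> `|w| <= W%:R * t%:R ^+ D.
  move=> t0 rw; apply: (le_trans (hWf tau t w t0 rw)).
  by rewrite ler_wpM2r ?exprn_ge0 ?ler0n // ler_nat /W (bigD1 tau) //= leq_addr.
(* The type of a factorization: for each embedding, the branches that approximate each of the two
   factors. *)
pose cT : finType := {ffun gal_of {:F} -> n.-bseq 'I_n * n.-bseq 'I_n}.
(* [B] bounds the degree in T of the coefficients of [P * Q - chi], for [P] and [Q] interpolated in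
   degree below [A]. Among [M] nodes some type occurs more than [B] times. *)
pose B := (A + A + D)%N; pose M := (#|cT| * B).+1.
(* All the constants that do not depend on [k]; [k] is chosen so that the spare factor [l ^ k]
   exceeds them. *)
pose K := (a ^ n * (diff_coef_bound A M * ((1 + W) * M ^ D) ^ n))%N.
have [k k0 ltK] : exists2 k, (0 < k)%N & (K < l ^ k)%N.
  by exists K.+1 => //; apply: leq_ltn_trans (leqnSn K) (ltn_expl _ (prime_gt1 pl)).
pose N := (((1 + W) * (l ^ k * M) ^ D) ^ n)%N.
have ltN : (a ^ n * (diff_coef_bound A M * N) < l ^ (k * A))%N.
  have -> : (a ^ n * (diff_coef_bound A M * N) = K * l ^ (k * (D * n)))%N.
    have gen x y w m L e r :
        (x * (y * (w * (L * m) ^ e) ^ r) = x * (y * (w * m ^ e) ^ r) * L ^ (e * r))%N.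
      rewrite !expnMn expnM; move: (w ^ r)%N ((L ^ e) ^ r)%N ((m ^ e) ^ r)%N => *; ring.
    by rewrite [(l ^ (k * _))%N]expnM -gen.
  by rewrite /A mulnS expnD ltn_mul2r expn_gt0 prime_gt0.
pose T u := (l ^ k * u)%N.
have fac u : exists pq : {poly F} * {poly F}, [/\ pq.1 \is monic, pq.2 \is monic,
    pq.1 * pq.2 = evp (T u)%:R chi & (1 < size pq.1)%N && (1 < size pq.2)%N].
  have [||irr|p [q h]] := @monic_factor F (evp (T u)%:R chi); last by exists (p, q).
  - exact: evp_monic.
  - by rewrite size_evp.
  - by apply: nex; exists (T u).
have [pq hpq] := boolp.choice fac.
pose Psi tau (gs : seq 'I_n) j : {poly algC} :=
  take_poly A (\prod_(i <- gs) ('X - ((phis tau)`_i)%:P))`_j.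
have hf1 u (hu : (0 < u <= M)%N) : _ := let: And4 m1 _ e _ := hpq u in
  hit_factor a0 pl vO intO Oa ha loc hW k0 hu m1 e.
have hf2 u (hu : (0 < u <= M)%N) : _ := let: And4 _ m2 e _ := hpq u in
  hit_factor a0 pl vO intO Oa ha loc hW k0 hu m2 (etrans (mulrC _ _) e).
have cls (u : 'I_M) : exists c : cT, forall tau,
    [/\ size (c tau).1 = (size (pq u.+1).1).-1, size (c tau).2 = (size (pq u.+1).2).-1,
     forall j, vdiv l O (k * A) (emb tau (pq u.+1).1`_j - (Psi tau (c tau).1 j).[(T u.+1)%:R]) &
     forall j, vdiv l O (k * A) (emb tau (pq u.+1).2`_j - (Psi tau (c tau).2 j).[(T u.+1)%:R])].
  have hu : (0 < u.+1 <= M)%N by rewrite ltn_ord.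
  have [_ _ h1] := hf1 _ hu; have [_ _ h2] := hf2 _ hu.
  have [g1 hg1] := boolp.choice h1; have [g2 hg2] := boolp.choice h2.
  exists [ffun tau => (g1 tau, g2 tau)] => tau; rewrite ffunE /=.
  by have [? ?] := hg1 tau; have [? ?] := hg2 tau.
have [cl hcl] := boolp.choice cls.
have [t ht] := @pigeonhole cT M B cl (ltnSn _).
pose S := [seq (val u).+1 | u <- enum [set u | cl u == t]].
have uS : uniq S by rewrite map_inj_uniq ?enum_uniq // => u v [/val_inj].
have sS : (B < size S)%N by rewrite size_map -cardE.
have SP u : u \in S -> exists2 v : 'I_M, cl v = t & u = v.+1.
  by move=> /mapP[v]; rewrite mem_enum inE => /eqP <- ->; exists v.
have SM u : u \in S -> (0 < u <= M)%N by move=> /SP[v _ ->]; rewrite ltn_ord.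
have interp1 j : exists2 q : {poly F}, (size q <= A)%N & forall u, u \in S -> q.[(T u)%:R] = (pq u).1`_j.
  apply: (@coef_interpolation F nu galF l O pl vO A k M (a ^ n) N S _ (fun tau => Psi tau (t tau).1 j)) => //.
  - by rewrite expn_gt0 a0.
  - by move=> u /SM/andP[].
  - by move=> u /SM/hf1[h _ _].
  - by move=> tau; apply: size_take_poly.
  - by move=> u tau /SP[v <- ->]; have [_ _ h _] := hcl v tau; apply: h.
  - by move=> u tau /SM/hf1[_ h _]; apply: (h tau).
have interp2 j : exists2 q : {poly F}, (size q <= A)%N & forall u, u \in S -> q.[(T u)%:R] = (pq u).2`_j.
  apply: (@coef_interpolation F nu galF l O pl vO A k M (a ^ n) N S _ (fun tau => Psi tau (t tau).2 j)) => //.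
  - by rewrite expn_gt0 a0.
  - by move=> u /SM/andP[].
  - by move=> u /SM/hf2[h _ _].
  - by move=> tau; apply: size_take_poly.
  - by move=> u tau /SP[v <- ->]; have [_ _ _ h] := hcl v tau; apply: h.
  - by move=> u tau /SM/hf2[_ h _]; apply: (h tau).
have lift_monic r (p : nat -> {poly F}) (c : nat -> {poly F}) :
    (forall u, u \in S -> p u \is monic /\ size (p u) = r.+1) ->
    (forall j, (size (c j) <= A)%N) -> (forall j u, u \in S -> (c j).[(T u)%:R] = (p u)`_j) ->
    exists P : {poly {poly F}}, [/\ P \is monic, size P = r.+1, forall j, (size (P`_j)%R <= A)%N &
      forall u, u \in S -> evp (T u)%:R P = p u].
  move=> hp sc ec; pose P : {poly {poly F}} := \poly_(j < r.+1) (if j == r then 1 else c j).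
  have Pr : P`_r = 1 by rewrite coef_poly ltnSn eqxx.
  have sP : size P = r.+1.
    apply/eqP; rewrite eqn_leq size_poly /= ltnNge; apply/negP => /leq_sizeP/(_ r (leqnn _)).
    by rewrite Pr => /eqP; rewrite oner_eq0.
  exists P; split=> //.
  - by rewrite monicE lead_coefE sP Pr.
  - move=> j; rewrite coef_poly; case: ifP => _; rewrite ?size_poly0 //.
    by case: eqP => _ //; rewrite size_poly1.
  - move=> u us; have [mp sp] := hp u us; apply/polyP => j; rewrite coef_map /= /horner_eval coef_poly.
    case: ltnP => [|le]; last by rewrite horner0 nth_default // sp.
    case: eqP => [-> _|_ _]; last exact: ec.
    by rewrite hornerC -(monicP mp) lead_coefE sp.
have [c1 sc1 ec1] : exists2 c : nat -> {poly F}, forall j, (size (c j) <= A)%N &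
    forall j u, u \in S -> (c j).[(T u)%:R] = (pq u).1`_j.
  have H j : exists q : {poly F}, (size q <= A)%N /\ forall u, u \in S -> q.[(T u)%:R] = (pq u).1`_j.
    by have [q ? ?] := interp1 j; exists q.
  by have [c hc] := boolp.choice H; exists c => j; have [] := hc j.
have [c2 sc2 ec2] : exists2 c : nat -> {poly F}, forall j, (size (c j) <= A)%N &
    forall j u, u \in S -> (c j).[(T u)%:R] = (pq u).2`_j.
  have H j : exists q : {poly F}, (size q <= A)%N /\ forall u, u \in S -> q.[(T u)%:R] = (pq u).2`_j.
    by have [q ? ?] := interp2 j; exists q.
  by have [c hc] := boolp.choice H; exists c => j; have [] := hc j.
have [|P [mP sP sPj eP]] := @lift_monic (size (t 1%g).1) (fun u => (pq u).1) c1 _ sc1 ec1.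
  move=> u us; have [m1 _ _ /andP[s1 _]] := hpq u; split=> //.
  by have [v ev eu] := SP _ us; have [h _ _ _] := hcl v 1%g; rewrite -ev h -eu prednK // ltnW.
have [|Q [mQ sQ sQj eQ]] := @lift_monic (size (t 1%g).2) (fun u => (pq u).2) c2 _ sc2 ec2.
  move=> u us; have [_ m2 _ /andP[_ s2]] := hpq u; split=> //.
  by have [v ev eu] := SP _ us; have [_ h _ _] := hcl v 1%g; rewrite -ev h -eu prednK // ltnW.
have u0 : exists u, u \in S by case: (S) sS => // u S' _; exists u; rewrite mem_head.
have [u us] := u0; have [_ _ _ /andP[s1 s2]] := hpq u.
have [] := nofac P Q mP mQ; last first.
- by move=> e; move: s2; rewrite -(eQ u us) size_evp // e.
- by move=> e; move: s1; rewrite -(eP u us) size_evp // e.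
(* The premise [P * Q = chi]: the coefficients of the difference vanish at more nodes than their
   degree allows. *)
apply/eqP; rewrite -subr_eq0; apply/eqP/polyP => j; rewrite coef0.
apply: (@roots_geq_poly_eq0 _ _ [seq (T v)%:R | v <- S]).
- apply/allP => _ /mapP[v vs ->]; rewrite rootE coefB hornerD hornerN.
  have [_ _ e _] := hpq v; have := congr1 (fun p : {poly F} => p`_j) e.
  rewrite -(eP v vs) -(eQ v vs) -evpM !coef_map /= /horner_eval => ->.
  by rewrite subrr.
- rewrite ?uniq_rootsE map_inj_uniq // => v w e.
  have /eqP : nu (T v)%:R = nu (T w)%:R by rewrite e.
  by rewrite !rmorph_nat eqr_nat eqn_pmul2l ?expn_gt0 ?prime_gt0 // => /eqP.
- rewrite size_map; apply: leq_trans sS; apply: leqW.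
  rewrite coefB (leq_trans (size_polyD _ _)) // size_polyN geq_max.
  rewrite (leq_trans (sD j)) ?leq_addl // andbT coefM.
  apply: (leq_trans (size_sum _ _ _)); apply/bigmax_leqP => i _.
  rewrite (leq_trans (size_polyMleq _ _)) // (leq_trans (leq_pred _)) //.
  by rewrite (leq_trans _ (leq_addr _ _)) // leq_add.
Qed.

End HilbertIrreducibility.

(** * Morphisms and closed sets of projective varieties *)

Section Coordinates.
Variables (C : fieldType).

Lemma coords_scale n (P : pspace C n) x c : coords P x -> c != 0 -> coords P (c *: x).
Proof.
move=> Px c0; rewrite /coords Px; apply/eqP; rewrite eqEsubv -!memvE.
by rewrite memvZ ?memv_line // andbT -[x in x \in _](scalerK c0) memvZ ?memv_line.
Qed.

Lemma coords_prop n (P : pspace C n) x y : coords P x -> coords P y ->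
  exists2 c, c != 0 & y = c *: x.
Proof.
move=> Px Py; have y0 := coords_neq0 Py.
have /vlineP[c ec] : y \in <[x]>%VS by rewrite -Px Py memv_line.
by exists c => //; apply: contraNneq y0 => c0; rewrite ec c0 scale0r.
Qed.

Lemma coords_inj n (P Q : pspace C n) x : coords P x -> coords Q x -> P = Q.
Proof. by move=> Px Qx; apply: val_inj; rewrite [LHS]Px [RHS]Qx. Qed.

Lemma coords_exists n (x : 'rV[C]_n) : x != 0 -> exists P : pspace C n, coords P x.
Proof.
move=> x0; have d1 : \dim <[x]>%VS == 1%N by rewrite dim_vline x0.
by exists (exist (fun U : {vspace 'rV[C]_n} => \dim U == 1%N) _ d1).
Qed.

Lemma minors_prop n (x y : 'rV[C]_n) : x != 0 -> y != 0 ->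
  (forall i j, x 0 i * y 0 j = x 0 j * y 0 i) -> exists2 c, c != 0 & y = c *: x.
Proof.
move=> /rV0Pn[i xi] y0 h; have e : y = (y 0 i / x 0 i) *: x.
  by apply/rowP => j; rewrite mxE; apply: (mulfI xi); rewrite h; field.
by exists (y 0 i / x 0 i) => //; apply: contraNneq y0 => c0; move: e; rewrite c0 scale0r => ->.
Qed.

Lemma meval_row_homog n d (F : {mpoly C[n]}) c x : F \is d.-homog ->
  meval_row F (c *: x) = c ^+ d * meval_row F x.
Proof.
move=> /dhomogP hF; rewrite /meval_row !mevalE mulr_sumr big_seq [RHS]big_seq.
apply: eq_bigr => m mF; rewrite mulrCA; congr (_ * _).
rewrite -(hF m mF) /= mdegE -prodrXr -big_split /=.
by apply: eq_bigr => i _; rewrite mxE exprMn.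
Qed.

Lemma homog_neq0 n d (F : {mpoly C[n]}) (P : pspace C n) x y : F \is d.-homog ->
  coords P x -> coords P y -> meval_row F x != 0 -> meval_row F y != 0.
Proof.
move=> hF Px Py; have [c c0 ->] := coords_prop Px Py.
by rewrite (meval_row_homog _ _ hF) mulf_eq0 expf_eq0 (negPf c0) andbF.
Qed.

Lemma dhomog_sum n d (I : eqType) (r : seq I) (f : I -> {mpoly C[n]}) :
  (forall i, i \in r -> f i \is d.-homog) -> \sum_(i <- r) f i \is d.-homog.
Proof.
elim: r => [|i r IH] h; first by rewrite big_nil dhomog0.
rewrite big_cons dhomogD ?IH ?h ?mem_head // => j jr.
by rewrite h // inE jr orbT.
Qed.

Lemma dhomog_prod_exp m n d (k : 'X_{1..m}) (F : 'I_m -> {mpoly C[n]}) :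
  (forall i, F i \is d.-homog) -> \prod_(i < m) F i ^+ k i \is (d * mdeg k).-homog.
Proof.
move=> hF; rewrite mdegE; elim/big_rec2: _ => [|i y p _ hp]; first by rewrite muln0 dhomog1.
by rewrite mulnDr; apply: dhomogM => //; apply: dhomogMn.
Qed.

Lemma comp_dhomog m n d e (H : {mpoly C[m]}) (F : 'I_m -> {mpoly C[n]}) :
  H \is e.-homog -> (forall i, F i \is d.-homog) ->
  H \mPo [tuple F i | i < m] \is (d * e).-homog.
Proof.
move=> /dhomogP hH hF; rewrite comp_mpolyE; apply: dhomog_sum => k kH.
rewrite dhomogZ // -(hH k kH) /=.
have -> : \prod_(i < m) tnth [tuple F i | i < m] i ^+ k i = \prod_(i < m) F i ^+ k i.
  by apply: eq_bigr => i _; rewrite tnth_mktuple.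
exact: dhomog_prod_exp.
Qed.

Lemma meval_row_comp m n (H : {mpoly C[m]}) (F : 'I_m -> {mpoly C[n]}) x :
  meval_row (H \mPo [tuple F i | i < m]) x = meval_row H (\row_i meval_row (F i) x).
Proof.
rewrite /meval_row comp_mpoly_meval; apply: meval_eq => i.
by rewrite tnth_mktuple mxE.
Qed.

Lemma meval_rowD n x : {morph (fun F : {mpoly C[n]} => meval_row F x) : p q / p + q}.
Proof. exact: mevalD. Qed.

Lemma meval_rowB n x : {morph (fun F : {mpoly C[n]} => meval_row F x) : p q / p - q}.
Proof. exact: mevalB. Qed.

Lemma meval_rowM n x : {morph (fun F : {mpoly C[n]} => meval_row F x) : p q / p * q}.
Proof. exact: mevalM. Qed.

Lemma meval_rowZ n x c (F : {mpoly C[n]}) : meval_row (c *: F) x = c * meval_row F x.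
Proof. exact: mevalZ. Qed.

Lemma meval_rowXU n (x : 'rV[C]_n) i : meval_row 'X_i x = x 0 i.
Proof. exact: mevalXU. Qed.

Lemma meval_rowC n (x : 'rV[C]_n) c : meval_row c%:MP x = c.
Proof. exact: mevalC. Qed.

End Coordinates.

Section Morphisms.
Variable C : fieldType.

Definition evrow m n (F : 'I_m -> {mpoly C[n]}) (x : 'rV[C]_n) : 'rV[C]_m :=
  \row_i meval_row (F i) x.

(** Coefficients in [C]: constant maps to arbitrary points are morphisms in this sense, whereas
    [morphism_over] asks for polynomials over K. *)
Definition cmorphism T n (e : T -> pspace C n) T' n' (e' : T' -> pspace C n') (f : T -> T') :=
  forall P, exists (d : nat) (F : 'I_n' -> {mpoly C[n]}),
    [/\ forall i, F i \is d.-homog, forall x, coords (e P) x -> evrow F x != 0 &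
        forall Q x, coords (e Q) x -> evrow F x != 0 -> coords (e' (f Q)) (evrow F x)].

Lemma map_mpoly_homog (K : fieldType) (iota : {rmorphism K -> C}) n d (F : {mpoly K[n]}) :
  F \is d.-homog -> map_mpoly iota F \is d.-homog.
Proof.
move=> /dhomogP hF; apply/dhomogP => m; rewrite mcoeff_msupp mcoeff_map_mpoly => h.
by apply: hF; rewrite mcoeff_msupp -(fmorph_eq0 iota).
Qed.

Lemma morphism_over_cmorphism (K : fieldType) (iota : {rmorphism K -> C})
    T n (e : T -> pspace C n) T' n' (e' : T' -> pspace C n') f :
  morphism_over iota e e' f -> cmorphism e e' f.
Proof.
move=> mf P; have [d [F [hF F0 hf]]] := mf P.
exists d, (fun i => map_mpoly iota (F i)); split=> // i; exact: map_mpoly_homog.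
Qed.

Lemma cmorphism_comp T n (e : T -> pspace C n) T' n' (e' : T' -> pspace C n')
    T'' n'' (e'' : T'' -> pspace C n'') f g :
  cmorphism e e' f -> cmorphism e' e'' g -> cmorphism e e'' (g \o f).
Proof.
move=> mf mg P; have [d [F [hF F0 hf]]] := mf P; have [d' [G [hG G0 hg]]] := mg (f P).
have Px := coords_pick (e P); set x := vpick _ in Px.
have /rV0Pn[i0] := F0 x Px; rewrite mxE => Fi0.
(* The factor [F i0] makes the composite representatives vanish wherever [F] does. The [G k] alone
   need not, since they may be constants of degree 0. *)
have ev y : evrow (fun k => F i0 * (G k \mPo [tuple F i | i < n'])) y =
    meval_row (F i0) y *: evrow G (evrow F y).
  by apply/rowP => k; rewrite !mxE meval_rowM meval_row_comp.
exists (d + d * d')%N, (fun k => F i0 * (G k \mPo [tuple F i | i < n'])); split=> [k|y Py|Q y Qy].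
- by apply: dhomogM => //; apply: comp_dhomog.
- rewrite ev scaler_eq0 negb_or (homog_neq0 (hF i0) Px Py Fi0) /=.
  by apply: G0; apply: hf => //; apply: F0.
- rewrite ev scaler_eq0 negb_or => /andP[Fy Gy].
  have Fy0 : evrow F y != 0 by apply/rV0Pn; exists i0; rewrite mxE.
  by apply: coords_scale => //; apply: hg => //; apply: hf.
Qed.

Definition pair_emb T n (e : T -> pspace C n) T' n' (e' : T' -> pspace C n') :=
  fun PQ : T * T' => segre (e PQ.1) (e' PQ.2).

Lemma segre_coords_pair m n (F : 'I_m -> C) (G : 'I_n -> C) :
  segre_coords (\row_i F i) (\row_i G i) = mxvec (\matrix_(i, j) (F i * G j)).
Proof. by congr mxvec; apply/matrixP => i j; rewrite !mxE big_ord1 !mxE. Qed.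

Lemma segre_coords_eq0 m n (x : 'rV[C]_m) (y : 'rV[C]_n) :
  segre_coords x y != 0 -> x != 0 /\ y != 0.
Proof.
move=> h; split; apply: contraNneq h => ->; rewrite /segre_coords.
  by rewrite trmx0 mul0mx linear0.
by rewrite mulmx0 linear0.
Qed.

Lemma cmorphism_pair T n (e : T -> pspace C n) T' n' (e' : T' -> pspace C n')
    T'' n'' (e'' : T'' -> pspace C n'') f g :
  cmorphism e e' f -> cmorphism e e'' g ->
  cmorphism e (pair_emb e' e'') (fun P => (f P, g P)).
Proof.
move=> mf mg P; have [d [F [hF F0 hf]]] := mf P; have [d' [G [hG G0 hg]]] := mg P.
pose H k := mxvec (\matrix_(i, j) (F i * G j)) 0 k.
have ev y : evrow H y = segre_coords (evrow F y) (evrow G y).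
  rewrite segre_coords_pair; apply/rowP => k; case/mxvec_indexP: k => i j.
  by rewrite mxvecE !mxE /H mxvecE mxE meval_rowM.
exists (d + d')%N, H; split=> [k|y Py|Q y Qy].
- by case/mxvec_indexP: k => i j; rewrite /H mxvecE mxE; apply: dhomogM.
- by rewrite ev segre_coords_neq0 ?F0 ?G0.
- rewrite ev => /segre_coords_eq0[Fy Gy]; apply: segreE; [exact: hf|exact: hg].
Qed.

Lemma cmorphism_const T n (e : T -> pspace C n) T' n' (e' : T' -> pspace C n') a :
  cmorphism e e' (fun=> a).
Proof.
move=> P; have ax := coords_pick (e' a); set x := vpick _ in ax.
have ev y : evrow (fun i => (x 0 i)%:MP : {mpoly C[n]}) y = x.
  by apply/rowP => i; rewrite mxE meval_rowC.
exists 0%N, (fun i => (x 0 i)%:MP); split=> [i|y _|Q y _ _]; rewrite ?ev //.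
  by rewrite -[_%:MP]mulr1 mul_mpolyC dhomogZ // dhomog1.
exact: coords_neq0 ax.
Qed.

End Morphisms.

Section Zariski.
Variables (C : fieldType) (T : Type) (n : nat) (e : T -> pspace C n).

(** A pointwise form of closedness: each point outside is separated by one homogeneous polynomial,
    so that no global equations have to be exhibited. *)
Lemma zclosedP (Z : T -> Prop) : zclosed e Z <->
  forall P, ~ Z P -> exists d (F : {mpoly C[n]}), [/\ F \is d.-homog,
    forall x, coords (e P) x -> meval_row F x != 0 &
    forall Q x, Z Q -> coords (e Q) x -> meval_row F x = 0].
Proof.
split=> [[S hS hZ] P nZ|h].
  apply: boolp.contrapT => nex; apply: nZ; apply/hZ => F SF x Px.
  apply: boolp.contrapT => /eqP Fx; apply: nex; have [d hF] := hS F SF.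
  exists d, F; split=> // [y Py|Q y /hZ/(_ F SF) ZQ Qy]; first exact: homog_neq0 hF Px Py Fx.
  exact: ZQ.
exists (fun F => homogeneous F /\ forall Q, Z Q -> vanishes F (e Q)) => [F []//|P].
split=> [ZP F [_]|hP]; first exact.
apply: boolp.contrapT => nZ; have [d [F [hF F0 FZ]]] := h P nZ.
have Px := coords_pick (e P); have := F0 _ Px; rewrite (hP F) ?eqxx //.
by split=> [|Q ZQ x Qx]; [exists d|apply: FZ Qx].
Qed.

Lemma zclosedU Z1 Z2 : zclosed e Z1 -> zclosed e Z2 -> zclosed e (fun P => Z1 P \/ Z2 P).
Proof.
move=> /zclosedP h1 /zclosedP h2; apply/zclosedP => P /boolp.not_orP[n1 n2].
have [d1 [F1 [hF1 F10 FZ1]]] := h1 P n1; have [d2 [F2 [hF2 F20 FZ2]]] := h2 P n2.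
exists (d1 + d2)%N, (F1 * F2); split=> [|x Px|Q x ZQ Qx]; first exact: dhomogM.
  by rewrite meval_rowM mulf_neq0 ?F10 ?F20.
rewrite meval_rowM; case: ZQ => ZQ; first by rewrite (FZ1 Q) ?mul0r.
by rewrite (FZ2 Q) ?mulr0.
Qed.

Lemma zclosed0 : zclosed e (fun=> False).
Proof.
apply/zclosedP => P _; exists 0%N, 1; split=> [|x _|//]; first exact: dhomog1.
by rewrite /meval_row meval1 oner_eq0.
Qed.

Lemma zclosed_bigU (I : eqType) (s : seq I) (Z : I -> T -> Prop) :
  (forall i, zclosed e (Z i)) -> zclosed e (fun P => exists2 i, i \in s & Z i P).
Proof.
move=> h; elim: s => [|i s IH].
  have -> : (fun P => exists2 i, i \in [::] & Z i P) = fun=> False; last exact: zclosed0.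
  by apply: boolp.funext => P; apply: boolp.propext; split=> // -[].
have -> : (fun P => exists2 j, j \in i :: s & Z j P) = (fun P => Z i P \/ exists2 j, j \in s & Z j P).
  apply: boolp.funext => P; apply: boolp.propext; split.
    by move=> [j]; rewrite inE => /orP[/eqP ->|js] Zj; [left|right; exists j].
  move=> [Zi|[j js Zj]]; first by exists i; rewrite ?mem_head.
  by exists j; rewrite // inE js orbT.
exact: zclosedU.
Qed.

Hypothesis irrT : zirreducible e (fun=> True).

Lemma zirr_cover Z1 Z2 : zclosed e Z1 -> zclosed e Z2 -> (forall P, Z1 P \/ Z2 P) ->
  (forall P, Z1 P) \/ (forall P, Z2 P).
Proof.
move=> c1 c2 h; case: irrT => _ /(_ Z1 Z2 c1 c2)[P _|H|H]; first exact: h.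
  by left=> P; apply: H.
by right=> P; apply: H.
Qed.

Lemma generic_point (I : eqType) (s : seq I) (Z : I -> T -> Prop) :
  (forall i, zclosed e (Z i)) -> (forall i, exists P, ~ Z i P) ->
  exists P, forall i, i \in s -> ~ Z i P.
Proof.
move=> cZ pZ; elim: s => [|i s [P hP]]; first by case: irrT => [[P _] _]; exists P.
apply: boolp.contrapT => nex.
have [|||hi|hs] := @zirr_cover (Z i) (fun P => exists2 j, j \in s & Z j P).
- exact: cZ.
- exact: zclosed_bigU.
- move=> Q; apply: boolp.contrapT => /boolp.not_orP[n1 n2]; apply: nex; exists Q => j.
  by rewrite inE => /orP[/eqP ->//|js] Zj; apply: n2; exists j.
- by have [Q nQ] := pZ i; apply: nQ.
- by have [j js Zj] := hs P; apply: hP js Zj.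
Qed.

End Zariski.

Section Closedness.
Variable C : fieldType.

(** Two vectors are proportional when their 2 by 2 minors vanish. A minor of local representatives
    at [P] also vanishes where either representative is zero, so it may be used on all of [T]. *)
Lemma equalizer_closed T n (e : T -> pspace C n) T' n' (e' : T' -> pspace C n') f g :
  injective e' -> cmorphism e e' f -> cmorphism e e' g -> zclosed e (fun P => f P = g P).
Proof.
move=> inje mf mg; apply/zclosedP => P fg.
have [d [F [hF F0 hf]]] := mf P; have [d' [G [hG G0 hg]]] := mg P.
have Px := coords_pick (e P); set x := vpick _ in Px.
have [i [j ij]] : exists i j, meval_row (F i * G j - F j * G i) x != 0.
  apply: boolp.contrapT => nex; apply: fg; apply: inje.
  have [|c c0 ec] := minors_prop (F0 x Px) (G0 x Px).
    move=> i j; apply/eqP; rewrite -subr_eq0; apply/negPn/negP => h; apply: nex.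
    by exists i, j; rewrite meval_rowB !meval_rowM; move: h; rewrite !mxE.
  apply: (coords_inj (x := evrow G x)); last by apply: hg => //; apply: G0.
  by rewrite ec; apply: coords_scale => //; apply: hf => //; apply: F0.
have hm : F i * G j - F j * G i \is (d + d').-homog.
  by apply: dhomogD; rewrite ?dhomogN; apply: dhomogM; rewrite ?hF ?hG.
exists (d + d')%N, (F i * G j - F j * G i); split=> // [y Py|Q y efg Qy].
  exact: homog_neq0 hm Px Py ij.
rewrite meval_rowB !meval_rowM.
have [Fy|Fy] := eqVneq (evrow F y) 0.
  have h k : meval_row (F k) y = 0 by have /rowP/(_ k) := Fy; rewrite !mxE.
  by rewrite !h !mul0r subrr.
have [Gy|Gy] := eqVneq (evrow G y) 0.
  have h k : meval_row (G k) y = 0 by have /rowP/(_ k) := Gy; rewrite !mxE.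
  by rewrite !h !mulr0 subrr.
have := hf Q y Qy Fy; rewrite efg => /coords_prop/(_ (hg Q y Qy Gy))[c c0 /rowP ec].
by have := ec i; have := ec j; rewrite !mxE => -> ->; ring.
Qed.

Lemma fiber_closed T n (e : T -> pspace C n) T' n' (e' : T' -> pspace C n') f a :
  injective e' -> cmorphism e e' f -> zclosed e (fun P => f P = a).
Proof. by move=> inje mf; apply: (equalizer_closed inje mf); apply: cmorphism_const. Qed.

Lemma preimage_closed T n (e : T -> pspace C n) T' n' (e' : T' -> pspace C n') f Z :
  cmorphism e e' f -> zclosed e' Z -> zclosed e (fun P => Z (f P)).
Proof.
move=> mf /zclosedP cZ; apply/zclosedP => P nZ.
have [d [F [hF F0 hf]]] := mf P; have [d' [H [hH H0 HZ]]] := cZ _ nZ.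
have Px := coords_pick (e P); set x := vpick _ in Px.
have /rV0Pn[i0] := F0 x Px; rewrite mxE => Fi0.
have hm : F i0 * (H \mPo [tuple F i | i < n']) \is (d + d * d').-homog.
  by apply: dhomogM => //; apply: comp_dhomog.
have ev y : meval_row (F i0 * (H \mPo [tuple F i | i < n'])) y =
    meval_row (F i0) y * meval_row H (evrow F y) by rewrite meval_rowM meval_row_comp.
exists (d + d * d')%N, (F i0 * (H \mPo [tuple F i | i < n'])); split=> // [y Py|Q y ZQ Qy].
  apply: (homog_neq0 hm Px Py); rewrite ev mulf_neq0 // H0 //; exact: (hf P x Px (F0 x Px)).
rewrite ev; have [->|Fy] := eqVneq (meval_row (F i0) y) 0; first by rewrite mul0r.
rewrite (HZ (f Q)) ?mulr0 //; apply: hf => //; by apply/rV0Pn; exists i0; rewrite mxE.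
Qed.

Section Regular.
Variables (T : Type) (n : nat) (e : T -> pspace C n).

Lemma regular_sub (U V : T -> Prop) h : (forall P, V P -> U P) ->
  regular_on e U h -> regular_on e V h.
Proof.
move=> VU rh P VP; have [d [N [D [hN hD D0 hND]]]] := rh P (VU P VP).
by exists d, N, D; split=> // Q x VQ; apply: hND; apply: VU.
Qed.

Lemma regular_ext (U : T -> Prop) h h' : (forall P, U P -> h P = h' P) ->
  regular_on e U h -> regular_on e U h'.
Proof.
move=> hh rh P UP; have [d [N [D [hN hD D0 hND]]]] := rh P UP.
by exists d, N, D; split=> // Q x UQ; rewrite -hh //; apply: hND.
Qed.

Lemma regular_const (U : T -> Prop) c : regular_on e U (fun=> c).
Proof.
move=> P UP; exists 0%N, c%:MP, 1; split=> [||x _|Q x _ _ _]; rewrite ?dhomog1 //.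
- by rewrite -[_%:MP]mulr1 mul_mpolyC dhomogZ // dhomog1.
- by rewrite /meval_row meval1 oner_eq0.
- by rewrite /meval_row meval1 mevalC divr1.
Qed.

Lemma regularD (U : T -> Prop) h1 h2 : regular_on e U h1 -> regular_on e U h2 ->
  regular_on e U (fun P => h1 P + h2 P).
Proof.
move=> r1 r2 P UP; have [d1 [N1 [D1 [hN1 hD1 D10 h1P]]]] := r1 P UP.
have [d2 [N2 [D2 [hN2 hD2 D20 h2P]]]] := r2 P UP.
exists (d1 + d2)%N, (N1 * D2 + N2 * D1), (D1 * D2); split=> [||x Px|Q x UQ Qx].
- by apply: dhomogD; [|rewrite addnC]; apply: dhomogM.
- exact: dhomogM.
- by rewrite meval_rowM mulf_neq0 ?D10 ?D20.
- rewrite !meval_rowM mulf_eq0 negb_or => /andP[x1 x2].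
  by rewrite (h1P Q x) // (h2P Q x) // meval_rowD !meval_rowM addf_div.
Qed.

Lemma regularM (U : T -> Prop) h1 h2 : regular_on e U h1 -> regular_on e U h2 ->
  regular_on e U (fun P => h1 P * h2 P).
Proof.
move=> r1 r2 P UP; have [d1 [N1 [D1 [hN1 hD1 D10 h1P]]]] := r1 P UP.
have [d2 [N2 [D2 [hN2 hD2 D20 h2P]]]] := r2 P UP.
exists (d1 + d2)%N, (N1 * N2), (D1 * D2); split=> [||x Px|Q x UQ Qx].
- exact: dhomogM.
- exact: dhomogM.
- by rewrite meval_rowM mulf_neq0 ?D10 ?D20.
- rewrite !meval_rowM mulf_eq0 negb_or => /andP[x1 x2].
  by rewrite (h1P Q x) // (h2P Q x) // mulf_div.
Qed.

Lemma regular_sum (U : T -> Prop) I (r : seq I) (h : I -> T -> C) :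
  (forall i, regular_on e U (h i)) -> regular_on e U (fun P => \sum_(i <- r) h i P).
Proof.
move=> rh; elim: r => [|i r IH].
  by apply: (@regular_ext _ (fun=> 0)) => [P _|]; [rewrite big_nil|apply: regular_const].
apply: (@regular_ext _ (fun P => h i P + \sum_(j <- r) h j P)) => [P _|].
  by rewrite big_cons.
exact: regularD.
Qed.

Lemma regular_prod (U : T -> Prop) I (r : seq I) (p : pred I) (h : I -> T -> C) :
  (forall i, regular_on e U (h i)) -> regular_on e U (fun P => \prod_(i <- r | p i) h i P).
Proof.
move=> rh; elim: r => [|i r IH].
  by apply: (@regular_ext _ (fun=> 1)) => [P _|]; [rewrite big_nil|apply: regular_const].
case pi: (p i); last by apply: regular_ext IH => P _; rewrite big_cons pi.
apply: (@regular_ext _ (fun P => h i P * \prod_(j <- r | p j) h j P)) => [P _|].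
  by rewrite big_cons pi.
exact: regularM.
Qed.

Lemma regularX (U : T -> Prop) h k : regular_on e U h -> regular_on e U (fun P => h P ^+ k).
Proof.
move=> rh; elim: k => [|k IH].
  by apply: (@regular_ext _ (fun=> 1)) => [P _|]; [rewrite expr0|apply: regular_const].
apply: (@regular_ext _ (fun P => h P * h P ^+ k)) => [P _|]; first by rewrite exprS.
exact: regularM.
Qed.

Lemma regular_mpoly (U : T -> Prop) m (h : 'I_m -> T -> C) (p : {mpoly C[m]}) :
  (forall i, regular_on e U (h i)) -> regular_on e U (fun P => meval_row p (\row_i h i P)).
Proof.
move=> rh; apply: (@regular_ext _ (fun P => \sum_(k <- msupp p) p@_k * \prod_(i <- enum 'I_m) h i P ^+ k i)).
  move=> P _; rewrite /meval_row mevalE; apply: eq_bigr => k _; congr (_ * _).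
  by rewrite big_enum /=; apply: eq_bigr => i _; rewrite mxE.
apply: regular_sum => k; apply: regularM; first exact: regular_const.
by apply: regular_prod => i; apply: regularX.
Qed.

(** Write [h = N / D] near [P] and let [R] vanish off [U]. The product [R N D] vanishes on the whole
    set: through [R] off [U], through [D] where the fraction says nothing, through [N] elsewhere. *)
Lemma regular_zeros_closed (U : T -> Prop) h : zopen e U -> regular_on e U h ->
  zclosed e (fun P => U P -> h P = 0).
Proof.
move=> /zclosedP oU rh; apply/zclosedP => P /boolp.not_implyP[UP hP].
have [d' [R [hR R0 RU]]] : exists d' (R : {mpoly C[n]}), [/\ R \is d'.-homog, 
   forall x, coords (e P) x -> meval_row R x != 0 &
   forall Q x, ~ U Q -> coords (e Q) x -> meval_row R x = 0] by apply: oU.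
have [d [N [D [hN hD D0 hND]]]] := rh P UP.
exists (d' + (d + d))%N, (R * (N * D)); split=> [|x Px|Q x ZQ Qx].
- by do 2!apply: dhomogM => //.
- rewrite !meval_rowM !mulf_neq0 ?R0 ?D0 //; apply: contra_notN hP => /eqP N0.
  by rewrite (hND P x) ?D0 // N0 mul0r.
- rewrite !meval_rowM; have [UQ|nU] := boolp.EM (U Q); last by rewrite (RU Q) ?mul0r.
  have [->|Dx] := eqVneq (meval_row D x) 0; first by rewrite !mulr0.
  have := hND Q x UQ Qx Dx; rewrite (ZQ UQ) => /esym/eqP.
  by rewrite mulf_eq0 invr_eq0 (negPf Dx) orbF => /eqP ->; rewrite mul0r mulr0.
Qed.

End Regular.
End Closedness.

(** * The orbit polynomial *)

Section IntegerPoints.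
Variable C : fieldType.
Hypothesis char0 : [pchar C] =i pred0.

Lemma natr_inj_char0 : injective (fun n : nat => n%:R : C).
Proof.
have h m n : (m <= n)%N -> m%:R = n%:R :> C -> m = n.
  move=> le /eqP; rewrite eq_sym -subr_eq0 -natrB // ((pcharf0P C).1 char0) subn_eq0 => ge.
  by apply/eqP; rewrite eqn_leq le.
by move=> m n e; case/orP: (leq_total m n) => le; [apply: h|apply/esym/h].
Qed.

Lemma poly_nat_nonroot (p : {poly C}) : p != 0 -> exists c : nat, p.[c%:R] != 0.
Proof.
move=> p0; apply: boolp.contrapT => nex.
have /max_poly_roots := p0; move=> /(_ [seq c%:R | c <- iota 0 (size p)]).
rewrite size_map size_iota ltnn => h; suff : false by []; apply: h.
  apply/allP => _ /mapP[c _ ->]; apply/negPn/negP => h; apply: nex; by exists c.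
by rewrite map_inj_uniq ?iota_uniq //; apply: natr_inj_char0.
Qed.

(** The form with coefficients 1, c, c^2, ...: a given nonzero vector is killed by finitely many [c]
    only. Its coefficients are natural numbers, hence fixed by every embedding. *)
Definition linform n (c : nat) (x : 'rV[C]_n) : C := \sum_(i < n) c%:R ^+ i * x 0 i.

Lemma linform_poly n (x : 'rV[C]_n) : x != 0 ->
  exists2 p : {poly C}, p != 0 & forall c : nat, p.[c%:R] = linform c x.
Proof.
move=> /rV0Pn[i xi]; exists (\poly_(j < n) (if insub j is Some j' then x 0 j' else 0)).
  apply/eqP => /polyP/(_ i); rewrite coef_poly coef0 ltn_ord valK => /eqP.
  by rewrite (negPf xi).
move=> c; rewrite horner_poly; apply: eq_bigr => j _; by rewrite valK mulrC.
Qed.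

Lemma exists_linform n (I : eqType) (s : seq I) (x : I -> 'rV[C]_n) :
  exists c : nat, forall i, i \in s -> x i != 0 -> linform c (x i) != 0.
Proof.
have [p p0 hp] : exists2 p : {poly C}, p != 0 & forall (c : nat) i, i \in s -> x i != 0 ->
    p.[c%:R] != 0 -> linform c (x i) != 0.
  elim: s => [|i s [p p0 hp]]; first by exists 1; rewrite ?oner_eq0.
  have [xi|xi] := eqVneq (x i) 0.
    exists p => // c j; rewrite inE => /orP[/eqP ->|]; [by rewrite xi eqxx|exact: hp].
  have [q q0 hq] := linform_poly xi.
  exists (p * q); rewrite ?mulf_neq0 // => c j; rewrite inE hornerM mulf_eq0 negb_or.
  move=> /orP[/eqP -> _ /andP[_]|js xj /andP[pc _]]; first by rewrite hq.
  exact: hp.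
by have [c pc] := poly_nat_nonroot p0; exists c => i is_ xi; apply: hp pc.
Qed.

Lemma digits_inj B n (f g : 'I_n -> nat) : (forall i, f i < B)%N -> (forall i, g i < B)%N ->
  (\sum_(i < n) f i * B ^ i = \sum_(i < n) g i * B ^ i)%N -> f =1 g.
Proof.
elim: n f g => [|n IH] f g hf hg e; first by case.
have B0 : (0 < B)%N by apply: leq_ltn_trans (hf ord0).
move: e; rewrite !big_ord_recl !expn0 !muln1.
have st (h : 'I_n.+1 -> nat) : (\sum_(i < n) h (lift ord0 i) * B ^ bump 0 i =
    B * \sum_(i < n) h (lift ord0 i) * B ^ i)%N.
  by rewrite big_distrr /=; apply: eq_bigr => i _; rewrite /bump add1n expnS; lia.
rewrite /= !st => e.
have e0 : f ord0 = g ord0.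
  by have := congr1 (modn^~ B) e; rewrite /= ![(_ + B * _)%N]addnC ![(B * _)%N]mulnC !modnMDl !modn_small.
have {}e : (\sum_(i < n) f (lift ord0 i) * B ^ i = \sum_(i < n) g (lift ord0 i) * B ^ i)%N.
  by move: e; rewrite e0 => /addnI/eqP; rewrite eqn_pmul2l // => /eqP.
have {}IH := IH (f \o lift ord0) (g \o lift ord0) (fun i => hf _) (fun i => hg _) e.
by move=> i; case: (unliftP ord0 i) => [j ->|->] //; apply: IH.
Qed.

(** Kronecker substitution: ['X_i] becomes ['X^(B ^ i)] with [B] above all the exponents, so that
    distinct monomials stay distinct. *)
Lemma mpoly_nat_nonzero n (p : {mpoly C[n]}) : p != 0 ->
  exists c : 'I_n -> nat, p.@[fun i => (c i)%:R] != 0.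
Proof.
move=> p0; pose B := msize p.
have hB m i : m \in msupp p -> (m i < B)%N.
  move=> mp; apply: leq_ltn_trans (msize_mdeg_lt mp).
  by rewrite mdegE (bigD1 i) //= leq_addr.
pose q : {poly C} := \sum_(m <- msupp p) p@_m *: 'X^(\sum_i m i * B ^ i).
have q0 : q != 0.
  have [m mp] : exists m, m \in msupp p.
    by exists (mlead p); rewrite mlead_supp.
  apply/eqP => /polyP/(_ (\sum_i m i * B ^ i)%N); rewrite coef0 coef_sum.
  rewrite (bigD1_seq m) ?msupp_uniq //= coefZ coefXn eqxx mulr1 big1_seq ?addr0.
    by move/eqP; rewrite mcoeff_eq0 mp.
  move=> k /andP[km kp]; rewrite coefZ coefXn; case: eqP => [e|_]; last by rewrite mulr0.
  case/eqP: km; apply/mnmP => i; have := @digits_inj B n m k (fun i => hB _ i mp) (fun i => hB _ i kp) e i.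
  by move=> ->.
have [c qc] := poly_nat_nonroot q0; exists (fun i => c ^ (B ^ i))%N.
move: qc; rewrite horner_sum mevalE; congr (_ != 0); apply: eq_bigr => m _.
rewrite hornerZ hornerXn; congr (_ * _); rewrite -prodrXr; apply: eq_bigr => i _.
by rewrite natrX -exprM mulnC.
Qed.

End IntegerPoints.

Section RegularPoly.
Variables (C : fieldType) (T : Type) (n : nat) (e : T -> pspace C n) (U : T -> Prop).

Definition regular_poly (p : T -> {poly C}) := forall j, regular_on e U (fun P => (p P)`_j).

Lemma regular_polyM p q : regular_poly p -> regular_poly q -> regular_poly (fun P => p P * q P).
Proof.
move=> rp rq j; apply: (@regular_ext _ _ _ _ _ (fun P => \sum_(i <- enum 'I_j.+1) (p P)`_i * (q P)`_(j - i))).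
  by move=> P _; rewrite coefM big_enum.
by apply: regular_sum => i; apply: regularM.
Qed.

Lemma regular_poly_sum I (r : seq I) (p : I -> T -> {poly C}) :
  (forall i, regular_poly (p i)) -> regular_poly (fun P => \sum_(i <- r) p i P).
Proof.
move=> rp j; apply: (@regular_ext _ _ _ _ _ (fun P => \sum_(i <- r) (p i P)`_j)).
  by move=> P _; rewrite coef_sum.
by apply: regular_sum => i; apply: rp.
Qed.

Lemma regular_poly_prod I (r : seq I) (b : pred I) (p : I -> T -> {poly C}) :
  (forall i, regular_poly (p i)) -> regular_poly (fun P => \prod_(i <- r | b i) p i P).
Proof.
move=> rp; elim: r => [|i r IH].
  move=> j; apply: (@regular_ext _ _ _ _ _ (fun=> (1 : {poly C})`_j)); last exact: regular_const.
  by move=> P _; rewrite big_nil.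
move=> j; case bi: (b i); last first.
  by apply: regular_ext (IH j) => P _; rewrite big_cons bi.
apply: (@regular_ext _ _ _ _ _ (fun P => (p i P * \prod_(i <- r | b i) p i P)`_j)).
  by move=> P _; rewrite big_cons bi.
exact: (regular_polyM (rp i) IH).
Qed.

Lemma regular_polyXsubC h : regular_on e U h -> regular_poly (fun P => 'X - (h P)%:P).
Proof.
move=> rh j; apply: (@regular_ext _ _ _ _ _ (fun P => ('X : {poly C})`_j + (j == 0%N)%:R * ((-1) * h P))).
  by move=> P _; rewrite coefB coefC; case: eqP => _; rewrite ?mul1r ?mulN1r ?mul0r ?subr0 ?addr0.
apply: regularD; first exact: regular_const.
by apply: regularM; [apply: regular_const|apply: regularM => //; apply: regular_const].
Qed.

Lemma regular_polyZ h p : regular_on e U h -> regular_poly p -> regular_poly (fun P => h P *: p P).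
Proof.
move=> rh rp j; apply: (@regular_ext _ _ _ _ _ (fun P => h P * (p P)`_j)); last exact: regularM.
by move=> P _; rewrite coefZ.
Qed.

End RegularPoly.

Section Ratio.
Variables (C : fieldType) (T : Type) (n : nat) (e : T -> pspace C n).
Variables (T' : Type) (n' : nat) (e' : T' -> pspace C n').

Definition hratio (A B : {mpoly C[n']}) (Q : T') : C :=
  meval_row A (vpick (val (e' Q))) / meval_row B (vpick (val (e' Q))).

Lemma hratioE d A B Q x : A \is d.-homog -> B \is d.-homog -> coords (e' Q) x ->
  hratio A B Q = meval_row A x / meval_row B x.
Proof.
move=> hA hB Qx; rewrite /hratio; have [c c0 ->] := coords_prop Qx (coords_pick (e' Q)).
by rewrite (meval_row_homog _ _ hA) (meval_row_homog _ _ hB) -mulf_div divff ?expf_neq0 // mul1r.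
Qed.

Lemma nonvanishing_open d (B : {mpoly C[n']}) : B \is d.-homog ->
  zopen e' (fun Q => meval_row B (vpick (val (e' Q))) != 0).
Proof.
move=> hB; apply/zclosedP => Q /boolp.contrapT B0.
exists d, B; split=> // [x Qx|R x /negP/negPn/eqP R0 Rx].
  exact: homog_neq0 hB (coords_pick _) Qx B0.
apply/eqP/negPn/negP => h; have := homog_neq0 hB Rx (coords_pick _) h.
by rewrite R0 eqxx.
Qed.

Lemma regular_hratio f d A B (U : T -> Prop) : cmorphism e e' f ->
  A \is d.-homog -> B \is d.-homog ->
  (forall P, U P -> meval_row B (vpick (val (e' (f P)))) != 0) ->
  regular_on e U (fun P => hratio A B (f P)).
Proof.
move=> mf hA hB UB P UP; have [d' [F [hF F0 hf]]] := mf P.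
have Px := coords_pick (e P); set x := vpick _ in Px.
have /rV0Pn[i0] := F0 x Px; rewrite mxE => Fi0.
have B0 : meval_row B (evrow F x) != 0.
  exact: homog_neq0 hB (coords_pick (e' (f P))) (hf P x Px (F0 x Px)) (UB P UP).
have hm (H : {mpoly C[n']}) : H \is d.-homog -> F i0 * (H \mPo [tuple F i | i < n']) \is (d' + d' * d).-homog.
  by move=> hH; apply: dhomogM => //; apply: comp_dhomog.
have ev (H : {mpoly C[n']}) y : meval_row (F i0 * (H \mPo [tuple F i | i < n'])) y =
    meval_row (F i0) y * meval_row H (evrow F y) by rewrite meval_rowM meval_row_comp.
exists (d' + d' * d)%N, (F i0 * (A \mPo [tuple F i | i < n'])), (F i0 * (B \mPo [tuple F i | i < n'])).
split=> [||y Py|Q y UQ Qy]; [exact: hm|exact: hm| |].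
  by apply: (homog_neq0 (hm _ hB) Px Py); rewrite ev mulf_neq0.
rewrite !ev mulf_eq0 negb_or => /andP[Fy By].
rewrite -mulf_div divff // mul1r; apply: (hratioE hA hB); apply: hf => //.
by apply/rV0Pn; exists i0; rewrite mxE.
Qed.

End Ratio.

(** * Invariant functions as fractions on projective space *)

Section Descent.
Variables (K C : fieldType) (iota : {rmorphism K -> C}).
Variables (X : Type) (n : nat) (eX : X -> pspace C n).
Variables (gT : finGroupType) (act : gT -> X -> X).
Variables (Y : Type) (q : nat) (eY : Y -> pspace C q) (pi : X -> Y).
Hypothesis hpi : group_quotient iota eX act eY pi.
Variables (d : nat) (u : Y -> pspace C d) (v : pspace C d -> Y).
Hypotheses (mv : cmorphism (@id (pspace C d)) eY v) (uK : cancel u v).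

(** The function lives on the quotient by [quo_functions]; composing its local fraction with
    polynomials for [v] gives a fraction in the coordinates of projective space. The factor [R]
    makes [D] vanish outside [U]. *)
Lemma descend_one (U : Y -> Prop) h Q0 x0 : zopen eY U ->
  regular_on eX (fun P => U (pi P)) h ->
  (forall g P, U (pi P) -> h (act g P) = h P) -> U Q0 -> coords (u Q0) x0 ->
  exists D N : {mpoly C[d]}, meval_row D x0 != 0 /\
    forall P x, coords (u (pi P)) x -> meval_row D x != 0 ->
      U (pi P) /\ h P = meval_row N x / meval_row D x.
Proof.
move=> oU rh hinv UQ Qx0; have [h' rh' hh'] := quo_functions hpi oU rh hinv.
have [e [N [D [hN hD D0 hND]]]] := rh' Q0 UQ.
have [e' [R [hR R0 RU]]] : exists e' (R : {mpoly C[q]}), [/\ R \is e'.-homog,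
    forall x, coords (eY Q0) x -> meval_row R x != 0 &
    forall Q x, ~ U Q -> coords (eY Q) x -> meval_row R x = 0].
  by have /zclosedP := oU; apply.
have [k [F [hF F0 hv]]] := mv (u Q0).
have /rV0Pn[i0] := F0 x0 Qx0; rewrite mxE => Fi0.
pose cF (H : {mpoly C[q]}) := F i0 * (H \mPo [tuple F i | i < q]).
have ev H x : meval_row (cF H) x = meval_row (F i0) x * meval_row H (evrow F x).
  by rewrite meval_rowM meval_row_comp.
exists (cF (D * R)), (cF (N * R)); split.
  have Qy : coords (eY Q0) (evrow F x0) by rewrite -(uK Q0); apply: hv => //; apply: F0.
  by rewrite ev meval_rowM !mulf_neq0 ?D0 ?R0.
move=> P x Px; rewrite !ev !meval_rowM !mulf_eq0 !negb_or => /and3P[Fx Dx Rx].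
have Py : coords (eY (pi P)) (evrow F x).
  by rewrite -[pi P]uK; apply: hv => //; apply/rV0Pn; exists i0; rewrite mxE.
have UP : U (pi P).
  by apply: boolp.contrapT => nU; move: Rx; rewrite (RU _ _ nU Py) eqxx.
by split=> //; rewrite hh' // (hND _ _ UP Py Dx); field; rewrite Fx Dx Rx.
Qed.

Lemma descend (I : finType) (i0 : I) (U : Y -> Prop) (h : I -> X -> C) Q0 x0 : zopen eY U ->
  (forall i, regular_on eX (fun P => U (pi P)) (h i)) ->
  (forall i g P, U (pi P) -> h i (act g P) = h i P) -> U Q0 -> coords (u Q0) x0 ->
  exists (D : {mpoly C[d]}) (N : I -> {mpoly C[d]}), meval_row D x0 != 0 /\
    forall P x, coords (u (pi P)) x -> meval_row D x != 0 ->
      U (pi P) /\ forall i, h i P = meval_row (N i) x / meval_row D x.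
Proof.
move=> oU rh hinv UQ Qx0.
have H i := descend_one oU (rh i) (hinv i) UQ Qx0.
have [D {}H] := boolp.choice H; have [N {}H] := boolp.choice H.
have ev (P : pred I) x : meval_row (\prod_(i | P i) D i) x = \prod_(i | P i) meval_row (D i) x.
  by rewrite /meval_row rmorph_prod.
exists (\prod_i D i), (fun i => N i * \prod_(j | j != i) D j); split.
  by rewrite ev; apply/prodf_neq0 => i _; have [] := H i.
move=> P x Px; rewrite ev => /prodf_neq0 Dx; split.
  by have [_ h'] := H i0; have [] := h' P x Px (Dx i0 isT).
move=> i; have [_ h'] := H i; have [_ ->] := h' P x Px (Dx i isT).
rewrite meval_rowM ev [X in _ = _ / X](bigD1 i) //= -mulf_div.
by rewrite divff ?mulr1 //; apply/prodf_neq0 => j _; apply: Dx.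
Qed.

End Descent.

Lemma coef_prod_scale (C : fieldType) (s : seq C) (D : C) j : D != 0 ->
  (\prod_(w <- s) ('X - (D * w)%:P))`_j = D ^+ (size s - j) * (\prod_(w <- s) ('X - w%:P))`_j.
Proof.
move=> D0; have [le|lt] := leqP j (size s); last first.
  by rewrite !nth_default ?mulr0 ?size_prod_XsubC.
apply: (mulfI (expf_neq0 j D0)); rewrite mulrA -exprD subnKC //.
have coefZX (p : {poly C}) i : (p \Po (D *: 'X))`_i = D ^+ i * p`_i.
  rewrite comp_polyE coef_sum.
  have [lt|ge] := ltnP i (size p); last first.
    rewrite (nth_default _ ge) mulr0 big1 // => k _.
    by rewrite exprZn !coefZ coefXn gtn_eqF ?mulr0 // (leq_trans (ltn_ord k)).
  rewrite (bigD1 (Ordinal lt)) //= exprZn !coefZ coefXn eqxx mulr1 mulrC big1 ?addr0 // => k ne.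
  rewrite exprZn !coefZ coefXn; case: eqP => [e|_]; rewrite ?mulr0 //.
  by case/eqP: ne; apply: val_inj; rewrite /= e.
rewrite -coefZX -coefZ.
suff -> : (\prod_(w <- s) ('X - (D * w)%:P)) \Po (D *: 'X) = D ^+ size s *: \prod_(w <- s) ('X - w%:P) by [].
elim: s {le} => [|w s IH]; first by rewrite !big_nil scale1r -polyC1 comp_polyC.
rewrite !big_cons comp_polyM IH /= exprS comp_polyB comp_polyX comp_polyC polyCM mul_polyC -scalerBr.
by rewrite -scalerAl -scalerAr scalerA.
Qed.

Section LinearForms.
Variables (C : fieldType) (n : nat).

Definition Lin c : {mpoly C[n]} := \sum_(i < n) c%:R ^+ i *: 'X_i.

Lemma meval_Lin c x : meval_row (Lin c) x = linform c x.
Proof.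
rewrite /meval_row /Lin raddf_sum; apply: eq_bigr => i _.
by rewrite /= mevalZ mevalXU.
Qed.

Lemma dhomogXi i : ('X_i : {mpoly C[n]}) \is 1.-homog.
Proof. by rewrite dhomogX /= mdeg1. Qed.

Lemma Lin_homog c : Lin c \is 1.-homog.
Proof. by apply: dhomog_sum => i _; apply: dhomogZ; apply: dhomogXi. Qed.

Lemma linformZ c a (x : 'rV[C]_n) : linform c (a *: x) = a * linform c x.
Proof. by rewrite /linform mulr_sumr; apply: eq_bigr => i _; rewrite mxE mulrCA. Qed.

Lemma linformB c (x y : 'rV[C]_n) : linform c (x - y) = linform c x - linform c y.
Proof. by rewrite /linform -sumrB; apply: eq_bigr => i _; rewrite !mxE mulrBr. Qed.

End LinearForms.

Lemma cmorphism_id (C : fieldType) T n (e : T -> pspace C n) : cmorphism e e id.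
Proof.
move=> P; exists 1%N, (fun i => 'X_i).
have ev x : evrow (fun i => 'X_i : {mpoly C[n]}) x = x.
  by apply/rowP => i; rewrite mxE meval_rowXU.
split=> [i|x Px|Q x Qx _]; rewrite ?ev //; [exact: dhomogXi|exact: coords_neq0 Px].
Qed.

(** * The polynomial chi and the recovery of the fibre from its roots *)

Section Model.
Variables (K C : fieldType) (iota : {rmorphism K -> C}).
Hypothesis char0 : [pchar C] =i pred0.
Variables (X : Type) (n : nat) (eX : X -> pspace C n).
Hypotheses (injX : injective eX) (irrX : zirreducible eX (fun=> True)).
Variables (gT : finGroupType) (act : gT -> X -> X).
Hypothesis hG : automorphism_subgroup iota eX act.
Variables (Y : Type) (q : nat) (eY : Y -> pspace C q) (pi : X -> Y).
Hypothesis hpi : group_quotient iota eX act eY pi.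
Variables (d : nat) (u : Y -> pspace C d) (v : pspace C d -> Y).
Hypotheses (mu : cmorphism eY (@id (pspace C d)) u) (mv : cmorphism (@id (pspace C d)) eY v).
Hypotheses (uK : cancel u v).

Let vp (P : X) := vpick (val (eX P)).
Let vpP P : coords (eX P) (vp P). Proof. exact: coords_pick. Qed.
Let nG := #|gT|.

Lemma act_cmorphism g : cmorphism eX eX (act g).
Proof. exact: morphism_over_cmorphism (aut_morphism hG g). Qed.

Lemma free_orbit : exists P, injective (act^~ P).
Proof.
have [g|g|P hP] := @generic_point _ _ _ _ irrX gT (enum gT) (fun g P => g != 1%g /\ act g P = P).
- have [->|g1] := eqVneq g 1%g.
    have -> : (fun P => false /\ act 1%g P = P) = (fun=> False); last exact: zclosed0.
    by apply: boolp.funext => P; apply: boolp.propext; split=> // -[].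
  have -> : (fun P => true /\ act g P = P) = (fun P => act g P = P).
    by apply: boolp.funext => P; apply: boolp.propext; split=> // -[].
  exact: equalizer_closed injX (act_cmorphism g) (@cmorphism_id _ _ _ eX).
- apply: boolp.contrapT => nex; case: (irrX) => [[P0 _] _]; have [g1|g1] := eqVneq g 1%g.
    by apply: nex; exists P0 => -[]; rewrite g1 eqxx.
  case/eqP: g1; apply: (aut_faithful hG) => P; apply: boolp.contrapT => ne; apply: nex.
  by exists P => -[].
- exists P => g h e; apply/eqP; rewrite eq_mulVg1 -(inj_eq invg_inj) invg1 invMg invgK; apply/negPn/negP => gh.
  apply: (hP (h^-1 * g)%g); first by rewrite mem_enum.
  by split=> //; rewrite (aut_mul hG) e -(aut_mul hG) mulVg (aut_one hG).
Qed.

Section Forms.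
Variables (c1 c2 : nat).
Definition theta (P : X) : C := linform c2 (vp P) / linform c1 (vp P).
Let zc i := hratio eX 'X_i (Lin C n c1).

Lemma thetaE P x : coords (eX P) x -> theta P = linform c2 x / linform c1 x.
Proof.
move=> Px; rewrite /theta -!meval_Lin; exact: (hratioE (Lin_homog _ _ _) (Lin_homog _ _ _) Px).
Qed.

Let W P := forall g, linform c1 (vp (act g P)) != 0.
Let U Q := forall P, pi P = Q -> W P.

Let UW P : U (pi P) <-> W P.
Proof.
split=> [h|hW P' /esym/(quo_orbits hpi)[k ->] g]; first exact: h.
by rewrite -(aut_mul hG).
Qed.

Let oU : zopen eY U.
Proof.
apply/(quo_topology hpi).
have -> : (fun P => ~ U (pi P)) = (fun P => exists2 g, g \in enum gT & ~ (linform c1 (vp (act g P)) != 0)).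
  apply: boolp.funext => P; apply: boolp.propext; split.
    move=> nU; apply: boolp.contrapT => nex; apply: nU; apply/UW => g.
    by apply: boolp.contrapT => h; apply: nex; exists g; rewrite ?mem_enum.
  by move=> [g _ h] /UW/(_ g).
apply: zclosed_bigU => g.
apply: (@preimage_closed _ _ _ eX _ _ eX (act g) (fun P => ~ (linform c1 (vp P) != 0)) (act_cmorphism g)).
have := nonvanishing_open eX (Lin_homog C n c1).
by congr zclosed; apply: boolp.funext => P; rewrite meval_Lin.
Qed.

Let cpoly P : {poly C} := \prod_g ('X - (theta (act g P))%:P).
(** Numerator of the Lagrange interpolation of the i-th coordinate at the points theta(gP). Its
    value at theta(gP) carries a factor that does not depend on [i], harmless for homogeneous
    coordinates; hence no division is made. *)
Let bpoly i P : {poly C} := \sum_g zc i (act g P) *: \prod_(h | h != g) ('X - (theta (act h P))%:P).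
Let delta P : C := \prod_g \prod_(h | h != g) (theta (act g P) - theta (act h P)).

Let regW g A : A \is 1.-homog -> regular_on eX (fun P => U (pi P)) (fun P => hratio eX A (Lin C n c1) (act g P)).
Proof.
move=> hA; apply: (regular_hratio (act_cmorphism g) hA (Lin_homog C n c1)) => P /UW/(_ g).
by rewrite meval_Lin.
Qed.

Let regT g : regular_on eX (fun P => U (pi P)) (fun P => theta (act g P)).
Proof.
apply: regular_ext (regW g (Lin_homog C n c2)) => P _.
by rewrite /hratio !meval_Lin.
Qed.

Let I : finType := option ('I_nG.+1 + 'I_n * 'I_nG.+1).
Let hfun (i : I) P : C := match i with
  | None => delta P | Some (inl j) => (cpoly P)`_j | Some (inr (i, j)) => (bpoly i P)`_j end.

Let hreg i : regular_on eX (fun P => U (pi P)) (hfun i).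
Proof.
case: i => [[j|[i j]]|] /=.
- by apply: regular_poly_prod => g; apply: regular_polyXsubC.
- apply: regular_poly_sum => g; apply: regular_polyZ; first by apply: regW; apply: dhomogXi.
  by apply: regular_poly_prod => h; apply: regular_polyXsubC.
- apply: regular_prod => g; apply: regular_prod => h.
  apply: (@regular_ext _ _ _ _ _ (fun P => theta (act g P) + (-1) * theta (act h P))).
    by move=> P _; rewrite mulN1r.
  by apply: regularD => //; apply: regularM => //; apply: regular_const.
Qed.

Let hinv i k P : U (pi P) -> hfun i (act k P) = hfun i P.
Proof.
move=> _; case: i => [[j|[i j]]|] /=.
- suff -> : cpoly (act k P) = cpoly P by [].
  rewrite /cpoly [RHS](reindex_inj (mulIg k)) /=.
  by apply: eq_bigr => g _; rewrite (aut_mul hG).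
- suff -> : bpoly i (act k P) = bpoly i P by [].
  rewrite /bpoly [RHS](reindex_inj (mulIg k)) /=; apply: eq_bigr => g _.
  rewrite (aut_mul hG); congr (_ *: _); rewrite [RHS](reindex_inj (mulIg k)) /=.
  by apply: eq_big => [h|h _]; rewrite ?(inj_eq (mulIg k)) ?(aut_mul hG).
- rewrite /delta [RHS](reindex_inj (mulIg k)) /=; apply: eq_bigr => g _.
  rewrite [RHS](reindex_inj (mulIg k)) /=.
  by apply: eq_big => [h|h _]; rewrite ?(inj_eq (mulIg k)) ?(aut_mul hG).
Qed.

Definition evc (x : 'rV[C]_d) (p : {poly {mpoly C[d]}}) : {poly C} :=
  map_poly (meval (fun i => x 0 i)) p.

Lemma evc_coef x p j : (evc x p)`_j = meval_row p`_j x.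
Proof. exact: coef_map. Qed.

Lemma model_exists P0 x0 : coords (u (pi P0)) x0 -> W P0 ->
  injective (fun g => theta (act g P0)) ->
  exists (D E : {mpoly C[d]}) (chi : {poly {mpoly C[d]}}) (b : 'I_n -> {poly {mpoly C[d]}}),
  [/\ chi \is monic, size chi = nG.+1, meval_row E x0 != 0 &
   forall P x, coords (u (pi P)) x -> meval_row E x != 0 ->
     [/\ meval_row D x != 0, W P, injective (fun g => meval_row D x * theta (act g P)),
       evc x chi = \prod_g ('X - (meval_row D x * theta (act g P))%:P) &
       forall g, coords (eX (act g P)) (\row_i (evc x (b i)).[meval_row D x * theta (act g P)])]].
Proof.
move=> Px0 WP0 inj0.
have [D [N [D0 hN]]] := descend hpi mv uK (None : I) oU hreg hinv ((UW P0).2 WP0) Px0.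
(* Multiplying the roots by [D] multiplies the coefficient [N / D] of Z^j by [D^(nG - j)]: all the
   coefficients become polynomials while chi stays monic. *)
pose chi : {poly {mpoly C[d]}} :=
  \poly_(j < nG.+1) (if j == nG then 1 else D ^+ (nG.-1 - j) * N (Some (inl (inord j)))).
pose b i : {poly {mpoly C[d]}} := \poly_(j < nG) (D ^+ (nG.-1 - j) * N (Some (inr (i, inord j)))).
have chin : chi`_nG = 1 by rewrite coef_poly ltnSn eqxx.
have schi : size chi = nG.+1.
  apply/eqP; rewrite eqn_leq size_poly /= ltnNge; apply/negP => /leq_sizeP/(_ nG (leqnn _)).
  by rewrite chin => /eqP; rewrite oner_eq0.
have mchi : chi \is monic by rewrite monicE lead_coefE schi chin.
(* The fraction at index [None] is the product [delta] of the differences of the roots. Where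
   [D * N None] is nonzero, the fractions are defined and the roots are distinct. *)
exists D, (D * N None), chi, b; split=> //.
  rewrite meval_rowM mulf_neq0 //; have [_ /(_ None) /= e] := hN P0 x0 Px0 D0.
  have : delta P0 != 0.
    apply/prodf_neq0 => g _; apply/prodf_neq0 => h hg.
    by rewrite subr_eq0 (inj_eq inj0) eq_sym.
  by rewrite e mulf_eq0 negb_or => /andP[].
move=> P x Px; rewrite meval_rowM mulf_eq0 negb_or => /andP[Dx Nx].
have [UP hP] := hN P x Px Dx; have WP := (UW P).1 UP.
set Dv := meval_row D x in Dx hP *.
have d0 : delta P != 0 by have /= -> := hP None; rewrite mulf_neq0 ?invr_neq0.
have injt : injective (fun g => theta (act g P)).
  move=> g h e; apply/eqP; apply: contraNT d0 => gh.
  rewrite /delta (bigD1 g) //= (bigD1 h) //=; last by rewrite eq_sym.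
  by rewrite e subrr !mul0r.
have sI : size (index_enum gT) = nG by rewrite /nG cardE enumT [index_enum _]unlock.
have sF k : size [seq h <- index_enum gT | h != k] = nG.-1.
  by rewrite -sum1_size big_filter sum1_card -(cardC1 k); apply: eq_card.
have nG0 : (0 < nG)%N by apply/card_gt0P; exists 1%g.
split=> //; first by move=> g h /(mulfI Dx)/injt.
  apply/polyP => j; rewrite evc_coef coef_poly.
  rewrite -(big_map (fun g => theta (act g P)) xpredT (fun w => 'X - (Dv * w)%:P)).
  rewrite coef_prod_scale // size_map big_map sI.
  have -> : \prod_(g <- index_enum gT) ('X - (theta (act g P))%:P) = cpoly P by [].
  case: ltnP => [|lt]; last first.
    rewrite /meval_row meval0 [(cpoly P)`_j]nth_default ?mulr0 //.
    by rewrite /cpoly size_prod_XsubC sI.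
  rewrite ltnS => le; case: eqP => [->|/eqP ne].
    rewrite subnn mul1r /meval_row meval1.
    have := monicP (monic_prod_XsubC (index_enum gT) xpredT (fun g => theta (act g P))).
    by rewrite lead_coefE size_prod_XsubC sI.
  have ltj : (j < nG)%N by rewrite ltn_neqAle ne.
  have /= := hP (Some (inl (inord j))); rewrite inordK ?ltnS // => ->.
  rewrite meval_rowM /meval_row rmorphXn /= -/(meval_row _ _) -/Dv.
  rewrite -/(meval_row _ _) mulrA mulrAC; congr (_ * _).
  have -> : (nG - j = (nG.-1 - j).+1)%N by lia.
  by rewrite exprSr mulfK.
move=> g; set y := Dv * theta (act g P).
pose kap := \prod_(h | h != g) (y - Dv * theta (act h P)).
have kap0 : kap != 0.
  apply/prodf_neq0 => h hg; rewrite -mulrBr mulf_neq0 // subr_eq0 (inj_eq injt) eq_sym //.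
have evb i : evc x (b i) = Dv *: \sum_g zc i (act g P) *: \prod_(h | h != g) ('X - (Dv * theta (act h P))%:P).
  apply/polyP => j; rewrite evc_coef coefZ coef_sum.
  transitivity (Dv * (Dv ^+ (nG.-1 - j) * (bpoly i P)`_j)); last first.
    congr (_ * _); rewrite coef_sum mulr_sumr; apply: eq_bigr => k _; rewrite !coefZ mulrCA; congr (_ * _).
    have := @coef_prod_scale C [seq theta (act h P) | h <- [seq h <- index_enum gT | h != k]] Dv j Dx.
    by rewrite !big_map size_map !big_filter sF => ->.
  rewrite /b coef_poly; case: ltnP => [lt|ge].
    have /= := hP (Some (inr (i, inord j))); rewrite inordK; last exact: ltnW.
    move=> ->; rewrite meval_rowM /meval_row rmorphXn /= -/(meval_row _ _) -/Dv -/(meval_row _ _).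
    by field.
  rewrite /meval_row meval0 [(bpoly i P)`_j]nth_default ?mulr0 //.
  apply: leq_trans ge; apply: (leq_trans (size_sum _ _ _)); apply/bigmax_leqP => k _.
  apply: (leq_trans (size_scale_leq _ _)); rewrite -big_filter.
  rewrite -(big_map (fun h => theta (act h P)) xpredT (fun w => 'X - w%:P)).
  by rewrite size_prod_XsubC size_map sF prednK.
have l0 : linform c1 (vp (act g P)) != 0 by apply: WP.
have -> : \row_i (evc x (b i)).[y] = (Dv * kap * (linform c1 (vp (act g P)))^-1) *: vp (act g P).
  apply/rowP => i; rewrite !mxE evb hornerZ horner_sum (bigD1 g) //=.
  have -> : \sum_(k | k != g) (zc i (act k P) *:
      \prod_(h | h != k) ('X - (Dv * theta (act h P))%:P)).[y] = 0.
    apply: big1 => k kg; rewrite hornerZ horner_prod (bigD1 g) //=; last by rewrite eq_sym.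
    by rewrite hornerXsubC subrr mul0r mulr0.
  have kE : \prod_(h | h != g) ('X - (Dv * theta (act h P))%:P).[y] = kap.
    by apply: eq_bigr => h _; rewrite hornerXsubC.
  rewrite addr0 hornerZ horner_prod kE /zc /hratio meval_rowXU meval_Lin -/(vp _).
  by rewrite -!mulrA; congr (_ * _); rewrite mulrA mulrC [_ * vp _ 0 i]mulrC.
by apply: coords_scale => //; rewrite mulf_neq0 ?mulf_neq0 ?invr_neq0.
Qed.

End Forms.
End Model.

Section Model.
Variables (K C : fieldType) (iota : {rmorphism K -> C}).
Hypothesis char0 : [pchar C] =i pred0.
Variables (X : Type) (n : nat) (eX : X -> pspace C n).
Hypotheses (injX : injective eX) (irrX : zirreducible eX (fun=> True)).
Variables (gT : finGroupType) (act : gT -> X -> X).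
Hypothesis hG : automorphism_subgroup iota eX act.
Variables (Y : Type) (q : nat) (eY : Y -> pspace C q) (pi : X -> Y).
Hypothesis hpi : group_quotient iota eX act eY pi.
Variables (d : nat) (u : Y -> pspace C d) (v : pspace C d -> Y).
Hypotheses (mu : cmorphism eY (@id (pspace C d)) u) (mv : cmorphism (@id (pspace C d)) eY v).
Hypotheses (uK : cancel u v).

Lemma good_forms : exists c1 c2 P, (forall g, linform c1 (vpick (val (eX (act g P)))) != 0) /\
  injective (fun g => theta eX c1 c2 (act g P)).
Proof.
have [P freeP] := free_orbit injX irrX hG.
pose x g := vpick (val (eX (act g P))).
have xP g : coords (eX (act g P)) (x g) by apply: coords_pick.
have [c1 hc1] := @exists_linform C char0 n gT (enum gT) x.
have l1 g : linform c1 (x g) != 0 by apply: hc1; rewrite ?mem_enum ?(coords_neq0 (xP g)).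
pose z g := (linform c1 (x g))^-1 *: x g.
have [c2 hc2] := @exists_linform C char0 n (gT * gT)%type (enum {: gT * gT}) (fun gh => z gh.1 - z gh.2).
exists c1, c2, P; split=> // g h e; apply/eqP/negPn/negP => gh.
have /= := hc2 (g, h); rewrite mem_enum => /(_ isT) nz.
suff : linform c2 (z g - z h) != 0.
  rewrite linformB !linformZ; move: e; rewrite /theta -/(x g) -/(x h) => e.
  by rewrite mulrC e mulrC subrr eqxx.
apply: nz; rewrite subr_eq0; apply: contra gh => /eqP ez; apply/eqP/freeP/injX.
apply: (coords_inj (x := z g)); last rewrite ez; apply: coords_scale => //; by rewrite invr_neq0.
Qed.

(** If [p * r = chi], the functions p(t, y) and r(t, y) on an open set of X have product 0, so one
    of them vanishes identically by irreducibility. Evaluated along an orbit, the corresponding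
    factor has [#|gT|] distinct roots, that is, the full degree of chi. *)
Lemma model_irreducible c1 c2 (D E : {mpoly C[d]}) (chi : {poly {mpoly C[d]}}) P0 i0 :
  chi \is monic -> size chi = #|gT|.+1 ->
  let t P := \row_i hratio (@id (pspace C d)) 'X_i 'X_i0 (u (pi P)) in
  meval_row 'X_i0 (vpick (val (u (pi P0)))) != 0 -> meval_row E (t P0) != 0 ->
  (forall P x, coords (u (pi P)) x -> meval_row E x != 0 ->
     [/\ forall g, linform c1 (vpick (val (eX (act g P)))) != 0,
       injective (fun g => meval_row D x * theta eX c1 c2 (act g P)) &
       evc x chi = \prod_g ('X - (meval_row D x * theta eX c1 c2 (act g P))%:P)]) ->
  forall p q : {poly {mpoly C[d]}}, p \is monic -> q \is monic -> p * q = chi ->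
    size p = 1%N \/ size q = 1%N.
Proof.
move=> mchi schi t P00 E0 hchi p r mp mr epr.
have mpi : cmorphism eX (@id (pspace C d)) (u \o pi).
  exact: cmorphism_comp (morphism_over_cmorphism (quo_morphism hpi)) mu.
pose V P := meval_row 'X_i0 (vpick (val (u (pi P)))) != 0 :> C.
have tP P : V P -> coords (u (pi P)) (t P).
  move=> VP; have Px := coords_pick (u (pi P)); set x := vpick _ in Px.
  have -> : t P = (meval_row 'X_i0 x)^-1 *: x.
    by apply/rowP => i; rewrite !mxE /hratio -/x [meval_row 'X_i _]meval_rowXU mulrC.
  by apply: coords_scale => //; rewrite invr_neq0.
have oV : zopen eX V.
  have := preimage_closed mpi (nonvanishing_open (@id (pspace C d)) (dhomogXi C i0)).
  by [].
have rt i : regular_on eX V (fun P => hratio (@id (pspace C d)) 'X_i 'X_i0 (u (pi P))).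
  by apply: (regular_hratio mpi (dhomogXi C i) (dhomogXi C i0)) => P; apply.
have rev (H : {mpoly C[d]}) : regular_on eX V (fun P => meval_row H (t P)) by apply: regular_mpoly.
pose U P := V P /\ meval_row E (t P) != 0.
have oU : zopen eX U.
  have := regular_zeros_closed oV (rev E); congr zclosed; apply: boolp.funext => P.
  apply: boolp.propext; split=> [h [VP]|h VP]; first by rewrite h // eqxx.
  by apply/eqP/negPn/negP => EP; apply: h.
pose y P := meval_row D (t P) * theta eX c1 c2 P.
have UL P : U P -> linform c1 (vpick (val (eX P))) != 0.
  move=> [VP EP]; have [h _ _] := hchi P (t P) (tP P VP) EP.
  by have := h 1%g; rewrite (aut_one hG).
have ry : regular_on eX U y.
  apply: regularM; first by apply: regular_sub (rev D) => P [].
  apply: (@regular_ext _ _ _ _ _ (fun P => hratio eX (Lin C n c2) (Lin C n c1) P)) => [P _|].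
    by rewrite /hratio !meval_Lin.
  apply: (regular_hratio (@cmorphism_id _ _ _ eX) (Lin_homog C n c2) (Lin_homog C n c1)) => P /UL.
  by rewrite meval_Lin.
have revy (H : {poly {mpoly C[d]}}) : regular_on eX U (fun P => (evc (t P) H).[y P]).
  apply: (@regular_ext _ _ _ _ _ (fun P => \sum_(j <- enum 'I_(size H)) meval_row (H`_j) (t P) * y P ^+ j)).
    move=> P _; rewrite (@horner_coef_wide _ (size H)); last by rewrite /evc size_poly.
    by rewrite big_enum /=; apply: eq_bigr => j _; rewrite evc_coef.
  apply: regular_sum => j; apply: regularM; last exact: regularX.
  by apply: regular_sub (rev _) => P [].
have tact P g : t (act g P) = t P.
  have e : pi (act g P) = pi P by apply/esym/(quo_orbits hpi); exists g.
  by apply/rowP => i; rewrite !mxE /hratio e.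
have Uact P g : U P -> U (act g P).
  have e : pi (act g P) = pi P by apply/esym/(quo_orbits hpi); exists g.
  by move=> [VP EP]; split; rewrite ?tact // /V e.
have roots (H : {poly {mpoly C[d]}}) P : H \is monic -> U P -> (forall Q, U Q -> (evc (t Q) H).[y Q] = 0) ->
    (#|gT| < size H)%N.
  move=> mH UP hH; have [VP EP] := UP; have [_ injy _] := hchi P (t P) (tP P VP) EP.
  have mH' : evc (t P) H \is monic by apply: monic_map.
  have sH : size (evc (t P) H) = size H.
    by rewrite size_map_poly_id0 // (monicP mH) rmorph1 oner_eq0.
  rewrite -sH cardE -(size_map (fun g => meval_row D (t P) * theta eX c1 c2 (act g P))).
  apply: max_poly_roots; first exact: monic_neq0.
    apply/allP => _ /mapP[g _ ->]; apply/rootP.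
    by have := hH _ (Uact P g UP); rewrite /y tact.
  by rewrite map_inj_uniq ?enum_uniq.
have U0 : U P0 by [].
have smul : (size p + size r = #|gT|.+2)%N.
  have := size_Mmonic (monic_neq0 mp) mr; rewrite epr schi.
  have : (0 < size p)%N by rewrite size_poly_gt0 monic_neq0.
  by case: (size p) => // a _; rewrite addSn /= => <-.
have r0 : (0 < size r)%N by rewrite size_poly_gt0 monic_neq0.
have p0 : (0 < size p)%N by rewrite size_poly_gt0 monic_neq0.
have [||P|hp|hr] := @zirr_cover _ _ _ _ irrX (fun P => U P -> (evc (t P) p).[y P] = 0)
  (fun P => U P -> (evc (t P) r).[y P] = 0).
- exact: regular_zeros_closed oU (revy p).
- exact: regular_zeros_closed oU (revy r).
- have [[VP EP]|nU] := boolp.EM (U P); last by left.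
  have [_ _ e] := hchi P (t P) (tP P VP) EP.
  have : (evc (t P) p).[y P] * (evc (t P) r).[y P] = 0.
    rewrite -hornerM -[evc _ p * _]rmorphM /= epr -/(evc (t P) chi) e horner_prod (bigD1 1%g) //=.
    by rewrite (aut_one hG) hornerXsubC subrr mul0r.
  by move=> /eqP; rewrite mulf_eq0 => /orP[/eqP h|/eqP h]; [left|right].
- by right; have := roots p P0 mp U0 hp; lia.
- by left; have := roots r P0 mr U0 hr; lia.
Qed.

(** The relations hold for every vector [x] of homogeneous coordinates with [E(x)] nonzero. Integer
    vectors thus serve directly as points of projective space, without a choice of affine chart. *)
Theorem geometric_model :
  exists (c1 c2 : nat) (D E : {mpoly C[d]}) (chi : {poly {mpoly C[d]}}) (b : 'I_n -> {poly {mpoly C[d]}}),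
  [/\ chi \is monic, size chi = #|gT|.+1,
   exists P x, coords (u (pi P)) x /\ meval_row E x != 0,
   forall P x, coords (u (pi P)) x -> meval_row E x != 0 ->
     [/\ meval_row D x != 0, forall g, linform c1 (vpick (val (eX (act g P)))) != 0,
       injective (fun g => meval_row D x * theta eX c1 c2 (act g P)),
       evc x chi = \prod_g ('X - (meval_row D x * theta eX c1 c2 (act g P))%:P) &
       forall g, coords (eX (act g P)) (\row_i (evc x (b i)).[meval_row D x * theta eX c1 c2 (act g P)])] &
   forall p q, p \is monic -> q \is monic -> p * q = chi -> size p = 1%N \/ size q = 1%N].
Proof.
have [c1 [c2 [P0 [W0 inj0]]]] := good_forms.
have Px := coords_pick (u (pi P0)); set x := vpick _ in Px.
have /rV0Pn[i0 xi0] := coords_neq0 Px.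
pose t P := \row_i hratio (@id (pspace C d)) 'X_i 'X_i0 (u (pi P)).
have Pt : coords (u (pi P0)) (t P0).
  have -> : t P0 = (x 0 i0)^-1 *: x.
    by apply/rowP => i; rewrite !mxE /hratio -/x !meval_rowXU mulrC.
  by apply: coords_scale => //; rewrite invr_neq0.
have [D [E [chi [b [mchi schi E0 h]]]]] := model_exists hG hpi mv uK Pt W0 inj0.
exists c1, c2, D, E, chi, b; split=> //.
  by exists P0, (t P0).
move=> p r mp mr e; apply: (@model_irreducible c1 c2 D E chi P0 i0 mchi schi _ _ _ p r mp mr e) => //.
  by rewrite meval_rowXU.
by move=> P y Py Ey; have [? ? ? ? ?] := h P y Py Ey.
Qed.

End Model.

(** * Irreducibility on a line *)

Lemma rmorph_mpoly_ext (C : fieldType) d (S : comNzRingType) (f g : {rmorphism {mpoly C[d]} -> S}) :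
  (forall c, f c%:MP = g c%:MP) -> (forall i, f 'X_i = g 'X_i) -> f =1 g.
Proof.
move=> hC hX p; rewrite [p]mpolyE !rmorph_sum; apply: eq_bigr => m _.
rewrite -mul_mpolyC !rmorphM hC; congr (_ * _).
rewrite mpolyXE_id !rmorph_prod; apply: eq_bigr => i _.
by rewrite !rmorphXn hX.
Qed.

(** * A bound for the degree in T of a monic factor *)

Section FactorDegree.
Variables (C : fieldType) (chi : {poly {poly C}}) (D : nat).
Hypotheses (mchi : chi \is monic) (sD : forall j, (size (chi`_j)%R <= D.+1)%N).

Let wt (P : {poly {poly C}}) : {poly {poly C}} := \poly_(j < size P) ('X ^+ (D * j) * P`_j).

Let wt_comp P : wt P = P \Po (('X ^+ D)%:P * 'X).
Proof.
rewrite comp_polyE /wt poly_def; apply: eq_bigr => j _.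
by rewrite exprMn -polyC_exp -exprM -mul_polyC -[in RHS]mul_polyC mulrA -polyCM mulrC [_`_j * _]mulrC mulrC.
Qed.

Let wtM P Q : wt (P * Q) = wt P * wt Q.
Proof. by rewrite !wt_comp comp_polyM. Qed.

Let coef_wt P j : (wt P)`_j = 'X ^+ (D * j) * P`_j.
Proof.
rewrite coef_poly; case: ltnP => // le.
by rewrite nth_default ?mulr0.
Qed.

(** Give T weight 1 and Z weight [D], by Z -> T^D Z. Then chi, of degree N in Z, has T-degree at
    most D N, and a monic factor of degree r in Z has T-degree at least D r. As the T-degree is
    additive, the lower bound for one factor bounds the other from above. *)
Lemma size_factor_coef p q j : p \is monic -> q \is monic -> p * q = chi ->
  (size (p`_j)%R <= (D * (size chi).-1).+1)%N.
Proof.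
move=> mp mq e; pose N := (size chi).-1.
have sp0 : (0 < size p)%N by rewrite size_poly_gt0 monic_neq0.
have sq0 : (0 < size q)%N by rewrite size_poly_gt0 monic_neq0.
have sN : N = ((size p).-1 + (size q).-1)%N.
  by rewrite /N -e size_Mmonic ?monic_neq0 //; move: sp0 sq0; case: (size p) => // a; case: (size q) => // b; rewrite addnS.
have wtm (r : {poly {poly C}}) : r \is monic -> ((D * (size r).-1).+1 <= sizeY (wt r))%N.
  move=> mr; apply: leq_trans (max_size_coefXY _ (size r).-1).
  by rewrite coef_wt -lead_coefE (monicP mr) mulr1 size_polyXn.
have wchi : (sizeY (wt chi) <= (D * N).+1)%N.
  rewrite /sizeY; apply/bigmax_leqP => i _; rewrite coef_wt.
  have [->|iN] := eqVneq (i : nat) N.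
    by rewrite -lead_coefE (monicP mchi) mulr1 size_polyXn.
  have [->|c0] := eqVneq chi`_i 0; first by rewrite mulr0 size_poly0.
  have ltN : (i < N)%N.
    rewrite ltn_neqAle iN /N -ltnS prednK ?size_poly_gt0 ?monic_neq0 //.
    by rewrite ltnNge; apply: contra c0 => le; rewrite nth_default.
  rewrite size_mul ?expf_neq0 ?polyX_eq0 // size_polyXn ?addSn /=.
  rewrite (leq_trans (leq_add (leqnn _) (sD i))) // addnS ltnS -mulnSr leq_mul2l ltN orbT //.
have wt0 (r : {poly {poly C}}) : r \is monic -> swapXY (wt r) != 0.
  move=> mr; rewrite swapXY_eq0; apply/eqP => /polyP/(_ (size r).-1).
  rewrite coef_wt -lead_coefE (monicP mr) mulr1 coef0 => /eqP.
  by rewrite expf_eq0 polyX_eq0 andbF.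
have sM : sizeY (wt chi) = (sizeY (wt p) + sizeY (wt q)).-1.
  by rewrite -e wtM !sizeYE rmorphM size_mul ?wt0.
have h1 := wtm q mq; have h2 : (sizeY (wt p) <= (D * (size p).-1).+1)%N.
  move: wchi; rewrite sM sN mulnDr; move: h1.
  move: (sizeY (wt p)) (sizeY (wt q)) (D * _)%N (D * _)%N => a b x y; lia.
have h3 := leq_trans (max_size_coefXY (wt p) j) h2.
have [->|p0] := eqVneq p`_j 0; first by rewrite size_poly0.
move: h3; rewrite coef_wt size_mul ?expf_neq0 ?polyX_eq0 // size_polyXn ?addSn /= => h3.
apply: leq_trans (leq_addl (D * j) _) _; apply: (leq_trans h3).
by rewrite ltnS leq_mul2l -/N sN leq_addr orbT.
Qed.

End FactorDegree.

Section Truncation.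
Variables (R : idomainType) (m : nat).

Definition congX (P Q : {poly {poly R}}) := exists E, P = Q + ('X ^+ m)%:P * E.

Lemma congX_sym P Q : congX P Q -> congX Q P.
Proof. by move=> [E ->]; exists (- E); rewrite mulrN addrK. Qed.

Lemma congX_trans P Q S : congX P Q -> congX Q S -> congX P S.
Proof. by move=> [E ->] [E' ->]; exists (E' + E); rewrite mulrDr addrA. Qed.

Lemma congXM P Q P' Q' : congX P Q -> congX P' Q' -> congX (P * P') (Q * Q').
Proof.
move=> [E ->] [E' ->]; exists (Q * E' + E * Q' + ('X ^+ m)%:P * E * E'); ring.
Qed.

Lemma congX_eq (P Q : {poly {poly R}}) : (forall j, (size (P`_j)%R <= m)%N) -> (forall j, (size (Q`_j)%R <= m)%N) ->
  congX P Q -> P = Q.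
Proof.
move=> sP sQ [E e]; apply/polyP => j; apply/eqP; rewrite -subr_eq0; apply/negPn/negP => ne.
have eE : P`_j - Q`_j = 'X ^+ m * E`_j by rewrite e coefD coefCM addrAC subrr add0r.
have : (size (P`_j - Q`_j)%R <= m)%N by rewrite (leq_trans (size_polyD _ _)) // size_polyN geq_max sP sQ.
move: ne; rewrite eE mulf_eq0 negb_or => /andP[x0 E0].
rewrite size_mul // size_polyXn ?addSn /=.
have : (0 < size (E`_j)%R)%N by rewrite size_poly_gt0.
by case: (size _) => // a _; rewrite addnS ltnNge leq_addr.
Qed.

Lemma congX_truncate B (P : {poly {poly R}}) : (B < m)%N -> (forall s j, (B < j < m)%N -> (P`_s)`_j = 0) ->
  congX P (\poly_(s < size P) take_poly B.+1 P`_s).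
Proof.
move=> Bm h; exists (\poly_(s < size P) drop_poly m P`_s); apply/polyP => s.
rewrite coefD coefCM !coef_poly; case: ltnP => [lt|le]; last first.
  by rewrite nth_default // mulr0 addr0.
rewrite -[LHS](poly_take_drop m) mulrC; congr (_ + _).
apply/polyP => j; rewrite !coef_take_poly ltnS.
have [jB|Bj] := leqP j B; first by rewrite (leq_ltn_trans jB Bm).
by case: ltnP => // jm; rewrite h ?Bj.
Qed.

End Truncation.

(** * Special and generic lines through a point *)

Section Line.
Variables (C : closedFieldType) (d : nat).
Hypothesis char0 : [pchar C] =i pred0.
Variable t : 'rV[C]_d.

Definition line_eval (v : 'I_d -> C) : {rmorphism {mpoly C[d]} -> {poly C}} :=
  (meval (fun i => (t 0 i)%:P + v i *: 'X) \o map_mpoly (@polyC C)).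

(** The direction is the vector of the variables themselves; giving them values recovers
    [line_eval]. *)
Definition generic_line : {rmorphism {mpoly C[d]} -> {poly {mpoly C[d]}}} :=
  (meval (fun i => (t 0 i)%:MP%:P + 'X_i *: 'X) \o map_mpoly (@polyC {mpoly C[d]} \o @mpolyC d C)).

Lemma line_evalC v c : line_eval v c%:MP = c%:P.
Proof. by rewrite /= map_mpolyC mevalC. Qed.

Lemma line_evalX v i : line_eval v 'X_i = (t 0 i)%:P + v i *: 'X.
Proof. by rewrite /= map_mpolyX mevalXU. Qed.

Lemma generic_lineC c : generic_line c%:MP = c%:MP%:P.
Proof. by rewrite /= map_mpolyC mevalC. Qed.

Lemma generic_lineX i : generic_line 'X_i = (t 0 i)%:MP%:P + 'X_i *: 'X.
Proof. by rewrite /= map_mpolyX mevalXU. Qed.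

Lemma line_eval_generic v p : map_poly (meval v) (generic_line p) = line_eval v p.
Proof.
apply: (@rmorph_mpoly_ext _ _ _ (map_poly (meval v) \o generic_line) (line_eval v)) => [c|i].
  by rewrite line_evalC -[LHS]/(map_poly (meval v) (generic_line c%:MP)) generic_lineC map_polyC /= mevalC.
rewrite line_evalX -[LHS]/(map_poly (meval v) (generic_line 'X_i)) generic_lineX rmorphD /= map_polyC /= mevalC.
by rewrite map_polyZ map_polyX /= mevalXU.
Qed.

Lemma line_eval_horner v p c : (line_eval v p).[c] = meval_row p (\row_i (t 0 i + v i * c)).
Proof.
apply: (@rmorph_mpoly_ext _ _ _ (horner_eval c \o line_eval v) (meval (fun i => (\row_i (t 0 i + v i * c)) 0 i))) => [a|i].
  by rewrite -[LHS]/((line_eval v a%:MP).[c]) line_evalC hornerC /= mevalC.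
by rewrite -[LHS]/((line_eval v 'X_i).[c]) line_evalX hornerD hornerZ hornerX hornerC /= mevalXU mxE.
Qed.

Lemma generic_line0 p : (generic_line p).[0] = (meval_row p t)%:MP.
Proof.
apply: (@rmorph_mpoly_ext _ _ _ (horner_eval 0 \o generic_line) (@mpolyC d C \o meval (fun i => t 0 i))) => [a|i].
  by rewrite -[LHS]/((generic_line a%:MP).[0]) generic_lineC hornerC /= mevalC.
by rewrite -[LHS]/((generic_line 'X_i).[0]) generic_lineX hornerD hornerZ hornerX hornerC mulr0 addr0 /= mevalXU.
Qed.

(* At T = 1 the generic line recovers the original variables. *)
Definition back : {rmorphism {poly {mpoly C[d]}} -> {mpoly C[d]}} :=
  (comp_mpoly [tuple 'X_i - (t 0 i)%:MP | i < d] \o horner_eval 1).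

Lemma generic_lineK p : back (generic_line p) = p.
Proof.
apply: (@rmorph_mpoly_ext _ _ _ (back \o generic_line) idfun) => [a|i].
  by rewrite -[LHS]/(comp_mpoly [tuple 'X_i - (t 0 i)%:MP | i < d] (generic_line a%:MP).[1]) generic_lineC hornerC comp_mpolyC.
rewrite -[LHS]/(comp_mpoly [tuple 'X_i - (t 0 i)%:MP | i < d] (generic_line 'X_i).[1]) generic_lineX hornerD hornerZ hornerX hornerC mulr1.
by rewrite comp_mpolyD comp_mpolyC comp_mpolyXU -tnth_nth tnth_mktuple addrC subrK.
Qed.

End Line.

Lemma congX_prod (S : idomainType) (I : finType) (w : I -> {poly S}) (J : {set I}) m (p : {poly {poly S}}) :
  injective (fun i => (w i).[0]) -> p \is monic -> size p = #|J|.+1 ->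
  (forall i, i \in J -> exists c, p.[w i] = c * 'X ^+ m) ->
  congX m p (\prod_(i in J) ('X - (w i)%:P)).
Proof.
move=> injw mp sp hp; have [||||E e] := @congr_prod_XsubC _ ('X ^+ m) [seq w i | i <- enum J] p.
- rewrite pairwise_map; apply: (@sub_pairwise _ [rel x y | x != y]); last by rewrite -uniq_pairwise enum_uniq.
  move=> i j /= ij; apply/boolp.asboolP/regular_mod_Xn.
  by rewrite hornerD hornerN subr_eq0 (inj_eq injw) eq_sym.
- exact: mp.
- by rewrite sp size_map -cardE.
- by move=> a /mapP[i]; rewrite mem_enum => iJ ->; apply: hp.
- by exists E; rewrite e big_map big_enum.
Qed.

Section IrreducibleLine.
Variables (C : closedFieldType) (d : nat).
Hypothesis char0 : [pchar C] =i pred0.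
Variables (t : 'rV[C]_d) (chi : {poly {mpoly C[d]}}).
Hypotheses (mchi : chi \is monic) (sep : separable_poly (evc t chi)).
Hypothesis irr : forall p q, p \is monic -> q \is monic -> p * q = chi ->
  size p = 1%N \/ size q = 1%N.

Let R := {mpoly C[d]}.
Let chiL : {poly {poly R}} := map_poly (generic_line t) chi.
Let N := (size chi).-1.

Let sN : size chi = N.+1.
Proof. by rewrite prednK // size_poly_gt0 monic_neq0. Qed.

Let mchiL : chiL \is monic. Proof. exact: monic_map. Qed.

Let schiL : size chiL = N.+1.
Proof. by rewrite size_map_poly_id0 // (monicP mchi) rmorph1 oner_eq0. Qed.

Let evp0 : evp 0 chiL = map_poly (@mpolyC d C) (evc t chi).
Proof.
rewrite /evp /chiL /evc -!map_poly_comp; apply: eq_map_poly => p /=.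
by rewrite /horner_eval -[LHS]/((generic_line t p).[0]) generic_line0.
Qed.

Lemma line_roots m : exists (y : 'I_N -> C) (Phi : 'I_N -> {poly R}),
  [/\ injective y, evc t chi = \prod_i ('X - (y i)%:P), forall i, (Phi i).[0] = (y i)%:MP &
   forall i, exists c, chiL.[Phi i] = c * 'X ^+ m].
Proof.
have mev : evc t chi \is monic by apply: monic_map.
have sev : size (evc t chi) = N.+1.
  by rewrite size_map_poly_id0 // (monicP mchi) rmorph1 oner_eq0.
have [ys eys] := closed_field_poly_normal (evc t chi).
rewrite (monicP mev) scale1r in eys.
have uys : uniq ys by rewrite -separable_prod_XsubC -eys.
have szy : size ys = N by apply: succn_inj; rewrite -sev eys size_prod_XsubC.
pose y (i : 'I_N) := ys`_i.
have injy : injective y.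
  by move=> i j /eqP; rewrite nth_uniq ?szy // => /eqP; apply: val_inj.
have ry (i : 'I_N) : root (evc t chi) (y i).
  by rewrite eys root_prod_XsubC mem_nth // szy.
have H (i : 'I_N) : exists phi : {poly R}, phi.[0] = (y i)%:MP /\ exists q, chiL.[phi] = q * 'X ^+ m.
  apply: hensel_root; first by rewrite evp_horner evp0 horner_map (rootP (ry i)) rmorph0.
  rewrite evp_horner /evp -deriv_map -/(evp 0 chiL) evp0 deriv_map horner_map.
  apply: rmorph_unit; rewrite unitfE; have /factor_theorem[r er] := ry i.
  move: sep; rewrite er separable_root => /andP[_ nr].
  by rewrite derivM derivXsubC !hornerE subrr mulr0 add0r.
have [Phi hPhi] := boolp.choice H; exists y, Phi; split=> [||i|i] //; try by have [] := hPhi i.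
rewrite eys (big_nth 0) szy big_mkord; exact: eq_bigr.
Qed.

(** A Bertini argument on power series. On the generic line chi splits into branches modulo T^m. If,
    for a proper nonempty set I of branches, neither the product over I nor that over its complement
    had a term of degree between [B] and [m], their truncations would multiply to chi exactly and
    [back] would factor the original polynomial. So each I leaves such a nonzero coefficient, a
    polynomial in the direction. In a direction where none of them vanishes, a factor would violate
    the degree bound [B]. *)
Lemma irreducible_line : exists v : 'I_d -> nat, forall p q : {poly {poly C}},
  p \is monic -> q \is monic -> p * q = map_poly (line_eval t (fun i => (v i)%:R)) chi ->
  size p = 1%N \/ size q = 1%N.
Proof.
pose D := (\max_(j < size chiL) size (chiL`_j)%R)%N.
have sD j : (size (chiL`_j)%R <= D)%N.
  have [lt|le] := ltnP j (size chiL); last by rewrite nth_default // size_poly0.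
  by rewrite (leq_bigmax (Ordinal lt)).
(* [B] is the bound of [size_factor_coef]. The modulus exceeds the T-degrees of chi and of a product
   of two polynomials of degree at most [B], so that a congruence between them is an equality. *)
pose B := (D * N)%N; pose m := (B.+1 + B.+1 + D)%N.
have [y [Phi [injy ey Phi0 hPhi]]] := line_roots m.
have injPhi : injective (fun i => (Phi i).[0]).
  by move=> i j; rewrite !Phi0 => /(congr1 (meval (fun=> 0 : C))); rewrite !mevalC => /injy.
pose PhiI (I : {set 'I_N}) : {poly {poly R}} := \prod_(i in I) ('X - (Phi i)%:P).
have sPhiI I : size (PhiI I) = #|I|.+1.
  by rewrite /PhiI -big_enum size_prod_XsubC -cardE.
have mPhiI I : PhiI I \is monic by apply: monic_prod_XsubC.
have chiPhi : congX m chiL (PhiI [set: 'I_N]).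
  by apply: congX_prod => //; rewrite cardsT card_ord.
have PhiC I : PhiI I * PhiI (~: I) = PhiI [set: 'I_N].
  rewrite /PhiI [RHS](big_setID I) /= setTI; congr (_ * _).
  by apply: eq_bigl => i; rewrite !inE andbT.
have HI (I : {set 'I_N}) : exists c : R, c != 0 /\ (I != set0 -> I != [set: 'I_N] ->
    forall v, meval v c != 0 -> exists s j, (B < j < m)%N /\
    ((map_poly (meval v) (PhiI I)`_s)`_j != 0 \/ (map_poly (meval v) (PhiI (~: I))`_s)`_j != 0)).
  have [[J [s [j [jB hJ cJ]]]]|nex] := boolp.EM (exists J s j, [/\ (B < j < m)%N, J = I \/ J = ~: I & ((PhiI J)`_s)`_j != 0]).
    exists (((PhiI J)`_s)`_j); split=> // _ _ v nz; exists s, j; split=> //.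
    by case: hJ => <-; [left|right]; rewrite coef_map.
  exists 1; split; first exact: oner_neq0; move=> I0 IT.
  have hz J : J = I \/ J = ~: I -> forall s j, (B < j < m)%N -> ((PhiI J)`_s)`_j = 0.
    move=> hJ s j jB; apply/eqP/negPn/negP => nz; apply: nex; by exists J, s, j.
  have Bm : (B < m)%N by rewrite /m; lia.
  pose tr J : {poly {poly R}} := \poly_(s < size (PhiI J)) take_poly B.+1 (PhiI J)`_s.
  have trlead J : (tr J)`_#|J| = 1.
    rewrite coef_poly sPhiI ltnSn; have -> : (PhiI J)`_#|J| = 1.
      by rewrite -(monicP (mPhiI J)) lead_coefE sPhiI.
    by rewrite take_poly_id // size_poly1.
  have str J : size (tr J) = #|J|.+1.
    apply/eqP; rewrite eqn_leq -{1}sPhiI size_poly /= ltnNge; apply/negP => /leq_sizeP/(_ _ (leqnn _)).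
    by rewrite trlead => /eqP; rewrite oner_eq0.
  have mtr J : tr J \is monic by rewrite monicE lead_coefE str trlead.
  have trs J s : (size ((tr J)`_s)%R <= B.+1)%N.
    rewrite coef_poly; case: ifP => _; rewrite ?size_poly0 //; exact: size_take_poly.
  have ctr J : J = I \/ J = ~: I -> congX m (PhiI J) (tr J) by move=> hJ; apply: congX_truncate (hz J hJ).
  have e : tr I * tr (~: I) = chiL.
    apply: (@congX_eq _ m) => [j|j|].
    - rewrite coefM; apply: (leq_trans (size_sum _ _ _)); apply/bigmax_leqP => i _.
      rewrite (leq_trans (size_polyMleq _ _)) // (leq_trans (leq_pred _)) //.
      by rewrite /m (leq_trans _ (leq_addr _ _)) // leq_add.
    - by rewrite (leq_trans (sD j)) // /m leq_addl.
    apply: congX_sym; apply: congX_trans chiPhi _; rewrite -(PhiC I).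
    by apply: congXM; apply: ctr; [left|right].
  have eb : map_poly (back t) (tr I) * map_poly (back t) (tr (~: I)) = chi.
    by rewrite -rmorphM /= e /chiL -map_poly_comp map_poly_id // => p _; apply: generic_lineK.
  have sb J : size (map_poly (back t) (tr J)) = #|J|.+1.
    by rewrite size_map_poly_id0 ?str // (monicP (mtr J)) rmorph1 oner_eq0.
  have [] := irr (monic_map _ (mtr I)) (monic_map _ (mtr (~: I))) eb.
    by rewrite sb => -[/eqP]; rewrite cards_eq0 (negPf I0).
  rewrite sb => -[/eqP]; rewrite cards_eq0 => /eqP h; case/eqP: IT.
  by rewrite -[I]setCK h setC0.
have [c hc] := boolp.choice HI.
have [v hv] : exists v : 'I_d -> nat, (\prod_I c I).@[fun i => (v i)%:R] != 0.
  by apply: (mpoly_nat_nonzero char0); apply/prodf_neq0 => I _; have [] := hc I.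
exists v => p q mp mq epq.
pose f : {rmorphism R -> C} := meval (fun i => (v i)%:R).
have echi : map_poly (line_eval t (fun i => (v i)%:R)) chi = map_poly (map_poly f) chiL.
  rewrite /chiL -map_poly_comp; apply: eq_map_poly => h.
  by rewrite -line_eval_generic.
pose w i : {poly C} := map_poly f (Phi i).
have w0 i : (w i).[0] = y i.
  by rewrite /w -[0](rmorph0 f) horner_map Phi0 /= mevalC.
have injw : injective (fun i => (w i).[0]) by move=> i j; rewrite !w0 => /injy.
have chiw i : exists e, (p * q).[w i] = e * 'X ^+ m.
  have [e he] := hPhi i; exists (map_poly f e).
  by rewrite epq echi /w horner_map he rmorphM /= map_polyXn.
have sp0 : (0 < size p)%N by rewrite size_poly_gt0 monic_neq0.
have sq0 : (0 < size q)%N by rewrite size_poly_gt0 monic_neq0.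
have mchiv : map_poly (map_poly f) chiL \is monic by apply: monic_map.
have schiv : size (map_poly (map_poly f) chiL) = N.+1.
  by rewrite size_map_poly_id0 // (monicP mchiL) rmorph1 oner_eq0.
have spq : ((size p).-1 + (size q).-1)%N = N.
  have := size_Mmonic (monic_neq0 mp) mq; rewrite epq echi schiv.
  by move: sp0 sq0; case: (size p) => // a _; case: (size q) => // b _; rewrite addSn addnS /= => -[].
have e0 : evp 0 p * evp 0 q = \prod_i ('X - (y i)%:P).
  rewrite -evpM epq echi -ey -(rmorph0 f) -evp_map evp0 -map_poly_comp.
  by rewrite map_poly_id // => h _ /=; rewrite mevalC.
have rpq i : root (evp 0 p) (y i) || root (evp 0 q) (y i).
  by rewrite -rootM e0 /root horner_prod (bigD1 i) //= hornerXsubC subrr mul0r.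
have npq i : root (evp 0 p) (y i) -> ~~ root (evp 0 q) (y i).
  move=> rp; apply/negP => rq; have := sep; rewrite ey -e0.
  have /factor_theorem[r er] := rp; rewrite er mulrAC separable_root => /andP[_].
  by rewrite rootM rq orbT.
(* Separability at the centre assigns each branch to exactly one of [p] and [q]; comparing degrees,
   [p] is congruent to the product over I and [q] to the product over its complement. *)
pose I := [set i | root (evp 0 p) (y i)].
have cardI (J : {set 'I_N}) (r : {poly {poly C}}) : r \is monic -> (forall i, i \in J -> root (evp 0 r) (y i)) ->
    (#|J| <= (size r).-1)%N.
  move=> mr hr; rewrite -ltnS prednK ?size_poly_gt0 ?monic_neq0 // -(size_evp 0 mr) cardE -(size_map y).
  apply: max_poly_roots; first by rewrite monic_neq0 // evp_monic.
    by apply/allP => a /mapP[i]; rewrite mem_enum => iJ ->; apply: hr.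
  by rewrite map_inj_uniq ?enum_uniq.
have cI : (#|I| <= (size p).-1)%N by apply: cardI => // i; rewrite inE.
have cI' : (#|~: I| <= (size q).-1)%N.
  by apply: cardI => // i; rewrite !inE => np; have := rpq i; rewrite (negPf np).
have cardN := cardsC I; rewrite card_ord in cardN.
apply: boolp.contrapT => /boolp.not_orP[p1 q1].
have cp : (size p = #|I|.+1)%N by move: p1 q1 cI cI' cardN spq sp0 sq0; lia.
have cq : (size q = #|~: I|.+1)%N by move: p1 q1 cI cI' cardN spq sp0 sq0; lia.
have I0 : I != set0 by apply/eqP => I0; apply: p1; rewrite cp I0 cards0.
have IT : I != [set: 'I_N] by apply/eqP => IT; apply: q1; rewrite cq IT setCT cards0.
have vI : f (c I) != 0.
  by move: hv; rewrite rmorph_prod /= (bigD1 I) //= mulf_eq0 negb_or => /andP[].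
have [s [j [jB hj]]] := (hc I).2 I0 IT _ vI.
have ew i (r : {poly {poly C}}) : (r.[w i]).[0] = (evp 0 r).[y i].
  by rewrite -[LHS]/(horner_eval 0 _) -horner_map /= /horner_eval w0.
have cgp : congX m p (\prod_(i in I) ('X - (w i)%:P)).
  apply: congX_prod => // i; rewrite inE => ri; have := chiw i; rewrite hornerM.
  by apply: regular_mod_Xn; rewrite ew; apply: npq.
have cgq : congX m q (\prod_(i in ~: I) ('X - (w i)%:P)).
  apply: congX_prod => // i; rewrite !inE => ri; have := chiw i; rewrite hornerM mulrC.
  by apply: regular_mod_Xn; rewrite ew.
have small (J : {set 'I_N}) (r r' : {poly {poly C}}) : congX m r (\prod_(i in J) ('X - (w i)%:P)) ->
    r \is monic -> r' \is monic -> r * r' = map_poly (map_poly f) chiL -> (map_poly f (PhiI J)`_s)`_j = 0.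
  move=> [E eE] mr mr' err.
  have -> : map_poly f (PhiI J)`_s = (\prod_(i in J) ('X - (w i)%:P))`_s.
    rewrite -coef_map; congr ((polyseq _)`_s); rewrite rmorph_prod; apply: eq_bigr => i _.
    by rewrite rmorphB /= map_polyX map_polyC.
  have sDv k : (size ((map_poly (map_poly f) chiL)`_k)%R <= D.+1)%N.
    rewrite coef_map (leq_trans (size_poly _ _)) // (leq_trans (sD k)) //.
  have := size_factor_coef mchiv sDv s mr mr' err; rewrite schiv /= -/B => sz.
  have /andP[Bj jm] := jB.
  have : (r`_s)`_j = 0 by rewrite nth_default // (leq_trans sz).
  rewrite eE coefD coefCM coefD coefXnM jm addr0 //.
case: hj => /eqP; apply.
  by apply: (small I p q cgp mp mq); rewrite epq echi.
by apply: (small (~: I) q p cgq mq mp); rewrite mulrC epq echi.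
Qed.

End IrreducibleLine.

(** * Continuity and torsion in the valuation topology *)

Section Continuity.
Variables (C : fieldType) (l : nat) (O : C -> Prop).
Hypothesis vO : valuation_ring l O.
Let sO := subring_vr vO.

(** If [l ^ k / c] is in [O], then [c] is not in [l ^ (k + 1) O]. *)
Lemma vdiv_nonzero c : c != 0 -> exists k, ~ vdiv l O k c.
Proof.
move=> c0; have [k Ok] := vr_arch vO c^-1; exists k.+1 => -[b Ob e].
apply: (vr_Nl vO); have l0 := vr_neq0 vO.
have b0 : b != 0 by apply: contraNneq c0 => b0; rewrite e b0 mulr0.
have -> : l%:R^-1 = b * (l%:R ^+ k * c^-1).
  by rewrite e exprS; field; rewrite l0 b0 expf_neq0.
exact: srM.
Qed.

Lemma vdiv_archM k c : exists k', forall x, vdiv l O k' x -> vdiv l O k (c * x).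
Proof.
have [a Oa] := vr_arch vO c; exists (k + a)%N => x [b Ob ->].
exists (l%:R ^+ a * c * b); first exact: srM.
by rewrite exprD; ring.
Qed.

Section Filter.
Variables (Om : Type) (N : nat -> Om -> Prop).
Hypothesis Nle : forall k k' w, (k <= k')%N -> N k' w -> N k w.

(** The neighbourhoods form an arbitrary decreasing family, so as to cover vectors, pairs of
    vectors, and vectors paired with a root. *)
Definition cont (phi : Om -> C) (c : C) := forall m, exists k, forall w, N k w -> vdiv l O m (phi w - c).

Lemma cont_const c : cont (fun=> c) c.
Proof. by move=> m; exists 0%N => w _; rewrite subrr; apply: vdiv0. Qed.

Lemma contD phi psi c d : cont phi c -> cont psi d -> cont (fun w => phi w + psi w) (c + d).
Proof.
move=> h1 h2 m; have [k1 {}h1] := h1 m; have [k2 {}h2] := h2 m; exists (maxn k1 k2) => w Nw.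
rewrite opprD addrACA; apply: (vdivD vO).
  by apply: h1; apply: Nle Nw; rewrite leq_maxl.
by apply: h2; apply: Nle Nw; rewrite leq_maxr.
Qed.

Lemma contM phi psi c d : cont phi c -> cont psi d -> cont (fun w => phi w * psi w) (c * d).
Proof.
move=> h1 h2 m; have [a ha] := vdiv_archM m d; have [b hb] := vdiv_archM m c.
have [k1 {}h1] := h1 (maxn m a); have [k2 {}h2] := h2 (maxn m b); exists (maxn k1 k2) => w Nw.
have v1 : vdiv l O (maxn m a) (phi w - c) by apply: h1; apply: Nle Nw; rewrite leq_maxl.
have v2 : vdiv l O (maxn m b) (psi w - d) by apply: h2; apply: Nle Nw; rewrite leq_maxr.
have -> : phi w * psi w - c * d = (phi w - c) * (psi w - d) + (d * (phi w - c) + c * (psi w - d)) by ring.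
apply: (vdivD vO).
  apply: (vdivMr vO); first by apply: vdiv_le v1 => //; rewrite leq_maxl.
  exact: vdivO v2.
apply: (vdivD vO); [apply: ha|apply: hb].
  by apply: vdiv_le v1 => //; rewrite leq_maxr.
by apply: vdiv_le v2 => //; rewrite leq_maxr.
Qed.

Lemma cont_sum I (r : seq I) (phi : I -> Om -> C) c : (forall i, cont (phi i) (c i)) ->
  cont (fun w => \sum_(i <- r) phi i w) (\sum_(i <- r) c i).
Proof.
move=> h; elim: r => [|i r IH] m.
  by exists 0%N => w _; rewrite !big_nil subrr; apply: vdiv0.
by have [k hk] := contD (h i) IH m; exists k => w /hk; rewrite !big_cons.
Qed.

Lemma cont_prod I (r : seq I) (phi : I -> Om -> C) c : (forall i, cont (phi i) (c i)) ->
  cont (fun w => \prod_(i <- r) phi i w) (\prod_(i <- r) c i).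
Proof.
move=> h; elim: r => [|i r IH] m.
  by exists 0%N => w _; rewrite !big_nil subrr; apply: vdiv0.
by have [k hk] := contM (h i) IH m; exists k => w /hk; rewrite !big_cons.
Qed.

Lemma contX phi c e : cont phi c -> cont (fun w => phi w ^+ e) (c ^+ e).
Proof.
move=> h; elim: e => [|e IH] m.
  by exists 0%N => w _; rewrite !expr0 subrr; apply: vdiv0.
by have [k hk] := contM h IH m; exists k => w /hk; rewrite !exprS.
Qed.

Lemma cont_meval n (p : {mpoly C[n]}) (x : Om -> 'rV[C]_n) (x0 : 'rV[C]_n) :
  (forall i, cont (fun w => x w 0 i) (x0 0 i)) ->
  cont (fun w => meval_row p (x w)) (meval_row p x0).
Proof.
move=> h m; have [|k hk] := @cont_sum _ (msupp p) (fun k w => p@_k * \prod_(i <- enum 'I_n) x w 0 i ^+ k i)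
    (fun k => p@_k * \prod_(i <- enum 'I_n) x0 0 i ^+ k i) _ m.
  move=> k; apply: contM; first exact: cont_const.
  by apply: cont_prod => i; apply: contX.
exists k => w /hk; rewrite /meval_row !mevalE.
have e (y : 'rV[C]_n) : \sum_(k <- msupp p) p@_k * \prod_(i <- enum 'I_n) y 0 i ^+ k i =
    \sum_(m <- msupp p) p@_m * \prod_(i < n) y 0 i ^+ m i.
  by apply: eq_bigr => j _; rewrite big_enum.
by rewrite !e.
Qed.

Lemma cont_nonzero phi c : cont phi c -> c != 0 -> exists k, forall w, N k w -> phi w != 0.
Proof.
move=> h c0; have [m hm] := vdiv_nonzero c0; have [k hk] := h m; exists k => w /hk v.
by apply/eqP => e; apply: hm; rewrite -[c]opprK; apply: (vdivN vO); rewrite e sub0r in v.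
Qed.

End Filter.

Definition nearv n (x0 : 'rV[C]_n) k (x : 'rV[C]_n) := forall i, vdiv l O k (x 0 i - x0 0 i).

Lemma nearv_le n (x0 : 'rV[C]_n) k k' x : (k <= k')%N -> nearv x0 k' x -> nearv x0 k x.
Proof. by move=> le h i; apply: vdiv_le (h i). Qed.

Lemma cont_coord n (x0 : 'rV[C]_n) i : cont (nearv x0) (fun x => x 0 i) (x0 0 i).
Proof. by move=> m; exists m => x; apply. Qed.

Definition nb T n (e : T -> pspace C n) x0 k P := exists2 x, coords (e P) x & nearv x0 k x.

Lemma cmorphism_cont T n (e : T -> pspace C n) T' n' (e' : T' -> pspace C n') f P0 x0 y0 :
  cmorphism e e' f -> coords (e P0) x0 -> coords (e' (f P0)) y0 ->
  forall m, exists k, forall P, nb e x0 k P -> nb e' y0 m (f P).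
Proof.
move=> mf Px Py m; have [d [F [hF F0 hf]]] := mf P0.
have [a a0 ea] := coords_prop (hf P0 x0 Px (F0 x0 Px)) Py.
have hc i : cont (nearv x0) (fun x => a * meval_row (F i) x) (y0 0 i).
  rewrite ea !mxE; apply: contM; [exact: nearv_le|exact: cont_const|].
  by apply: cont_meval; [exact: nearv_le|exact: cont_coord].
have [i0 yi0] := rV0Pn _ (coords_neq0 Py).
have [k0 hk0] := cont_nonzero (hc i0) yi0.
have H i := hc i m; have [K hK] := boolp.choice H.
exists (maxn k0 (\max_i K i)) => P [x Pxx nx].
have Fx : evrow F x != 0.
  apply/rV0Pn; exists i0; rewrite mxE.
  have := hk0 x (nearv_le (leq_maxl _ _) nx); by rewrite mulf_eq0 negb_or => /andP[].
exists (a *: evrow F x); first by apply: coords_scale => //; apply: hf.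
move=> i; rewrite !mxE; apply: hK; apply: nearv_le nx.
by rewrite (leq_trans (leq_bigmax i)) // leq_maxr.
Qed.

Lemma nb_segre T n (e : T -> pspace C n) T' n' (e' : T' -> pspace C n') x0 y0 m :
  exists k, forall P Q, nb e x0 k P -> nb e' y0 k Q -> nb (pair_emb e e') (segre_coords x0 y0) m (P, Q).
Proof.
pose N k (w : 'rV[C]_n * 'rV[C]_n') := nearv x0 k w.1 /\ nearv y0 k w.2.
have Nle k k' w : (k <= k')%N -> N k' w -> N k w.
  by move=> le [h1 h2]; split; apply: nearv_le le _.
have hc i j : cont N (fun w => w.1 0 i * w.2 0 j) (x0 0 i * y0 0 j).
  by apply: contM => //= m'; exists m' => w [h1 h2].
have H ij := hc ij.1 ij.2 m; have [K hK] := boolp.choice H.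
exists (\max_ij K ij) => P Q [x Px nx] [y Qy ny].
exists (segre_coords x y); first exact: segreE.
move=> k; case/mxvec_indexP: k => i j; rewrite !mxvecE !mxE !big_ord1 !mxE.
apply: (hK (i, j) (x, y)); split; apply: nearv_le (leq_bigmax (i, j)) _ => //.
Qed.

End Continuity.

(** * The group law near the origin *)

Section Torsion.
Variables (C : fieldType) (l : nat) (O : C -> Prop).
Hypothesis vO : valuation_ring l O.
Let sO := subring_vr vO.

(** The modulus is arbitrary because the size of a point need not be that of a power of [l]; in
    [prime_torsion] it is the largest coordinate itself. *)
Definition cdiv (c x : C) := exists2 b, O b & x = c * b.

Lemma cdiv0 c : cdiv c 0.
Proof. by exists 0; [apply: (sr0 sO)|rewrite mulr0]. Qed.

Lemma cdivD c x y : cdiv c x -> cdiv c y -> cdiv c (x + y).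
Proof. by move=> [a Oa ->] [b Ob ->]; exists (a + b); [apply: (srD sO)|rewrite mulrDr]. Qed.

Lemma cdivM c c' x y : cdiv c x -> cdiv c' y -> cdiv (c * c') (x * y).
Proof. by move=> [a Oa ->] [b Ob ->]; exists (a * b); [apply: (srM sO)|rewrite mulrACA]. Qed.

Lemma cdivMr c x y : cdiv c x -> O y -> cdiv c (x * y).
Proof. by move=> [a Oa ->] Oy; exists (a * y); [apply: (srM sO)|rewrite mulrA]. Qed.

Lemma cdiv_trans c c' x : cdiv c c' -> cdiv c' x -> cdiv c x.
Proof. by move=> [a Oa ->] [b Ob ->]; exists (a * b); [apply: (srM sO)|rewrite mulrA]. Qed.

Lemma cdivO c x : O c -> cdiv c x -> O x.
Proof. by move=> Oc [a Oa ->]; apply: (srM sO). Qed.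

Lemma O_pow k : O (l%:R ^+ k). Proof. by apply: (srX sO); apply: (sr_nat sO). Qed.

Lemma max_coord n (x : 'rV[C]_n) : x != 0 ->
  exists2 i, x 0 i != 0 & forall j, cdiv (x 0 i) (x 0 j).
Proof.
move=> /rV0Pn[i0 xi0].
suff [i xi h] : exists2 i, x 0 i != 0 & forall j, j \in enum 'I_n -> cdiv (x 0 i) (x 0 j).
  by exists i => // j; apply: h; rewrite mem_enum.
elim: (enum _) => [|j s [i xi h]]; first by exists i0.
have [e|n0] := eqVneq (x 0 j) 0.
  by exists i => // k; rewrite inE => /predU1P[->|/h //]; rewrite e; apply: cdiv0.
have [Oji|Oij] := vrV vO (x 0 j / x 0 i).
  by exists i => // k; rewrite inE => /predU1P[->|/h //]; exists (x 0 j / x 0 i) => //; field.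
exists j => // k; rewrite inE => /predU1P[->|/h].
  by exists 1; [apply: (sr1 sO)|rewrite mulr1].
by apply: cdiv_trans; exists (x 0 j / x 0 i)^-1 => //; field; rewrite xi n0.
Qed.

(* The mixed difference of E is divisible by the product c * c' of the sizes of
   x - o and x' - o, up to a fixed power of l. *)
Definition bilip_at n (E : 'rV[C]_n -> 'rV[C]_n -> C) (o : 'rV[C]_n) K c c' (x x' : 'rV[C]_n) :=
  [/\ O (l%:R ^+ K * E o o), cdiv c (l%:R ^+ K * (E x o - E o o)),
      cdiv c' (l%:R ^+ K * (E o x' - E o o)) &
      cdiv (c * c') (l%:R ^+ K * (E x x' - E x o - E o x' + E o o))].

Definition bilip n (o : 'rV[C]_n) E := exists K, forall c c' (x x' : 'rV[C]_n), O c -> O c' ->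
  (forall i, cdiv c (x 0 i - o 0 i)) -> (forall i, cdiv c' (x' 0 i - o 0 i)) ->
  bilip_at E o K c c' x x'.

Section Bilip.
Variables (n : nat) (o : 'rV[C]_n).

Lemma bilip_const a : bilip o (fun _ _ => a).
Proof.
have [K OK] := vr_arch vO a; exists K => c c' x x' Oc Oc' _ _.
by split=> //; rewrite ?addrK ?subrr ?subr0 ?sub0r ?addNr mulr0; apply: cdiv0.
Qed.

Lemma bilip_fst i : bilip o (fun x _ => x 0 i).
Proof.
have [K OK] := vr_arch vO (o 0 i); exists K => c c' x x' Oc Oc' h h'.
split=> //; rewrite ?subrr ?sub0r ?addNr ?mulr0; try exact: cdiv0.
by rewrite mulrC; apply: cdivMr => //; apply: O_pow.
Qed.

Lemma bilip_snd i : bilip o (fun _ x => x 0 i).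
Proof.
have [K OK] := vr_arch vO (o 0 i); exists K => c c' x x' Oc Oc' h h'.
split=> //; rewrite ?subrr ?mulr0; try exact: cdiv0.
  by rewrite mulrC; apply: cdivMr => //; apply: O_pow.
have -> : x' 0 i - o 0 i - x' 0 i + o 0 i = 0 by ring.
by rewrite mulr0; apply: cdiv0.
Qed.

Lemma bilip_atS E K K' c c' x x' : (K <= K')%N ->
  bilip_at E o K c c' x x' -> bilip_at E o K' c c' x x'.
Proof.
move=> le [h1 h2 h3 h4]; have e (y : C) : l%:R ^+ K' * y = l%:R ^+ K * y * l%:R ^+ (K' - K).
  by rewrite [RHS]mulrAC -exprD subnKC.
by split; rewrite e; [apply: (srM sO)|apply: cdivMr..] => //; apply: O_pow.
Qed.

Lemma bilipD E E' : bilip o E -> bilip o E' -> bilip o (fun x y => E x y + E' x y).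
Proof.
move=> [K hK] [K' hK']; exists (maxn K K') => c c' x x' Oc Oc' h h'.
have [h1 h2 h3 h4] := bilip_atS (leq_maxl K K') (hK _ _ _ _ Oc Oc' h h').
have [h1' h2' h3' h4'] := bilip_atS (leq_maxr K K') (hK' _ _ _ _ Oc Oc' h h').
move: {hK hK' h h'} (maxn K K') h1 h2 h3 h4 h1' h2' h3' h4' => M h1 h2 h3 h4 h1' h2' h3' h4'.
split; first by rewrite mulrDr; apply: (srD sO).
- by rewrite opprD addrACA mulrDr; apply: cdivD.
- by rewrite opprD addrACA mulrDr; apply: cdivD.
have -> : l%:R ^+ M * (E x x' + E' x x' - (E x o + E' x o) - (E o x' + E' o x') + (E o o + E' o o)) =
  l%:R ^+ M * (E x x' - E x o - E o x' + E o o) + l%:R ^+ M * (E' x x' - E' x o - E' o x' + E' o o) by ring.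
exact: cdivD.
Qed.

Lemma bilipM E E' : bilip o E -> bilip o E' -> bilip o (fun x y => E x y * E' x y).
Proof.
move=> [K hK] [K' hK']; exists (K + K')%N => c c' x x' Oc Oc' h h'.
have [h1 h2 h3 h4] := hK _ _ _ _ Oc Oc' h h'.
have [h1' h2' h3' h4'] := hK' _ _ _ _ Oc Oc' h h'.
rewrite /bilip_at !exprD; move: (l%:R ^+ K) (l%:R ^+ K') h1 h2 h3 h4 h1' h2' h3' h4' => M M'.
move: (E x x') (E x o) (E o x') (E o o) (E' x x') (E' x o) (E' o x') (E' o o).
move=> f11 f10 f01 f00 g11 g10 g01 g00 h1 h2 h3 h4 h1' h2' h3' h4'.
have Occ := srM sO Oc Oc'.
have Og10 : O (M' * g10).
  by rewrite -[g10](subrK g00) mulrDr; apply: (srD sO) => //; apply: (cdivO Oc h2').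
have Og01 : O (M' * g01).
  by rewrite -[g01](subrK g00) mulrDr; apply: (srD sO) => //; apply: (cdivO Oc' h3').
have Og11 : O (M' * g11).
  have -> : M' * g11 = M' * (g11 - g10 - g01 + g00) + M' * g10 + M' * g01 - M' * g00 by ring.
  apply: (srB sO) => //; do 2?[apply: (srD sO) => //].
  exact: (cdivO Occ h4').
split.
- by rewrite mulrACA; apply: (srM sO).
- have -> : M * M' * (f10 * g10 - f00 * g00) = M * (f10 - f00) * (M' * g10) + M' * (g10 - g00) * (M * f00) by ring.
  by apply: cdivD; apply: cdivMr.
- have -> : M * M' * (f01 * g01 - f00 * g00) = M * (f01 - f00) * (M' * g01) + M' * (g01 - g00) * (M * f00) by ring.
  by apply: cdivD; apply: cdivMr.
(* Leibniz rule for mixed differences: each term contains a mixed difference, or one difference in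
   each variable. *)
have -> : M * M' * (f11 * g11 - f10 * g10 - f01 * g01 + f00 * g00) =
   M * (f11 - f10 - f01 + f00) * (M' * g11)
   + M' * (g11 - g10 - g01 + g00) * (M * f00)
   + M' * (g11 - g10 - g01 + g00) * (M * (f10 - f00))
   + M' * (g11 - g10 - g01 + g00) * (M * (f01 - f00))
   + M * (f10 - f00) * (M' * (g01 - g00))
   + M' * (g10 - g00) * (M * (f01 - f00)) by ring.
do 5?[apply: cdivD]; try (by apply: cdivM); apply: cdivMr => //; by [apply: (cdivO Oc)|apply: (cdivO Oc')].
Qed.

Lemma bilip_sum I (r : seq I) (E : I -> 'rV[C]_n -> 'rV[C]_n -> C) :
  (forall i, bilip o (E i)) -> bilip o (fun x y => \sum_(i <- r) E i x y).
Proof.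
move=> h; elim: r => [|i r IH].
  have -> : (fun x y => \sum_(i <- [::]) E i x y) = (fun _ _ => 0).
    by apply: boolp.funext => x; apply: boolp.funext => y; rewrite big_nil.
  exact: bilip_const.
have -> : (fun x y => \sum_(j <- i :: r) E j x y) = (fun x y => E i x y + \sum_(j <- r) E j x y).
  by apply: boolp.funext => x; apply: boolp.funext => y; rewrite big_cons.
exact: bilipD.
Qed.

Lemma bilip_prod I (r : seq I) (E : I -> 'rV[C]_n -> 'rV[C]_n -> C) :
  (forall i, bilip o (E i)) -> bilip o (fun x y => \prod_(i <- r) E i x y).
Proof.
move=> h; elim: r => [|i r IH].
  have -> : (fun x y => \prod_(i <- [::]) E i x y) = (fun _ _ => 1).
    by apply: boolp.funext => x; apply: boolp.funext => y; rewrite big_nil.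
  exact: bilip_const.
have -> : (fun x y => \prod_(j <- i :: r) E j x y) = (fun x y => E i x y * \prod_(j <- r) E j x y).
  by apply: boolp.funext => x; apply: boolp.funext => y; rewrite big_cons.
exact: bilipM.
Qed.

Lemma bilipX E e : bilip o E -> bilip o (fun x y => E x y ^+ e).
Proof.
move=> h; have -> : (fun x y => E x y ^+ e) = (fun x y => \prod_(i <- nseq e tt) E x y).
  by apply: boolp.funext => x; apply: boolp.funext => y; rewrite big_nseq iter_mulr_1.
exact: bilip_prod.
Qed.

Lemma bilip_meval (p : {mpoly C[n * n]}) :
  bilip o (fun x y => meval_row p (segre_coords x y)).
Proof.
have -> : (fun x y => meval_row p (segre_coords x y)) =
    (fun x y : 'rV[C]_n => \sum_(m <- msupp p) p@_m * \prod_(k <- enum 'I_(n * n)) segre_coords x y 0 k ^+ m k).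
  apply: boolp.funext => x; apply: boolp.funext => y; rewrite /meval_row mevalE.
  by apply: eq_bigr => m _; rewrite big_enum.
apply: bilip_sum => m; apply: bilipM; first exact: bilip_const.
apply: bilip_prod => k; apply: bilipX; case/mxvec_indexP: k => i j.
have -> : (fun x y : 'rV[C]_n => segre_coords x y 0 (mxvec_index i j)) = (fun x y => x 0 i * y 0 j).
  by apply: boolp.funext => x; apply: boolp.funext => y; rewrite mxvecE !mxE big_ord1 !mxE.
apply: bilipM; [exact: bilip_fst|exact: bilip_snd].
Qed.

End Bilip.
End Torsion.

Section SmallTorsion.
Variables (C : closedFieldType) (l : nat) (O : C -> Prop).
Hypothesis vO : valuation_ring l O.
Let sO := subring_vr vO.
Variables (A : zmodType) (n : nat) (e : A -> pspace C n).
Hypothesis e_inj : injective e.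
Hypothesis addA : cmorphism (pair_emb e e) e (fun PQ : A * A => PQ.1 + PQ.2).
Variables (o : 'rV[C]_n) (i0 : 'I_n).
Hypotheses (o_coords : coords (e 0) o) (oi0 : o 0 i0 = 1).

(* E_i = S_i - S_i0 (x_i + x'_i - o_i) vanishes when x = o or x' = o, so that it
   is equal to its mixed difference. *)
Lemma add_near : exists K, forall c c' P P' x x',
  vdiv l O K c -> vdiv l O K c' ->
  coords (e P) x -> x 0 i0 = 1 -> coords (e P') x' -> x' 0 i0 = 1 ->
  (forall i, cdiv O c (x 0 i - o 0 i)) -> (forall i, cdiv O c' (x' 0 i - o 0 i)) ->
  exists w, [/\ coords (e (P + P')) w, w 0 i0 = 1 &
    forall i, cdiv O (c * c') (l%:R ^+ K * (w 0 i - x 0 i - x' 0 i + o 0 i))].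
Proof.
have [d [F [hF F0 hf]]] := addA (0, 0).
pose S i (x x' : 'rV[C]_n) := meval_row (F i) (segre_coords x x').
have bS i : bilip l O o (S i) by apply: bilip_meval.
pose E i (x x' : 'rV[C]_n) := S i x x' + (- 1) * (S i0 x x' * (x 0 i + (x' 0 i + (- o 0 i)))).
have bE i : bilip l O o (E i).
  apply: bilipD => //; apply: bilipM => //; first exact: bilip_const.
  apply: bilipM => //; apply: bilipD => //; first exact: bilip_fst.
  apply: bilipD => //; first exact: bilip_snd; exact: bilip_const.
have [K2 hK2] := boolp.choice bE; have [K1 hK1] := bS i0.
have ho : evrow F (segre_coords o o) != 0 by apply: F0; apply: segreE.
have cS P P' x x' : coords (e P) x -> coords (e P') x' -> evrow F (segre_coords x x') != 0 ->
    coords (e (P + P')) (evrow F (segre_coords x x')).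
  by move=> Px Px'; apply: (hf (P, P')); apply: segreE.
have E0 x x' P P' : coords (e P) x -> x 0 i0 = 1 -> coords (e P') x' -> x' 0 i0 = 1 ->
    forall y, coords (e (P + P')) y -> y 0 i0 = 1 -> forall i, S i x x' = S i0 x x' * y 0 i.
  move=> Px x1 Px' x1' y Py y1 i.
  have [z|nz] := eqVneq (evrow F (segre_coords x x')) 0.
    have zi j : S j x x' = 0 by move/rowP/(_ j): z; rewrite !mxE.
    by rewrite !zi mul0r.
  have [a _ ea] := coords_prop Py (cS _ _ _ _ Px Px' nz).
  have ei j : S j x x' = a * y 0 j by move/rowP/(_ j): ea; rewrite !mxE.
  by rewrite !ei y1 mulr1.
pose kap := S i0 o o.
(* By [E0] the vector of all [S j o o] is [kap] times [o], and it is not zero. *)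
have kap0 : kap != 0.
  apply: contraNneq ho => k0; apply/eqP/rowP => j; rewrite !mxE.
  rewrite -/(S j o o) (E0 o o 0 0 o_coords oi0 o_coords oi0 o) ?addr0 //.
  by rewrite -/kap k0 mul0r.
have [k1 hk1] := vr_arch vO kap^-1.
(* Smallness of order [K1 + k1 + 1] makes [S i0 x x' / kap] equal to 1 modulo [l], hence a unit. [M]
   covers the denominators of all the [E i], and the last [k1] that of [1 / kap]. *)
pose M := \max_i K2 i; exists (K1 + k1 + 1 + M + k1)%N => c c' P P' x x' vc vc' Px x1 Px' x1' nx nx'.
have Oc := vdivO vO vc; have Oc' := vdivO vO vc'.
have [_ s1 s2 s3] := hK1 _ _ _ _ Oc Oc' nx nx'.
have vS : vdiv l O (K1 + k1 + 1) (l%:R ^+ K1 * (S i0 x x' - kap)).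
  have -> : l%:R ^+ K1 * (S i0 x x' - kap) = l%:R ^+ K1 * (S i0 x x' - S i0 x o - S i0 o x' + S i0 o o)
     + l%:R ^+ K1 * (S i0 x o - S i0 o o) + l%:R ^+ K1 * (S i0 o x' - S i0 o o) by rewrite /kap; ring.
  have vc1 : vdiv l O (K1 + k1 + 1) c by apply: vdiv_le vc => //; lia.
  have vc1' : vdiv l O (K1 + k1 + 1) c' by apply: vdiv_le vc' => //; lia.
  apply: (vdivD vO); first apply: (vdivD vO).
  - apply: (cdiv_trans vO _ s3); apply: (cdivMr vO) => //.
  - exact: (cdiv_trans vO vc1 s1).
  - exact: (cdiv_trans vO vc1' s2).
have l0 := vr_neq0 vO.
have u1 : vdiv l O 1 (kap^-1 * S i0 x x' - 1).
  have [b Ob eb] := vS; exists (l%:R ^+ k1 * kap^-1 * b); first exact: (srM sO).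
  apply: (mulfI (expf_neq0 K1 l0)).
  have -> : l%:R ^+ K1 * (kap^-1 * S i0 x x' - 1) = kap^-1 * (l%:R ^+ K1 * (S i0 x x' - kap)).
    by field.
  by rewrite eb !exprD expr1; ring.
have [] := vr_unit_congr vO (sr1 sO) (oner_neq0 _) _ u1; first by rewrite invr1; apply: (sr1 sO).
move=> u0 Ou.
have S0 : S i0 x x' != 0 by apply: contraNneq u0 => ->; rewrite mulr0.
have Fn : evrow F (segre_coords x x') != 0.
  by apply/rV0Pn; exists i0; rewrite mxE.
exists ((S i0 x x')^-1 *: evrow F (segre_coords x x')); split.
- by apply: coords_scale; [exact: cS|rewrite invr_neq0].
- by rewrite !mxE mulVf.
move=> i; rewrite !mxE -/(S i x x').
have [_ _ _] := hK2 i _ _ _ _ Oc Oc' nx nx'.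
have Ex0 : E i x o = 0.
  by rewrite /E (E0 x o P 0 Px x1 o_coords oi0 x) ?addr0 //; ring.
have E0x : E i o x' = 0.
  by rewrite /E (E0 o x' 0 P' o_coords oi0 Px' x1' x') ?add0r //; ring.
have E00 : E i o o = 0.
  by rewrite /E (E0 o o 0 0 o_coords oi0 o_coords oi0 o) ?add0r //; ring.
rewrite Ex0 E0x E00 !subr0 addr0 => hE.
have -> : l%:R ^+ (K1 + k1 + 1 + M + k1) * ((S i0 x x')^-1 * S i x x' - x 0 i - x' 0 i + o 0 i) =
  (l%:R ^+ K2 i * E i x x') * ((l%:R ^+ k1 * kap^-1) * (kap^-1 * S i0 x x')^-1 * (l%:R ^+ (K1 + k1 + 1) * l%:R ^+ (M - K2 i))).
  have eM : l%:R ^+ M = l%:R ^+ K2 i * l%:R ^+ (M - K2 i) :> C by rewrite -exprD subnKC // leq_bigmax.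
  rewrite exprD [l%:R ^+ (_ + M)]exprD eM /E.
  move: (l%:R ^+ (K1 + k1 + 1)) (l%:R ^+ k1) (l%:R ^+ K2 i) (l%:R ^+ (M - K2 i)) => L1 L2 L3 L4.
  by field; rewrite S0 kap0.
apply: (cdivMr vO) => //; apply: (srM sO); first exact: (srM sO).
by apply: (srM sO); apply: (O_pow vO).
Qed.

(** Multiplication by N+1 is z -> (N+1) z up to an error in [c^2 / l^K]. As [l^K] divides [c], this
    error lies in [c O], so that all multiples remain in the ball, uniformly in N. *)
Lemma small_multiples : exists K, forall c P x, vdiv l O K c ->
  coords (e P) x -> x 0 i0 = 1 -> (forall i, cdiv O c (x 0 i - o 0 i)) ->
  forall N, exists w, [/\ coords (e (P *+ N.+1)) w, w 0 i0 = 1,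
    forall i, cdiv O c (w 0 i - o 0 i) &
    forall i, cdiv O (c * c) (l%:R ^+ K * (w 0 i - o 0 i - (x 0 i - o 0 i) *+ N.+1))].
Proof.
have l0 := vr_neq0 vO.
have [K hK] := add_near; exists K => c P x vc Px x1 nx; elim=> [|N [w [Pw w1 nw nw2]]].
  by exists x; split=> // i; rewrite subrr mulr0; apply: (cdiv0 vO).
have [w' [Pw' w1' nw']] := hK c c _ _ w x vc vc Pw w1 Px x1 nw nx.
exists w'; rewrite [_ *+ N.+2]mulrSr; split=> // i.
  have [b Ob eb] := nw' i; have [b1 Ob1 eb1] := vc.
  have -> : w' 0 i - o 0 i = (w 0 i - o 0 i) + (x 0 i - o 0 i) + (w' 0 i - w 0 i - x 0 i + o 0 i) by ring.
  apply: (cdivD vO); first exact: (cdivD vO).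
  exists (b1 * b); first exact: (srM sO).
  by apply: (mulfI (expf_neq0 K l0)); rewrite eb {1}eb1; ring.
have -> : l%:R ^+ K * (w' 0 i - o 0 i - (x 0 i - o 0 i) *+ N.+2) =
   l%:R ^+ K * (w 0 i - o 0 i - (x 0 i - o 0 i) *+ N.+1) + l%:R ^+ K * (w' 0 i - w 0 i - x 0 i + o 0 i).
  by rewrite [_ *+ N.+2]mulrSr; ring.
exact: (cdivD vO).
Qed.

(** Apply [small_multiples] with [c] the largest coordinate z of x - o. The relation p P = 0 puts p
    z in [z^2 / l^K], so [l^K p] is divisible by z and hence by [l^(K + 2)]. But p is not divisible
    by [l^2], whether p is [l] or another prime. *)
Lemma prime_torsion : prime l -> exists K, forall c P x p, vdiv l O K c -> prime p ->
  coords (e P) x -> x 0 i0 = 1 -> (forall i, cdiv O c (x 0 i - o 0 i)) -> P *+ p = 0 -> P = 0.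
Proof.
move=> pl; have l0 := vr_neq0 vO.
have [K hK] := small_multiples; exists (K + 2)%N => c P x p vc pp Px x1 nx tP.
have [e0|n0] := eqVneq (x - o) 0.
  by apply: e_inj; apply: (coords_inj Px); move/eqP: e0; rewrite subr_eq0 => /eqP ->.
have [j zj hj] := max_coord vO n0; set z := (x - o) 0 j in zj hj.
have vz : vdiv l O (K + 2) z.
  by apply: (cdiv_trans vO vc); rewrite /z !mxE; apply: nx.
have [|w [Pw w1 _ nw]] := hK z P x (vdiv_le vO (leq_addr 2 K) vz) Px x1 _ p.-1.
  by move=> i; have := hj i; rewrite !mxE.
rewrite prednK ?prime_gt0 // in Pw nw.
rewrite tP in Pw; have [a a0 ea] := coords_prop o_coords Pw.
have a1 : a = 1 by move/rowP/(_ i0): ea; rewrite !mxE w1 oi0 mulr1.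
have ew : w = o by rewrite ea a1 scale1r.
have [b Ob eb] := nw j; rewrite ew subrr sub0r in eb.
have {}eb : l%:R ^+ K * p%:R = z * - b.
  apply: (mulfI zj); have -> : z * (l%:R ^+ K * p%:R) = - (l%:R ^+ K * - (z *+ p)) by rewrite -mulr_natr; ring.
  by rewrite /z !mxE eb /z !mxE; ring.
have [b' Ob' eb'] := vz.
have vp : vdiv l O 2 p%:R.
  exists (b' * - b); first by apply: (srM sO) => //; apply: (srN sO).
  apply: (mulfI (expf_neq0 K l0)); rewrite eb eb' exprD; ring.
have v1 : vdiv l O 1 p%:R by apply: vdiv_le vp.
exfalso.
have [epl|npl] := eqVneq p l.
  apply: (vdiv1 vO (ltn0Sn 0)); have [b2 Ob2 eb2] := vp; exists b2 => //.
  by apply: (mulfI l0); rewrite mulr1 expr1 -[in LHS]epl eb2 expr2; ring.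
have cop : coprime p l by rewrite prime_coprime // dvdn_prime2.
apply: (@vdiv1 _ _ _ vO 1) => //.
have := prime_gt0 pp; case: (egcdnP l (prime_gt0 pp)) => u v euv _ p0.
rewrite (eqP cop) in euv.
have -> : 1 = u%:R * p%:R - v%:R * l%:R :> C.
  by rewrite -!natrM euv natrD addrAC subrr add0r.
apply: (vdivB vO); first by apply: (vdivMl vO) => //; apply: (sr_nat sO).
by exists v%:R; [apply: (sr_nat sO)|rewrite expr1 mulrC].
Qed.

Lemma no_small_torsion : prime l -> exists k, forall P, nb l O e o k P ->
  forall N, (0 < N)%N -> P *+ N = 0 -> P = 0.
Proof.
move=> pl; have [K0 h0] := small_multiples; have [K hK] := prime_torsion pl.
have : exists k1, forall i, O (l%:R ^+ k1 * o 0 i).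
  have [k hk] := boolp.choice (fun i => vr_arch vO (o 0 i)); exists (\max_i k i) => i.
  rewrite -(subnKC (leq_bigmax i)) addnC exprD -mulrA.
  by apply: (srM sO) => //; apply: (O_pow vO).
(* The 1 makes [x 0 i0] a unit, [k1] clears the denominators of [o] when [x] is divided by it, and
   [K0 + K] gives a radius fit for both lemmas. *)
move=> [k1 hk1]; exists (k1 + K0 + K + 1)%N => P [x Px nx].
set c : C := l%:R ^+ (K0 + K).
have vc0 : vdiv l O K0 c by exists (l%:R ^+ K); [apply: (O_pow vO)|rewrite -exprD].
have vc : vdiv l O K c by exists (l%:R ^+ K0); [apply: (O_pow vO)|rewrite -exprD addnC].
have [] := vr_unit_congr vO (x := 1) (y := x 0 i0) (sr1 sO) (oner_neq0 _).
- by rewrite invr1; apply: (sr1 sO).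
- by rewrite -oi0; apply: vdiv_le (nx i0); rewrite // addn1.
move=> x0 Ox; pose y := (x 0 i0)^-1 *: x.
have Py : coords (e P) y by apply: coords_scale; rewrite ?invr_neq0.
have y1 : y 0 i0 = 1 by rewrite mxE mulVf.
have ny i : cdiv O c (y 0 i - o 0 i).
  have -> : y 0 i - o 0 i = ((x 0 i - o 0 i) - o 0 i * (x 0 i0 - o 0 i0)) * (x 0 i0)^-1.
    by rewrite mxE oi0; field.
  apply: (cdivMr vO) => //; apply: (vdivB vO); first by apply: vdiv_le (nx i) => //; lia.
  have [b Ob eb] := nx i0; exists (l%:R ^+ k1 * o 0 i * (l%:R * b)).
    by apply: (srM sO) => //; apply: (srM sO) => //; apply: (sr_nat sO).
  by rewrite eb !exprD expr1; ring.
move=> N N0 tN; apply/eqP; rewrite -[_ == _]negbK; apply/negP => nP.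
have : exists M, (0 < M)%N && (P *+ M == 0) by exists N; rewrite N0 tN eqxx.
move=> /ex_minnP[M /andP[M0 /eqP tM] minM].
have M1 : (1 < M)%N.
  by case: M M0 tM {minM} => [//|[|//]] _; rewrite mulr1n => tP; rewrite tP eqxx in nP.
have pp := pdiv_prime M1; have dM := pdiv_dvd M.
(* [P *+ M'] is killed by a prime and is still in the ball, hence is 0, against the minimality of
   [M]. *)
pose M' := (M %/ pdiv M)%N.
have eM : M = (M' * pdiv M)%N by rewrite divnK.
have M'0 : (0 < M')%N by move: M0; rewrite eM muln_gt0 => /andP[].
have M'lt : (M' < M)%N by rewrite ltn_Pdiv ?prime_gt1.
have [w [Pw w1 nw _]] := h0 c P y vc0 Py y1 ny M'.-1; rewrite prednK // in Pw.
have : P *+ M' = 0 by apply: (hK c _ w (pdiv M)) => //; rewrite -mulrnA -eM.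
by move=> t; have := minM M'; rewrite M'0 t eqxx => /(_ isT); rewrite leqNgt M'lt.
Qed.

End SmallTorsion.

Lemma torsion_free_nbhd (C : closedFieldType) l (O : C -> Prop) (A : zmodType) n (e : A -> pspace C n) :
  valuation_ring l O -> prime l -> injective e ->
  cmorphism (pair_emb e e) e (fun PQ : A * A => PQ.1 + PQ.2) ->
  exists k o, coords (e 0) o /\ forall P, nb l O e o k P ->
  forall N, (0 < N)%N -> P *+ N = 0 -> P = 0.
Proof.
move=> vO pl e_inj addA.
have P0 := coords_pick (e 0); have /rV0Pn[i0 xi0] := coords_neq0 P0.
set x := vpick _ in P0 xi0; pose o := (x 0 i0)^-1 *: x.
have Po : coords (e 0) o by apply: coords_scale; rewrite ?invr_neq0.
have oi0 : o 0 i0 = 1 by rewrite mxE mulVf.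
by have [k hk] := no_small_torsion vO e_inj addA Po oi0 pl; exists k, o.
Qed.

(** * Continuity of the fibres *)

Section Lift.
Variables (C : closedFieldType) (l : nat) (O : C -> Prop).
Hypothesis vO : valuation_ring l O.
Let sO := subring_vr vO.

Lemma cont_evc_horner d Om (N : nat -> Om -> Prop) (p : {poly {mpoly C[d]}}) (t : Om -> 'rV[C]_d) (t0 : 'rV[C]_d) y y0 :
  (forall k k' w, (k <= k')%N -> N k' w -> N k w) ->
  (forall i, cont l O N (fun w => t w 0 i) (t0 0 i)) -> cont l O N y y0 ->
  cont l O N (fun w => (evc (t w) p).[y w]) (evc t0 p).[y0].
Proof.
move=> Nle ct cy m.
have [|k hk] := @cont_sum _ _ _ vO _ _ Nle _ (index_enum 'I_(size p))
   (fun j w => meval_row p`_j (t w) * y w ^+ j) (fun j => meval_row p`_j t0 * y0 ^+ j) _ m.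
  by move=> j; apply: contM => //; [apply: cont_meval|apply: contX].
have e t' y' : (evc t' p).[y'] = \sum_(j < size p) meval_row p`_j t' * y' ^+ j.
  rewrite (horner_coef_wide _ (size_poly _ _)); apply: eq_bigr => j _.
  by rewrite evc_coef.
by exists k => w /hk; rewrite !e.
Qed.

(** Otherwise every [l ^ M / x_i] is in [O], and their product with [b] is [1 / l]. *)
Lemma vdiv_factor M (I : finType) (x : I -> C) : vdiv l O (#|I| * M).+1 (\prod_i x i) ->
  exists i, vdiv l O M (x i).
Proof.
move=> [b Ob eb]; apply: boolp.contrapT => nex; have l0 := vr_neq0 vO.
have x0 i : x i != 0.
  by apply/eqP => xi; apply: nex; exists i; rewrite xi; apply: vdiv0.
have h i : O (l%:R ^+ M / x i).
  have [|] := vrV vO (x i / l%:R ^+ M); last by rewrite invf_div.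
  move=> Oi; case: nex; exists i; exists (x i / l%:R ^+ M) => //.
  by field; rewrite expf_neq0.
apply: (vr_Nl vO); have b0 : b != 0.
  apply/eqP => b0; have : \prod_i x i != 0 by apply/prodf_neq0.
  by rewrite eb b0 mulr0 eqxx.
have -> : l%:R^-1 = b * \prod_i (l%:R ^+ M / x i).
  rewrite big_split /= prodr_const -exprM mulnC prodfV eb exprS.
  by field; rewrite l0 b0 expf_neq0.
by apply: (srM sO) => //; apply: (sr_prod sO).
Qed.

Variables (X : Type) (n : nat) (eX : X -> pspace C n) (gT : finGroupType) (act : gT -> X -> X).
Variables (d : nat) (rho : X -> pspace C d) (theta : X -> C).
Variables (D E : {mpoly C[d]}) (chi : {poly {mpoly C[d]}}) (b : 'I_n -> {poly {mpoly C[d]}}).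
Hypothesis act1 : forall P, act 1%g P = P.
Hypothesis hM : forall P x, coords (rho P) x -> meval_row E x != 0 ->
  evc x chi = \prod_g ('X - (meval_row D x * theta (act g P))%:P) /\
  forall g, coords (eX (act g P)) (\row_i (evc x (b i)).[meval_row D x * theta (act g P)]).

(** Continuity of roots: chi(t, y0) is small for t near t0, so some root over t is near y0 by
    [vdiv_factor], and the polynomials [b] carry this to coordinates. Only one point of the orbit is
    controlled, which explains the [g] in the conclusion. *)
Lemma lift_near P0 t0 : coords (rho P0) t0 -> meval_row E t0 != 0 ->
  exists2 x0, coords (eX P0) x0 & forall m, exists k, forall t P,
    nearv l O t0 k t -> coords (rho P) t ->
    meval_row E t != 0 /\ exists g, nb l O eX x0 m (act g P).
Proof.
move=> Pt0 E0; have [chi0 b0] := hM Pt0 E0.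
set y0 := meval_row D t0 * theta (act 1%g P0).
exists (\row_i (evc t0 (b i)).[y0]); first by rewrite -{1}(act1 P0); apply: b0.
move=> m; pose N k (w : 'rV[C]_d * C) := nearv l O t0 k w.1 /\ vdiv l O k (w.2 - y0).
have Nle k k' w : (k <= k')%N -> N k' w -> N k w.
  move=> le [h1 h2]; split; [exact: (nearv_le vO le h1)|exact: (vdiv_le vO le h2)].
have hb i : cont l O N (fun w => (evc w.1 (b i)).[w.2]) (evc t0 (b i)).[y0].
  by apply: cont_evc_horner => // [j|] m'; exists m' => w [h1 h2] //; apply: h1.
have [K hK] := boolp.choice (fun i => hb i m); pose M := \max_i K i.
have hchi : cont l O (nearv l O t0) (fun t => (evc t chi).[y0]) 0.
  have <- : (evc t0 chi).[y0] = 0.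
    by rewrite chi0 horner_prod (bigD1 1%g) //= hornerXsubC subrr mul0r.
  apply: cont_evc_horner; [exact: (nearv_le vO)| |exact: (cont_const vO)].
  by move=> i; apply: cont_coord.
have hE : cont l O (nearv l O t0) (meval_row E) (meval_row E t0).
  by apply: cont_meval => //; [exact: (nearv_le vO)|move=> i; apply: cont_coord].
have [k1 hk1] := cont_nonzero vO hE E0.
have [k2 hk2] := hchi (#|gT| * M).+1.
exists (maxn M (maxn k1 k2)) => t P nt Pt.
have nt' k : (k <= maxn M (maxn k1 k2))%N -> nearv l O t0 k t by move=> le; apply: nearv_le le nt.
have Et : meval_row E t != 0 by apply: hk1; apply: nt'; lia.
split=> //; have [chit bt] := hM Pt Et.
have := hk2 t (nt' k2 _); rewrite subr0 chit horner_prod => h2.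
have [|g hg] := @vdiv_factor M gT (fun g => y0 - meval_row D t * theta (act g P)).
  have := h2; rewrite (eq_bigr (fun g => y0 - meval_row D t * theta (act g P))).
    by apply; lia.
  by move=> g _; rewrite hornerXsubC.
exists g, (\row_i (evc t (b i)).[meval_row D t * theta (act g P)]); first exact: bt.
move=> i; rewrite !mxE; apply: (hK i (t, meval_row D t * theta (act g P))); split=> /=.
  by apply: nt'; rewrite leq_max leq_bigmax.
by rewrite -opprB; apply: (vdivN vO); apply: (vdiv_le vO (leq_bigmax i)).
Qed.
End Lift.

Definition torsion (A : zmodType) (a : A) := exists2 N, (0 < N)%N & a *+ N = 0.

Lemma torsionB (A : zmodType) (a b : A) : torsion a -> torsion b -> torsion (a - b).
Proof.
move=> [M M0 aM] [N N0 bN]; exists (M * N)%N; first by rewrite muln_gt0 M0.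
by rewrite mulrnBl mulrnA aM mul0rn mulnC mulrnA bN mul0rn subrr.
Qed.

Lemma meval_row_row (C : fieldType) n (p : {mpoly C[n]}) (f : 'I_n -> C) :
  meval_row p (\row_i f i) = p.@[f].
Proof. by rewrite /meval_row; congr (meval _ p); apply: boolp.funext => i; rewrite mxE. Qed.

Lemma nat_near_nonzero (C : fieldType) n (p : {mpoly C[n]}) (t0 : 'I_n -> nat) (a : nat) :
  [pchar C] =i pred0 -> (0 < a)%N -> p != 0 ->
  exists c : 'I_n -> nat, meval_row p (\row_i (t0 i + a * c i)%:R) != 0.
Proof.
move=> char0 a0 p0; have ac : a%:R != 0 :> C by rewrite ((pcharf0P C).1 char0) -lt0n.
pose q := p \mPo [tuple (t0 i)%:R%:MP + a%:R *: 'X_i | i < n].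
have eq (x : 'rV[C]_n) : meval_row q x = meval_row p (\row_i ((t0 i)%:R + a%:R * x 0 i)).
  rewrite meval_row_comp; congr meval_row; apply/rowP => i.
  by rewrite !mxE meval_rowD meval_rowZ meval_rowC meval_rowXU.
have q0 : q != 0.
  have [c hc] := mpoly_nat_nonzero char0 p0; apply: contraNneq hc => q0.
  have := eq (\row_i (((c i)%:R - (t0 i)%:R) / a%:R)); rewrite q0 [LHS]meval0 => /esym.
  rewrite meval_row_row => <-; apply/eqP; congr (meval _ p); apply: boolp.funext => i.
  by rewrite mxE; field.
have [c hc] := mpoly_nat_nonzero char0 q0; exists c.
rewrite -meval_row_row eq in hc.
have -> : \row_i (t0 i + a * c i)%:R = \row_i ((t0 i)%:R + a%:R * (\row_i (c i)%:R) 0 i) :> 'rV[C]_n.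
  by apply/rowP => i; rewrite !mxE natrD natrM.
exact: hc.
Qed.

(** * Balls without torsion values *)

Section Ball.
Variables (C : closedFieldType) (l : nat) (O : C -> Prop).
Hypotheses (vO : valuation_ring l O) (pl : prime l).
Let sO := subring_vr vO.
Variables (A : zmodType) (m : nat) (eA : A -> pspace C m).
Hypotheses (injA : injective eA)
  (addA : cmorphism (pair_emb eA eA) eA (fun PQ : A * A => PQ.1 + PQ.2))
  (oppA : cmorphism eA eA (fun P => - P)).
Variables (X : Type) (n : nat) (eX : X -> pspace C n).

Lemma torsion_unique g P0 x0 : cmorphism eX eA g -> coords (eX P0) x0 ->
  exists k, forall P P', nb l O eX x0 k P -> nb l O eX x0 k P' ->
    torsion (g P) -> torsion (g P') -> g P = g P'.
Proof.
move=> mg Px0; have [k [o [Po hk]]] := torsion_free_nbhd vO pl injA addA.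
have c1 := coords_pick (eA (g P0)); set y1 := vpick _ in c1.
have c2 := coords_pick (eA (- g P0)); set y2 := vpick _ in c2.
have c12 : coords (pair_emb eA eA (g P0, - g P0)) (segre_coords y1 y2) by apply: segreE.
have co : coords (eA ((g P0, - g P0).1 + (g P0, - g P0).2)) o by rewrite /= subrr.
have [k1 hk1] := cmorphism_cont vO addA c12 co k.
have [k2 hk2] := nb_segre vO eA eA y1 y2 k1.
have [k3 hk3] := cmorphism_cont vO mg Px0 c1 k2.
have [k4 hk4] := cmorphism_cont vO (cmorphism_comp mg oppA) Px0 c2 k2.
exists (maxn k3 k4) => P P' nP nP' tP tP'.
have nble k5 Q : (k5 <= maxn k3 k4)%N -> nb l O eX x0 (maxn k3 k4) Q -> nb l O eX x0 k5 Q.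
  by move=> le [x Qx nx]; exists x => //; apply: (nearv_le vO le nx).
have [N N0 tN] := torsionB tP tP'.
apply/eqP; rewrite -subr_eq0; apply/eqP; apply: (hk _ _ N N0 tN).
apply: (hk1 (g P, - g P')); apply: hk2.
  by apply: hk3; apply: nble nP; rewrite leq_maxl.
by apply: hk4; apply: nble nP'; rewrite leq_maxr.
Qed.

Lemma nb_zopen Z P1 x1 : zclosed eX Z -> ~ Z P1 -> coords (eX P1) x1 ->
  exists k, forall P, nb l O eX x1 k P -> ~ Z P.
Proof.
move=> /zclosedP cZ nZ Px; have [d [F [hF F0 FZ]]] := cZ _ nZ.
have cF : cont l O (nearv l O x1) (meval_row F) (meval_row F x1).
  by apply: cont_meval => //; [exact: (nearv_le vO)|move=> i; apply: cont_coord].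
have [k hk] := cont_nonzero vO cF (F0 _ Px); exists k => P [x Px1 nx] ZP.
by have := hk x nx; rewrite (FZ P x ZP Px1) eqxx.
Qed.

(** Any point of an ultrametric ball is a centre, after rescaling its coordinates. *)
Lemma nb_recenter P1 x0 x1 k : nb l O eX x0 k P1 -> coords (eX P1) x1 ->
  exists k', forall P, nb l O eX x1 k' P -> nb l O eX x0 k P.
Proof.
move=> [x Px nx] Px1; have [a a0 ex] := coords_prop Px1 Px.
have [k' hk'] := vdiv_archM vO k a; exists k' => P [x' Px' nx'].
exists (a *: x'); first exact: coords_scale.
move=> i; have -> : (a *: x') 0 i - x0 0 i = a * (x' 0 i - x1 0 i) + (x 0 i - x0 0 i).
  by rewrite ex !mxE; ring.
by apply: (vdivD vO) => //; apply: hk'.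
Qed.

Variables (gT : finGroupType) (act : gT -> X -> X) (d : nat) (rho : X -> pspace C d) (theta : X -> C).
Variables (D E : {mpoly C[d]}) (chi : {poly {mpoly C[d]}}) (b : 'I_n -> {poly {mpoly C[d]}}).
Hypothesis char0 : [pchar C] =i pred0.
Hypothesis act1 : forall P, act 1%g P = P.
Hypothesis actM : forall g h P, act (g * h)%g P = act g (act h P).
Hypothesis act_mor : forall g, cmorphism eX eX (act g).
Hypothesis hM : forall P x, coords (rho P) x -> meval_row E x != 0 ->
  evc x chi = \prod_g ('X - (meval_row D x * theta (act g P))%:P) /\
  forall g, coords (eX (act g P)) (\row_i (evc x (b i)).[meval_row D x * theta (act g P)]).
Hypothesis irrX : zirreducible eX (fun=> True).
Hypothesis rho_surj : forall Q, exists P, rho P = Q.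
Hypothesis rho_orbit : forall P P', rho P = rho P' -> exists g, P' = act g P.
Hypothesis rho_act : forall g P, rho (act g P) = rho P.
Hypothesis rho_closed : forall Z, zclosed eX Z -> (forall g P, Z P -> Z (act g P)) ->
  zclosed (@id (pspace C d)) (fun Q => exists2 P, Z P & rho P = Q).
Hypothesis E_neq0 : E != 0.

(** The points whose orbit meets the fibre of [a] form a G-stable closed set, proper because X is
    irreducible. Stability makes its image in projective space closed, and [H] is an equation of
    this image. The whole orbit has to be avoided since the lift to X is known only up to G. *)
Lemma orbit_avoid g a : cmorphism eX eA g -> ~ is_constant g ->
  exists2 H : {mpoly C[d]}, H != 0 & forall P x h, coords (rho P) x -> meval_row H x != 0 ->
    g (act h P) <> a.
Proof.
move=> mg ncg; pose Z P := exists2 h, h \in enum gT & g (act h P) = a.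
have cg h : cmorphism eX eA (fun P => g (act h P)) by apply: (cmorphism_comp (act_mor h) mg).
have cZh h : zclosed eX (fun P => g (act h P) = a) by apply: (fiber_closed a injA (cg h)).
have cZ : zclosed eX Z by apply: zclosed_bigU.
have [P nZP] : exists P, ~ Z P.
  have [h|P hP] := @generic_point _ _ _ _ irrX gT (enum gT) _ cZh.
    apply: boolp.contrapT => nex; apply: ncg; exists a => P; apply: boolp.contrapT => nP.
    by apply: nex; exists (act h^-1%g P); rewrite -actM mulgV act1.
  by exists P => -[h /hP].
have iZ h P' : Z P' -> Z (act h P').
  move=> [h' _ e]; exists (h' * h^-1)%g; first by rewrite mem_enum.
  by rewrite -actM -mulgA mulVg mulg1.
have /zclosedP cW := rho_closed cZ iZ.
have [|d' [H [hH H0 HW]]] := cW (rho P).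
  by move=> [P' ZP' /rho_orbit[h eP]]; apply: nZP; rewrite eP; apply: iZ.
exists H.
  have := H0 _ (coords_pick (rho P)); apply: contraNneq => ->.
  by rewrite /meval_row meval0.
move=> P' x h Px Hx e; move/eqP: Hx; apply; apply: (HW (rho P')) => //.
by exists P' => //; exists h; rewrite ?mem_enum.
Qed.

Lemma torsion_value g P0 x0 : cmorphism eX eA g -> coords (eX P0) x0 ->
  exists k a, forall P, nb l O eX x0 k P -> torsion (g P) -> g P = a.
Proof.
move=> mg Px0; have [k hk] := torsion_unique mg Px0; exists k.
have [[P' [nP' tP']]|nex] := boolp.EM (exists P', nb l O eX x0 k P' /\ torsion (g P')).
  by exists (g P') => P nP tP; apply: hk.
by exists 0 => P nP tP; case: nex; exists P.
Qed.

(** Two centres are used: near a lift of [t0] the only possible torsion values are [a1] and [a2];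
    [t1] is an integral point nearby whose fibre avoids both, and by continuity so does a smaller
    ball. *)
Lemma good_point (i0 : 'I_d) g1 g2 : cmorphism eX eA g1 -> cmorphism eX eA g2 ->
  ~ is_constant g1 -> ~ is_constant g2 ->
  exists (t1 : 'I_d -> nat) k, (exists P, coords (rho P) (\row_i (t1 i)%:R)) /\
    forall P t, nearv l O (\row_i (t1 i)%:R) k t -> coords (rho P) t ->
      meval_row E t != 0 /\ exists g, ~ torsion (g1 (act g P)) /\ ~ torsion (g2 (act g P)).
Proof.
move=> mg1 mg2 nc1 nc2; pose Xi0 : {mpoly C[d]} := 'X_i0.
have Xi00 : Xi0 != 0.
  apply/eqP => /(congr1 (meval (fun=> 1))); rewrite mevalXU meval0.
  by apply/eqP/oner_neq0.
(* The factor [Xi0] keeps [t] nonzero, so that it represents a point. *)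
have over t : meval_row (Xi0 * E) t != 0 -> meval_row E t != 0 /\ exists P, coords (rho P) t.
  rewrite meval_rowM mulf_eq0 negb_or meval_rowXU => /andP[ti Et]; split=> //.
  have [|Q Qt] := @coords_exists _ _ t; first by apply/rV0Pn; exists i0.
  by have [P eP] := rho_surj Q; exists P; rewrite eP.
have [t0] := mpoly_nat_nonzero char0 (mulf_neq0 Xi00 E_neq0); rewrite -meval_row_row => ht0.
have [E0 [P0 P0t]] := over _ ht0.
have [x0 P0x0 lift0] := lift_near vO act1 hM P0t E0.
have [k1 [a1 ha1]] := torsion_value mg1 P0x0; have [k2 [a2 ha2]] := torsion_value mg2 P0x0.
have [H1 H10 hH1] := orbit_avoid a1 mg1 nc1; have [H2 H20 hH2] := orbit_avoid a2 mg2 nc2.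
have [k3 hk3] := lift0 (maxn k1 k2).
have lk0 : (0 < l ^ k3)%N by rewrite expn_gt0 prime_gt0.
have [c hc] := nat_near_nonzero t0 char0 lk0 (mulf_neq0 (mulf_neq0 Xi00 E_neq0) (mulf_neq0 H10 H20)).
pose t1 i := (t0 i + l ^ k3 * c i)%N; exists t1.
move: hc; rewrite meval_rowM [meval_row (H1 * _) _]meval_rowM !mulf_eq0 !negb_or -/(t1 _).
move=> /and3P[ht1 h1 h2].
have [E1 [P1' P1t]] := over _ ht1.
have nt1 : nearv l O (\row_i (t0 i)%:R) k3 (\row_i (t1 i)%:R).
  move=> i; rewrite !mxE natrD addrAC subrr add0r natrM natrX.
  by exists (c i)%:R => //; apply: (sr_nat sO).
have [_ [g0 nP1]] := hk3 _ _ nt1 P1t.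
set P1 := act g0 P1' in nP1.
have P1t' : coords (rho P1) (\row_i (t1 i)%:R) by rewrite rho_act.
have [x1 P1x lift1] := lift_near vO act1 hM P1t' E1.
have [k4 hk4] := nb_recenter nP1 P1x.
have na1 : ~ g1 P1 = a1 by rewrite -[P1]act1; apply: hH1 P1t' h1.
have na2 : ~ g2 P1 = a2 by rewrite -[P1]act1; apply: hH2 P1t' h2.
have [k5 hk5] := nb_zopen (fiber_closed a1 injA mg1) na1 P1x.
have [k6 hk6] := nb_zopen (fiber_closed a2 injA mg2) na2 P1x.
have [k7 hk7] := lift1 (maxn k4 (maxn k5 k6)); exists k7; split; first by exists P1.
move=> P t nt Pt; have [Et [g nP]] := hk7 t P nt Pt; split=> //; exists g.
have nble T' (e' : T' -> pspace C n) x k k' Q : (k <= k')%N -> nb l O e' x k' Q -> nb l O e' x k Q.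
  by move=> le [y Qy ny]; exists y => //; apply: (nearv_le vO le ny).
have nP4 := hk4 _ (nble _ _ _ k4 _ _ (leq_maxl _ _) nP).
split=> tP.
  apply: (hk5 (act g P)); first by apply: nble nP; rewrite !leq_max leqnn ?orbT.
  by apply: ha1 tP; apply: nble nP4; rewrite leq_max leqnn ?orbT.
apply: (hk6 (act g P)); first by apply: nble nP; rewrite !leq_max leqnn ?orbT.
by apply: ha2 tP; apply: nble nP4; rewrite leq_max leqnn ?orbT.
Qed.
End Ball.

(** * Extensions of K and conjugate points *)

Section SplitExtension.
Variables (K : fieldType) (C : closedFieldType) (iota : {rmorphism K -> C}).
Hypotheses (char0 : [pchar K] =i pred0) (alg : integralRange iota).

Lemma primitive_generator (s : seq C) : exists z : C,
  (forall x, x \in s -> exists p : {poly K}, (map_poly iota p).[z] = x) /\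
  forall S : C -> Prop, S 0 -> (forall a b, S a -> S b -> S (a - b)) ->
    (forall x, x \in s -> S x) -> S z.
Proof.
elim: s => [|x s [z [hz Sz]]]; first by exists 0; split.
have [p mp px] := alg x; have [q mq qz] := alg z.
have [n [[r1 e1] [r2 e2]]] := pchar0_PET (monic_neq0 mp) px (monic_neq0 mq) qz char0.
set z' := z *+ n - x in e1 e2; exists z'; split.
  move=> w; rewrite inE => /predU1P[->|/hz[p1 <-]]; first by exists r1.
  by exists (p1 \Po r2); rewrite map_comp_poly horner_comp e2.
move=> S S0 SB hS; have SN a : S a -> S (- a) by rewrite -sub0r; apply: SB.
have SD a b : S a -> S b -> S (a + b) by move=> Sa Sb; rewrite -[b]opprK; apply: SB => //; apply: SN.
have Sx : S x by apply: hS; rewrite mem_head.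
have Szz : S z by apply: Sz => // w ws; apply: hS; rewrite inE ws orbT.
by rewrite /z'; apply: SB => //; elim: n {e1 e2 z'} => [|n IH] //; rewrite mulrSr; apply: SD.
Qed.

Lemma min_poly_exists (z : C) : exists r : {poly K},
  [/\ r \is monic, root (map_poly iota r) z & forall q, q != 0 -> root (map_poly iota q) z -> (size r <= size q)%N].
Proof.
have [p mp pz] := alg z.
pose P n := boolp.asbool (exists q : {poly K}, [/\ q != 0, root (map_poly iota q) z & size q = n]).
have : exists n, P n by exists (size p); apply/boolp.asboolP; exists p; rewrite monic_neq0.
move=> /ex_minnP[n /boolp.asboolP[q [q0 qz sq]] minn].
exists ((lead_coef q)^-1 *: q); split.
- by rewrite monicE lead_coefZ mulVf // lead_coef_eq0.
- by rewrite map_polyZ rootZ // fmorph_eq0 invr_eq0 lead_coef_eq0.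
move=> q' q'0 q'z; rewrite size_scale ?invr_eq0 ?lead_coef_eq0 // sq.
by apply: minn; apply/boolp.asboolP; exists q'.
Qed.

(** The field is built as K(z) inside [C], and so comes with the embedding whose images of the roots
    are prescribed. *)
Lemma split_ext (p : {poly K}) (s : seq C) : map_poly iota p = \prod_(x <- s) ('X - x%:P) ->
  exists (L : splittingFieldType K) (j : {rmorphism L -> C}) (ys : seq L),
  [/\ extends iota j, galois 1%AS {:L}, map j ys = s & <<1 & ys>>%VS = fullv].
Proof.
move=> ep; have [z [hz Sz]] := primitive_generator s.
have [r [mr rz minr]] := min_poly_exists z.
have r0 := monic_neq0 mr.
have irr : irreducible_poly r by apply/(subfx_irreducibleP rz r0) => q qz q0; apply: minr.
pose L0 := SubFieldExtType rz irr; pose j0 : {rmorphism L0 -> C} := @subfx_inj _ _ iota z r.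
have j0K a : j0 a%:A = iota a by apply: subfx_inj_base.
have [ys eys] : exists ys : seq L0, map j0 ys = s.
  elim: s hz {ep Sz} => [|x s IH] hz; first by exists [::].
  have [ys eys] : exists ys : seq L0, map j0 ys = s by apply: IH => w ws; apply: hz; rewrite inE ws orbT.
  have [q eq] := hz x (mem_head x s).
  by exists ((subfx_eval iota z r q : L0) :: ys); rewrite /= eys [j0 _](subfx_inj_eval rz r0 q) eq.
have eP : \prod_(y <- ys) ('X - y%:P) = map_poly (in_alg L0) p.
  apply: (map_poly_inj j0); rewrite rmorph_prod -map_poly_comp /=.
  rewrite (eq_map_poly (g := iota)); last by move=> a; apply: j0K.
  rewrite ep -eys big_map; apply: eq_bigr => y _; by rewrite map_polyXsubC.
have gen : <<1 & ys>>%VS = fullv.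
  apply/vspaceP => w; rewrite memvf.
  have zin : subfx_root iota z r \in <<1 & ys>>%VS.
    have [w' w'in ew'] : exists2 w', w' \in <<1 & ys>>%VS & j0 w' = z.
      apply: (Sz (fun c => exists2 w' : L0, w' \in <<1 & ys>>%VS & j0 w' = c)) => [|a b [a' a'in <-] [b' b'in <-]|x].
      - by exists 0; rewrite ?mem0v ?rmorph0.
      - by exists (a' - b'); rewrite ?rpredB ?rmorphB.
      rewrite -eys => /mapP[y yin ->]; exists y => //.
      exact: seqv_sub_adjoin.
    suff <- : w' = subfx_root iota z r :> L0 by [].
    by apply: (fmorph_inj j0); rewrite ew'; apply/esym/(subfx_inj_root rz r0).
  have [q ->] := subfxEroot rz r0 w.
  elim/poly_ind: q => [|q a IH]; first by rewrite rmorph0 horner0 mem0v.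
  rewrite rmorphD rmorphM /= map_polyX map_polyC hornerD hornerM hornerX hornerC.
  by apply: rpredD; [apply: rpredM|apply: rpredZ; apply: mem1v].
have ax : SplittingField.axiom L0.
  exists (\prod_(y <- ys) ('X - y%:P)); first by rewrite eP; apply/polyOverP => i; rewrite coef_map; apply: rpredZ; apply: mem1v.
  by exists ys; [apply: eqpxx|apply: gen].
pose L : splittingFieldType K := HB.pack L0 (FieldExt_isSplittingField.Build K L0 ax).
exists L, j0, ys; split=> //.
apply/and3P; split; [exact: sub1v| |exact: normalFieldf].
apply/separableP => y _; apply: pcharf0_separable => l.
by rewrite -char0 (fmorph_pchar (in_alg L)).
Qed.

End SplitExtension.

Lemma ext_containing (K : fieldType) (C : closedFieldType) (iota : {rmorphism K -> C}) :
  [pchar K] =i pred0 -> integralRange iota -> forall s : seq C,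
  exists (L : splittingFieldType K) (j : {rmorphism L -> C}),
  [/\ extends iota j, galois 1%AS {:L} & forall x, x \in s -> exists y, j y = x].
Proof.
move=> char0 alg s.
have [p mp hp] : exists2 p : {poly K}, p \is monic & forall x, x \in s -> root (map_poly iota p) x.
  elim: s => [|x s [p mp hp]]; first by exists 1; rewrite ?monic1.
  have [q mq qx] := alg x; exists (q * p); first by rewrite monicMl.
  by move=> w; rewrite inE rmorphM rootM => /predU1P[->|/hp ->]; rewrite ?qx ?orbT.
have [r er] := closed_field_poly_normal (map_poly iota p).
rewrite (monicP _) ?monic_map // scale1r in er.
have [L [j [ys [ej gL eys _]]]] := split_ext char0 alg er.
exists L, j; split=> // x /hp; rewrite er root_prod_XsubC -eys => /mapP[y _ ->].
by exists y.
Qed.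

Lemma galois_stable_poly (K : fieldType) (L : splittingFieldType K) (ys : seq L) :
  galois 1%AS {:L} -> (forall t : gal_of {:L}, perm_eq (map t ys) ys) ->
  exists p : {poly K}, map_poly (in_alg L) p = \prod_(y <- ys) ('X - y%:P).
Proof.
move=> gL st; suff /polyOver1P[p ->] : \prod_(y <- ys) ('X - y%:P) \is a polyOver 1%VS by exists p.
have <- : fixedField 'Gal({:L} / 1%AS)%g = 1%VS :> {vspace L} by apply/galois_fixedField.
apply/polyOverP => i; apply/fixedFieldP; first exact: memvf.
move=> t _; have e : map_poly t (\prod_(y <- ys) ('X - y%:P)) = \prod_(y <- ys) ('X - y%:P).
  rewrite rmorph_prod -[RHS](perm_big _ (st t)) big_map /=.
  by apply: eq_bigr => y _; rewrite map_polyXsubC.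
by rewrite -[in RHS]e coef_map.
Qed.

Lemma integral_over_rat (K : fieldExtType rat) (C : closedFieldType) (iota : {rmorphism K -> C}) :
  integralRange iota -> integralRange (iota \o in_alg K : {rmorphism rat -> C}).
Proof.
move=> alg x; have [p mp px] := alg x.
apply: (@integral_root_monic _ _ _ _ (map_poly iota p)); rewrite ?map_monic //.
move=> _ /(nthP 0)[i ltip <-]; rewrite coef_map; apply: integral_rmorph.
have /polyOver1P[q eq] := minPolyOver 1%AS p`_i; exists q.
  by rewrite -(map_monic (in_alg K)) -eq monic_minPoly.
by rewrite -eq root_minPoly.
Qed.

(** * Points of varieties under two embeddings *)

Section ConjugatePoints.
Variables (K : fieldType) (C : fieldType) (iota : {rmorphism K -> C}) (L : fieldExtType K).

(** Substitute for the Galois action on points: one L-vector seen through two embeddings. It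
    respects morphisms over K, and for [j1 = j2] it expresses rationality over L. *)
Definition conj_points (j1 j2 : {rmorphism L -> C}) T n (e : T -> pspace C n) (P P' : T) :=
  exists y : 'rV[L]_n, coords (e P) (map_mx j1 y) /\ coords (e P') (map_mx j2 y).

Variables (j1 j2 : {rmorphism L -> C}).
Hypotheses (ej1 : extends iota j1) (ej2 : extends iota j2).

Lemma conj_points_rational j T n (e : T -> pspace C n) P :
  conj_points j j e P P <-> rational_point j e P.
Proof.
split=> [[y [Py _]]|[y _ Py]]; exists y; rewrite ?Py //.
by have := coords_neq0 Py; rewrite map_mx_eq0.
Qed.

Lemma conj_points_inj T n (e : T -> pspace C n) P P' P'' : injective e ->
  conj_points j1 j2 e P P' -> conj_points j1 j2 e P P'' -> P' = P''.
Proof.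
move=> inje [y [Py Py']] [z [Pz Pz']]; apply: inje; apply: (coords_inj Py').
have [a a0 ea] := coords_prop Py Pz; have [i yi] := rV0Pn _ (coords_neq0 Py).
have yi0 : y 0 i != 0 by move: yi; rewrite mxE fmorph_eq0.
have ez : z = (z 0 i / y 0 i) *: y.
  apply/rowP => k; apply: (fmorph_inj j1); rewrite !mxE rmorphM fmorph_div.
  have ek m : j1 (z 0 m) = a * j1 (y 0 m) by move/rowP/(_ m): ea; rewrite !mxE.
  by rewrite !ek mulfK // fmorph_eq0.
have b0 : z 0 i / y 0 i != 0.
  by apply: contraNneq (coords_neq0 Pz) => b0; rewrite ez b0 scale0r map_mx0.
have -> : map_mx j2 y = j2 (z 0 i / y 0 i)^-1 *: map_mx j2 z.
  by rewrite {2}ez map_mxZ scalerA -rmorphM mulVf // rmorph1 scale1r.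
by apply: coords_scale; rewrite ?fmorph_eq0 ?invr_eq0.
Qed.

Lemma meval_row_map (j : {rmorphism L -> C}) n (F : {mpoly K[n]}) (y : 'rV[L]_n) :
  extends iota j ->
  meval_row (map_mpoly iota F) (map_mx j y) = j (meval_row (map_mpoly (in_alg L) F) y).
Proof.
move=> ej; have supp (R : fieldType) (i : {rmorphism K -> R}) (f : 'I_n -> R) :
    (map_mpoly i F).@[f] = \sum_(m <- msupp F) i F@_m * \prod_k f k ^+ m k.
  rewrite mevalE (perm_big _ (msupp_map_mpoly _ (fmorph_inj i))).
  by apply: eq_bigr => m _; rewrite mcoeff_map_mpoly.
rewrite /meval_row !supp rmorph_sum; apply: eq_bigr => m _; rewrite rmorphM /= [in RHS]ej.
by congr (_ * _); rewrite rmorph_prod; apply: eq_bigr => k _; rewrite mxE rmorphXn.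
Qed.

Lemma conj_points_morphism T n (e : T -> pspace C n) T' n' (e' : T' -> pspace C n') f P P' :
  morphism_over iota e e' f -> conj_points j1 j2 e P P' -> conj_points j1 j2 e' (f P) (f P').
Proof.
move=> mf [y [Py Py']]; have [d [F [hF F0 hf]]] := mf P.
pose z : 'rV[L]_n' := \row_i meval_row (map_mpoly (in_alg L) (F i)) y.
have ez j : extends iota j -> meval_rows iota F (map_mx j y) = map_mx j z.
  by move=> ej; apply/rowP => i; rewrite !mxE meval_row_map.
have z0 : z != 0 by have := F0 _ Py; rewrite ez // map_mx_eq0.
exists z; split; rewrite -ez //; apply: hf => //; by rewrite ez // map_mx_eq0.
Qed.

(** The ideal has generators over K, so the conjugate vector satisfies the same equations, and the
    image of [e] is closed. *)
Lemma conj_points_exists T n (e : T -> pspace C n) P : projective_variety iota e ->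
  rational_point j1 e P -> exists P', conj_points j1 j2 e P P'.
Proof.
move=> [inje cle _ [m [F [hF [F0 genF]]]]] [y y0 Py].
have y20 : map_mx j2 y != 0 by rewrite map_mx_eq0.
have [Q Qy] := coords_exists y20; have [S hS hSQ] := cle.
suff [P' eP'] : exists P', Q = e P' by exists P', y; split; rewrite -?eP'.
apply/hSQ => H SH x Qx; have iH : in_ideal e H.
  by move=> P'; apply: (proj1 (hSQ (e P'))); [exists P'|].
have [h ->] := genF H iH; rewrite /meval_row rmorph_sum /= big1 // => i _.
rewrite rmorphM /=; suff -> : (map_mpoly iota (F i)).@[fun k => x 0 k] = 0 by rewrite mulr0.
have [c c0 ->] := coords_prop Qy Qx; have [d' hFi] := hF i.
have /meval_row_homog := map_mpoly_homog iota hFi; rewrite {1}/meval_row => ->.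
have z : meval_row (map_mpoly (in_alg L) (F i)) y = 0.
  by apply: (fmorph_inj j1); rewrite rmorph0 -meval_row_map //; apply: (F0 i P).
by rewrite -/(meval_row _ _) meval_row_map // z rmorph0 mulr0.
Qed.

Lemma conj_points_base T n (e : T -> pspace C n) P :
  rational_point iota e P -> conj_points j1 j2 e P P.
Proof.
move=> [y y0 Py]; exists (map_mx (in_alg L) y).
have h j : extends iota j -> map_mx j (map_mx (in_alg L) y) = map_mx iota y.
  by move=> ej; apply/rowP => i; rewrite !mxE /= ej.
by rewrite !h.
Qed.

Lemma conj_points_pair T n (e : T -> pspace C n) T' n' (e' : T' -> pspace C n') P P' Q Q' :
  conj_points j1 j2 e P P' -> conj_points j1 j2 e' Q Q' ->
  conj_points j1 j2 (fun PQ : T * T' => segre (e PQ.1) (e' PQ.2)) (P, Q) (P', Q').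
Proof.
move=> [y [Py Py']] [z [Qz Qz']]; exists (segre_coords y z).
have h (j : {rmorphism L -> C}) : map_mx j (segre_coords y z) = segre_coords (map_mx j y) (map_mx j z).
  by rewrite /segre_coords map_mxvec map_mxM map_trmx.
by rewrite !h; split; apply: segreE.
Qed.

End ConjugatePoints.

Lemma embedding_exists (K : fieldType) (C : closedFieldType) (iota : {rmorphism K -> C})
    (F : fieldExtType K) : [pchar K] =i pred0 ->
  exists j : {rmorphism F -> C}, extends iota j.
Proof.
move=> char0; have charF : [pchar F] =i pred0.
  by move=> l; rewrite -char0 (fmorph_pchar (in_alg F)).
have sep : separable 1 {:F} by apply/separableP => y _; apply: pcharf0_separable.
pose w := separable_generator 1%AS {:F}%AS.
have ew : {:F}%VS = <<1; w>>%VS by apply: (eq_adjoin_separable_generator sep (sub1v _)).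
have /polyOver1P[q eq] := minPolyOver 1%AS w.
have sq : (1 < size q)%N by rewrite -(size_map_poly (in_alg F)) -eq size_minPoly.
have [z qz] : exists z, root (map_poly iota q) z.
  by apply/closed_rootP; rewrite size_map_poly neq_ltn sq orbT.
pose P (x : F) (p : {poly K}) := (map_poly (in_alg F) p).[w] = x.
have exP x : exists p, P x p.
  have /Fadjoin_polyP[p /polyOver1P[p' ->] ->] : x \in <<1%AS; w>>%VS by rewrite -ew memvf.
  by exists p'.
have [f hf] := boolp.choice exP.
pose j0 x := (map_poly iota (f x)).[z].
have j0E x p : P x p -> j0 x = (map_poly iota p).[z].
  move=> Pp; apply/eqP; rewrite -subr_eq0 -hornerN -hornerD -rmorphB; apply/eqP/rootP.
  have : q %| f x - p.
    rewrite -(dvdp_map (in_alg F)) -eq; apply: minPoly_dvdp.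
      by apply/polyOver1P; exists (f x - p).
    by rewrite /root rmorphB hornerD hornerN [X in X - _]hf Pp subrr.
  by move=> /dvdpP[r ->]; rewrite rmorphM rootM qz orbT.
have jB : zmod_morphism j0.
  move=> x y; rewrite (j0E _ (f x - f y)); first by rewrite rmorphB hornerD hornerN.
  by rewrite /P rmorphB hornerD hornerN !hf.
have jM : monoid_morphism j0.
  split; first by rewrite (j0E _ 1) /P ?rmorph1 ?hornerC.
  move=> x y; rewrite (j0E _ (f x * f y)); first by rewrite rmorphM hornerM.
  by rewrite /P rmorphM hornerM !hf.
pose j : {rmorphism F -> C} := HB.pack j0 (GRing.isZmodMorphism.Build F C j0 jB)
  (GRing.isMonoidMorphism.Build F C j0 jM).
exists j => a; rewrite [LHS](j0E _ a%:P); first by rewrite map_polyC hornerC.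
by rewrite /P map_polyC hornerC.
Qed.

Lemma poly_lift (F C : fieldType) (k : {rmorphism F -> C}) (p : {poly C}) :
  (forall i, exists y, k y = p`_i) -> exists q, map_poly k q = p.
Proof.
move=> h; have [f hf] := boolp.choice h; exists (\poly_(i < size p) f i).
apply/polyP => i; rewrite coef_map coef_poly.
case: ltnP => [_|le]; first exact: hf.
by rewrite [RHS]nth_default // raddf0.
Qed.

Lemma poly2_lift (F C : fieldType) (k : {rmorphism F -> C}) (p : {poly {poly C}}) :
  (forall i m, exists y, k y = p`_i`_m) -> exists q, map_poly (map_poly k) q = p.
Proof.
move=> h; have h' i : exists q, map_poly k q = p`_i by apply: poly_lift; apply: h.
have [f hf] := boolp.choice h'; exists (\poly_(i < size p) f i).
apply/polyP => i; rewrite coef_map coef_poly.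
case: ltnP => [_|le]; first exact: hf.
by rewrite [RHS]nth_default // raddf0.
Qed.

Lemma mem_mpoly_coefs (C : fieldType) d (p : {mpoly C[d]}) (S : C -> Prop) :
  S 0 -> (forall m, m \in msupp p -> S p@_m) -> forall m, S p@_m.
Proof.
by move=> S0 h m; case: (boolP (m \in msupp p)) => [/h //|/memN_msupp_eq0 ->].
Qed.

(** * Irreducible specializations close to a given point *)

Section Specialization.
Variables (C : closedFieldType) (i0 : {rmorphism rat -> C}).
Hypothesis alg : integralRange i0.
Variables (l : nat) (O : C -> Prop).
Hypotheses (vO : valuation_ring l O) (pl : prime l).
Let sO := subring_vr vO.
Variables (d : nat) (chi : {poly {mpoly C[d]}}) (D : {mpoly C[d]}).
Hypotheses (mchi : chi \is monic) (schi : (1 < size chi)%N).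
Hypothesis irr : forall p q : {poly {mpoly C[d]}}, p \is monic -> q \is monic -> p * q = chi ->
  size p = 1%N \/ size q = 1%N.

Lemma rat_pchar0 : [pchar rat] =i pred0.
Proof. by apply/pcharf0P => n; rewrite Num.Theory.pnatr_eq0. Qed.

Lemma char0_C : [pchar C] =i pred0.
Proof. by move=> p; rewrite (fmorph_pchar i0) rat_pchar0. Qed.

(** Irreducibility on the line over [C] excludes factors over any F. F contains the coefficients of
    chi on the line, those of [D], and [s]; Hilbert's theorem is then applied over F. The bound
    [t1 i <= t i] will ensure that [t] is not the zero vector. *)
Lemma irreducible_specialization (t1 : 'I_d -> nat) (k : nat) (s : seq C) :
  separable_poly (evc (\row_i (t1 i)%:R) chi) ->
  exists (F : splittingFieldType rat) (kap : {rmorphism F -> C}) (t : 'I_d -> nat) (chiF : {poly F}) (DF : F),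
    [/\ forall x, x \in s -> exists y, kap y = x,
        nearv l O (\row_i (t1 i)%:R) k (\row_i (t i)%:R) /\ (forall i, t1 i <= t i)%N,
        irreducible_poly chiF, map_poly kap chiF = evc (\row_i (t i)%:R) chi &
        kap DF = meval_row D (\row_i (t i)%:R)].
Proof.
move=> sep; have c0 := char0_C.
have [v hv] := irreducible_line c0 mchi sep irr.
pose a : C := (l ^ k)%:R.
have a0 : a != 0 by rewrite ((pcharf0P C).1 c0) -lt0n expn_gt0 prime_gt0.
(* The substitution T -> l^k T is invertible over [C], so it preserves irreducibility, while every
   natural value of T now gives a point near [t1]. *)
pose sub (b : C) : {rmorphism {poly C} -> {poly C}} := comp_poly (b *: 'X).
have subK : cancel (sub a) (sub a^-1).
  move=> p; rewrite /sub /= -comp_polyA comp_polyZ comp_polyX scalerA mulfV // scale1r.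
  by rewrite comp_polyXr.
pose le := line_eval (\row_i (t1 i)%:R) (fun i => (v i)%:R : C).
pose chi1 := map_poly (sub a) (map_poly le chi).
pose cs := flatten (map (@polyseq C) (polyseq chi1)) ++ [seq D@_m | m <- msupp D] ++ s.
have [F [kap [ekap galF hcs]]] := ext_containing rat_pchar0 alg cs.
have [chiF echiF] : exists chiF, map_poly (map_poly kap) chiF = chi1.
  apply: poly2_lift => i m; have [lt1|le1] := ltnP i (size chi1); last first.
    by exists 0; rewrite raddf0 [chi1`_i]nth_default // coef0.
  have [lt2|le2] := ltnP m (size chi1`_i); last by exists 0; rewrite rmorph0 nth_default.
  apply: hcs; rewrite mem_cat; apply/orP; left; apply/flattenP.
  by exists (polyseq chi1`_i); [apply/map_f/mem_nth|apply: mem_nth].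
have mchi1 : chi1 \is monic by rewrite !monic_map.
have ikap := @map_poly_inj _ _ kap.
have mchiF : chiF \is monic.
  rewrite monicE; apply/eqP/ikap; rewrite rmorph1 -(monicP mchi1) -echiF.
  by rewrite lead_coef_map_inj // rmorph0.
have schiF : size chiF = size chi.
  rewrite -(size_map_inj_poly ikap (rmorph0 _)) echiF size_map_poly_id0 ?size_map_poly_id0 //.
    by rewrite (monicP mchi) rmorph1 oner_eq0.
  by rewrite (monicP (monic_map _ mchi)) rmorph1 oner_eq0.
pose t (c : nat) i := (t1 i + v i * (l ^ k * c))%N.
have evF (c : nat) : map_poly kap (evp c%:R chiF) = evc (\row_i (t c i)%:R) chi.
  rewrite evp_map echiF rmorph_nat /evp /chi1 -!map_poly_comp; apply: eq_map_poly => p /=.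
  rewrite /horner_eval horner_comp hornerZ hornerX -/(le p) line_eval_horner /meval_row.
  congr (meval _ p); apply: boolp.funext => i; rewrite !mxE natrD !natrM.
  by [].
have [nu _] := embedding_exists (@ratr algC) F rat_pchar0.
have [|||T irrT] := hilbert_irreducibility nu galF mchiF.
- by rewrite schiF.
- rewrite -(separable_map kap) -[0]/(0%:R) evF.
  by congr separable_poly: sep; congr evc; apply/rowP => i; rewrite !mxE /t !muln0 addn0.
- move=> P Q mP mQ ePQ.
  have [] := hv (map_poly (sub a^-1) (map_poly (map_poly kap) P)) (map_poly (sub a^-1) (map_poly (map_poly kap) Q)).
  + by rewrite !monic_map.
  + by rewrite !monic_map.
  + have e1 : map_poly (map_poly kap) P * map_poly (map_poly kap) Q = chi1.
      by rewrite -echiF -ePQ [RHS]rmorphM.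
    rewrite -rmorphM e1 -/le; apply/polyP => i.
    by rewrite 2!coef_map [LHS]subK.
  + move=> sP; left; move: sP; rewrite size_map_poly_id0 ?size_map_poly_id0 //.
      by rewrite (monicP mP) rmorph1 oner_eq0.
    by rewrite (monicP (monic_map _ mP)) rmorph1 oner_eq0.
  + move=> sP; right; move: sP; rewrite size_map_poly_id0 ?size_map_poly_id0 //.
      by rewrite (monicP mQ) rmorph1 oner_eq0.
    by rewrite (monicP (monic_map _ mQ)) rmorph1 oner_eq0.
have [DF eDF] : exists DF, kap DF = meval_row D (\row_i (t T i)%:R).
  have hD m : exists y, kap y = D@_m.
    apply: (mem_mpoly_coefs (S := fun x => exists y, kap y = x)) m.
      by exists 0; rewrite rmorph0.
    move=> m' Dm; have h : D@_m' \in [seq D@_m | m <- msupp D] by apply/mapP; exists m'.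
    by apply: hcs; rewrite !mem_cat h ?orbT.
  have [f hf] := boolp.choice hD.
  exists (\sum_(m <- msupp D) f m * \prod_i (t T i)%:R ^+ m i).
  rewrite /meval_row mevalE rmorph_sum; apply: eq_bigr => m _; rewrite rmorphM /= hf.
  by congr (_ * _); rewrite rmorph_prod; apply: eq_bigr => i _; rewrite mxE rmorphXn /= rmorph_nat.
exists F, kap, (t T), (evp T%:R chiF), DF; split=> //.
  by move=> x xs; apply: hcs; rewrite !mem_cat xs !orbT.
split=> i; last exact: leq_addr.
rewrite !mxE natrD addrAC subrr add0r mulnCA natrM natrX.
by exists (v i * T)%:R => //; apply: (sr_nat sO).
Qed.

End Specialization.

Lemma conj_points_coords (K C : fieldType) (L : fieldExtType K) (j1 j2 : {rmorphism L -> C})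
    T n (e : T -> pspace C n) P P' (y : 'rV[L]_n) :
  conj_points j1 j2 e P P' -> coords (e P) (map_mx j1 y) -> coords (e P') (map_mx j2 y).
Proof.
move=> cPP' Py; have y0 : map_mx j2 y != 0.
  by have := coords_neq0 Py; rewrite !map_mx_eq0.
have [Q Qy] := coords_exists y0.
suff -> : e P' = Q by [].
by apply: (@conj_points_inj _ _ _ j1 j2 _ _ (@id (pspace C n)) (e P)) => //; exists y.
Qed.

(** * The Galois group of a fibre *)

Section GaloisAction.
Variables (K : fieldType) (C : closedFieldType) (iota : {rmorphism K -> C}).
Hypotheses (char0 : [pchar K] =i pred0) (alg : integralRange iota).
Variables (X : Type) (n : nat) (eX : X -> pspace C n).
Hypothesis hX : projective_variety iota eX.
Variables (gT : finGroupType) (act : gT -> X -> X).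
Hypothesis hG : automorphism_subgroup iota eX act.
Variables (d : nat) (rho : X -> pspace C d).
Hypothesis crho : forall (L : fieldExtType K) (j1 j2 : {rmorphism L -> C}),
  extends iota j1 -> extends iota j2 -> forall P P', conj_points j1 j2 eX P P' ->
  conj_points j1 j2 (@id (pspace C d)) (rho P) (rho P').
Hypothesis rho_orbit : forall P P', rho P = rho P' -> exists g, P' = act g P.
Variables (P : X) (z : 'rV[K]_d) (c1 c2 : nat).
Hypothesis Pz : coords (rho P) (map_mx iota z).
Hypothesis lin1 : forall g, linform c1 (vpick (val (eX (act g P)))) != 0.
Hypothesis inj_theta : injective (fun g => theta eX c1 c2 (act g P)).

(** Normalization by a form with natural coefficients makes the coordinate vector unique and
    compatible with embeddings. *)
Definition norm_coords g : 'rV[C]_n :=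
  (linform c1 (vpick (val (eX (act g P)))))^-1 *: vpick (val (eX (act g P))).

Lemma norm_coordsP g : coords (eX (act g P)) (norm_coords g).
Proof. by apply: coords_scale; [apply: coords_pick|rewrite invr_eq0]. Qed.

Lemma linform_norm g : linform c1 (norm_coords g) = 1.
Proof. by rewrite linformZ mulVf. Qed.

Lemma norm_coords_uniq g x : coords (eX (act g P)) x -> linform c1 x = 1 -> x = norm_coords g.
Proof.
move=> Px l1; have [a a0 ea] := coords_prop (norm_coordsP g) Px.
by move: l1; rewrite ea linformZ linform_norm mulr1 => ->; rewrite scale1r.
Qed.

Lemma norm_coords_inj : injective norm_coords.
Proof.
move=> g h e; apply: inj_theta; rewrite /= (thetaE _ _ (norm_coordsP g)) (thetaE _ _ (norm_coordsP h)).
by rewrite e.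
Qed.

Lemma linform_map (R S : fieldType) (f : {rmorphism R -> S}) m c (x : 'rV[R]_m) :
  linform c (map_mx f x) = f (linform c x).
Proof.
by rewrite /linform rmorph_sum; apply: eq_bigr => i _; rewrite rmorphM rmorphXn rmorph_nat mxE.
Qed.

Section Action.
Variables (L : splittingFieldType K) (j : {rmorphism L -> C}) (y : gT -> 'rV[L]_n).
Hypotheses (ej : extends iota j) (hy : forall g, map_mx j (y g) = norm_coords g).

Definition conj_emb (t : gal_of {:L}) : {rmorphism L -> C} := j \o t.

Lemma conj_emb_extends t : extends iota (conj_emb t).
Proof. by move=> a; rewrite /conj_emb /= linearZ rmorph1 ej. Qed.

Lemma y_inj : injective y.
Proof. by move=> g h e; apply: norm_coords_inj; rewrite -!hy e. Qed.

(** The image of P is K-rational, so the conjugate of P lies in the same orbit and is hP. As [act g]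
    is defined over K, conjugation takes gP to g(hP), whence translation on the right. *)
Lemma galois_moves (t : gal_of {:L}) : exists h, forall g,
  map_mx t (y g) = y (g * h)%g /\ conj_points j (conj_emb t) eX (act g P) (act (g * h)%g P).
Proof.
have et := conj_emb_extends t.
have rat g : rational_point j eX (act g P).
  exists (y g); last by rewrite hy; apply: norm_coordsP.
  by have := coords_neq0 (norm_coordsP g); rewrite -hy map_mx_eq0.
have [P' cP'] : exists P', conj_points j (conj_emb t) eX P P'.
  by apply: (conj_points_exists ej et hX); rewrite -[P](aut_one hG); apply: rat.
have e : rho P = rho P'.
  apply: (@conj_points_inj _ _ _ j (conj_emb t) _ _ (@id (pspace C d)) (rho P)) => //.
    apply: (conj_points_base ej et); exists z => //.
    by have := coords_neq0 Pz; rewrite map_mx_eq0.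
  exact: (crho ej et cP').
have [h eP'] := rho_orbit e; exists h => g.
have cg : conj_points j (conj_emb t) eX (act g P) (act (g * h)%g P).
  by rewrite (aut_mul hG) -eP'; apply: (conj_points_morphism ej et (aut_morphism hG g) cP').
split=> //; apply/rowP => i; apply: (fmorph_inj j).
have /rowP/(_ i) : map_mx j (map_mx t (y g)) = norm_coords (g * h)%g.
  apply: norm_coords_uniq.
    rewrite -map_mx_comp; apply: (conj_points_coords cg).
    by rewrite hy; apply: norm_coordsP.
  by rewrite linform_map linform_map (_ : linform c1 (y g) = 1) ?rmorph1 //;
     apply: (fmorph_inj j); rewrite -linform_map hy linform_norm rmorph1.
by rewrite -hy !mxE.
Qed.

End Action.

(** Take first any Galois field with all the coordinates. The Galois group permutes them, so the
    polynomial with these roots descends to K, and its splitting field is generated by them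
    alone. *)
Lemma orbit_field : exists (L : splittingFieldType K) (j : {rmorphism L -> C}) (y : gT -> 'rV[L]_n),
  [/\ extends iota j, galois 1%AS {:L}, forall g, map_mx j (y g) = norm_coords g &
   forall E : {subfield L}, (forall g i, y g 0 i \in E) -> ({:L} <= E)%VS].
Proof.
pose s := [seq norm_coords gi.1 0 gi.2 | gi : gT * 'I_n].
have sP g i : norm_coords g 0 i \in s by apply/imageP; exists (g, i).
have [L' [j' [ej' galL' hs]]] := ext_containing char0 alg s.
have [y' hy'] : exists y' : gT -> 'rV[L']_n, forall g, map_mx j' (y' g) = norm_coords g.
  have H gi : exists a, j' a = norm_coords gi.1 0 gi.2 by apply/hs/sP.
  have [f hf] := boolp.choice H; exists (fun g => \row_i f (g, i)) => g.
  by apply/rowP => i; rewrite mxE mxE hf.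
pose ys' := undup [seq y' gi.1 0 gi.2 | gi : gT * 'I_n].
have ys'P g i : y' g 0 i \in ys' by rewrite mem_undup; apply/imageP; exists (g, i).
have [|p ep] := galois_stable_poly (ys := ys') galL'.
  move=> t; have [h ht] := galois_moves ej' hy' t.
  have sub : {subset map t ys' <= ys'}.
    move=> b /mapP[a + ->]; rewrite mem_undup => /imageP[[g i] _ ->] /=.
    by have [/rowP/(_ i) + _] := ht g; rewrite mxE => ->.
  have um : uniq (map t ys') by rewrite map_inj_uniq ?undup_uniq //; apply: fmorph_inj.
  have [_ e] := uniq_min_size um sub (eq_leq (esym (size_map t ys'))).
  exact: (uniq_perm um (undup_uniq _) e).
have eC : map_poly iota p = \prod_(x <- map j' ys') ('X - x%:P).
  have -> : map_poly iota p = map_poly j' (map_poly (in_alg L') p).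
    by rewrite -map_poly_comp; apply: eq_map_poly => a; rewrite /= ej'.
  by rewrite ep rmorph_prod big_map; apply: eq_bigr => x _; rewrite /= map_polyXsubC.
have [L [j [ys [ej galL eys gen]]]] := split_ext char0 alg eC.
have [y hy] : exists y : gT -> 'rV[L]_n, forall g, map_mx j (y g) = norm_coords g.
  have H gi : exists a, j a = norm_coords gi.1 0 gi.2.
    have : j' (y' gi.1 0 gi.2) \in map j ys by rewrite eys map_f.
    by move=> /mapP[a _ ea]; exists a; rewrite -ea -hy' mxE.
  have [f hf] := boolp.choice H; exists (fun g => \row_i f (g, i)) => g.
  by apply/rowP => i; rewrite mxE mxE hf.
exists L, j, y; split=> // E hE; rewrite -gen; apply/Fadjoin_seqP; split; first exact: sub1v.
move=> a ays; have : j a \in map j' ys' by rewrite -eys map_f.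
move=> /mapP[b + eb]; rewrite mem_undup => /imageP[[g i] _ /= ebi].
suff -> : a = y g 0 i by apply: hE.
apply: (fmorph_inj j); rewrite eb ebi.
by have /rowP/(_ i) := hy g; rewrite -hy' !mxE.
Qed.

Variable FF : C -> Prop.
Hypothesis FFiota : forall a, FF (iota a).
Hypothesis FFD : forall a b, FF a -> FF b -> FF (a + b).
Hypothesis FFM : forall a b, FF a -> FF b -> FF (a * b).
Hypothesis ind : forall c : 'I_#|gT| -> C, (forall i, FF (c i)) ->
  \sum_i c i * theta eX c1 c2 P ^+ i = 0 -> forall i, c i = 0.

(** Sending t to its translation is a homomorphism, because Galois products compose from left to
    right. It is injective since the coordinates generate L, and surjective since [ind] over K gives
    a degree of at least [#|gT|]. The powers of theta(P) then form a K-basis of L that stays free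
    over [FF], which is linear disjointness. *)
Lemma galois_specialization : exists (L : splittingFieldType K) (j : {rmorphism L -> C}),
  [/\ is_G_extension L gT, extends iota j, linearly_disjoint j FF,
    forall g, rational_point j eX (act g P) &
    forall h, exists2 j2 : {rmorphism L -> C}, extends iota j2 &
      forall g, conj_points j j2 eX (act g P) (act (g * h)%g P)].
Proof.
have [L [j [y [ej galL hy gen]]]] := orbit_field.
have [phi hphi] := boolp.choice (galois_moves ej hy).
have phi_uniq (t : gal_of {:L}) h : (forall g, map_mx t (y g) = y (g * h)%g) -> phi t = h.
  move=> ht; have := y_inj hy (etrans (esym (ht 1%g)) (proj1 (hphi t 1%g))).
  by rewrite !mul1g.
have phiM : {in 'Gal({:L} / 1%AS)%g &, {morph phi : t t' / (t * t')%g}}.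
  move=> t t' _ _; apply: phi_uniq => g.
  have -> : map_mx (t * t')%g (y g) = map_mx t' (map_mx t (y g)).
    by apply/rowP => i; rewrite !mxE galM // memvf.
  by rewrite (proj1 (hphi t g)) (proj1 (hphi t' _)) mulgA.
pose f : {morphism 'Gal({:L} / 1%AS)%g >-> gT} := Morphism phiM.
have injf : ('injm f)%g.
  apply/subsetP => t /morphpreP[_ /set1P]; rewrite -[f t]/(phi t) => pt1; apply/set1P.
  apply/eqP/gal_eqP => a _; rewrite gal_id.
  have /subvP/(_ a (memvf a)) : ({:L} <= fixedField [set t])%VS.
    apply: gen => g i; apply/fixedFieldP; first exact: memvf.
    move=> _ /set1P->; have /rowP/(_ i) := proj1 (hphi t g).
    by rewrite pt1 mulg1 mxE.
  by move=> /mem_fixedFieldP[_ ->]; rewrite ?set11.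
pose N := #|gT|; pose th := linform c2 (y 1%g).
have jth : j th = theta eX c1 c2 P.
  rewrite -[P in RHS](aut_one hG) (thetaE _ _ (norm_coordsP 1%g)) linform_norm divr1.
  by rewrite -hy linform_map.
pose pw : N.-tuple L := [tuple th ^+ i | i < N].
have pwE (i : 'I_N) : pw`_i = th ^+ i by rewrite -tnth_nth tnth_mktuple.
have jZ a w : j (a *: w) = iota a * j w by rewrite -mulr_algl rmorphM /= ej.
have freepw : free pw.
  apply/freeP => k e i; apply: (fmorph_inj iota); rewrite rmorph0.
  apply: (ind (c := iota \o k)) => [i'|] /=; first exact: FFiota.
  rewrite -[RHS](rmorph0 j) -[in RHS]e rmorph_sum; apply: eq_bigr => i' _.
  by rewrite pwE jZ rmorphXn /= jth.
have dimN : (N <= \dim {:L})%N.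
  by have := freepw; rewrite /free size_tuple => /eqP <-; apply/dimvS/subvf.
have cardG : #|'Gal({:L} / 1%AS)%g| = \dim {:L} by rewrite -galois_dim // dimv1 divn1.
have fG : (f @* 'Gal({:L} / 1%AS) = [set: gT])%g.
  by apply/eqP; rewrite eqEcard subsetT cardsT card_injm // cardG.
have isoG : ('Gal({:L} / 1%AS) \isog [set: gT])%g by rewrite -fG; apply: sub_isog.
have dimL : \dim {:L} = N by rewrite -cardG (card_isog isoG) cardsT.
have span v : v \in <<pw>>%VS.
  have -> : <<pw>>%VS = fullv; last exact: memvf.
  apply/eqP; rewrite eqEdim subvf dimL /=.
  by have := freepw; rewrite /free size_tuple => /eqP ->; rewrite leqnn.
exists L, j; split=> //.
- move=> m v freev b Fb e.
  pose A := \matrix_(i < m, k < N) coord pw k (tnth v i).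
  have vE i : tnth v i = \sum_k A i k *: th ^+ k.
    by rewrite {1}(coord_span (span (tnth v i))); apply: eq_bigr => k _; rewrite mxE pwE.
  have rA : row_free A.
    apply: inj_row_free => w wA; apply/rowP => i; rewrite mxE.
    have /freeP/(_ (fun i => w 0 i)) := freev; apply; rewrite (eq_bigr (fun i => \sum_k (w 0 i * A i k) *: th ^+ k)); last first.
      by move=> i' _; rewrite -tnth_nth vE scaler_sumr; apply: eq_bigr => k _; rewrite scalerA.
    rewrite exchange_big big1 //= => k _; rewrite -scaler_suml.
    by move/rowP/(_ k): wA; rewrite !mxE => ->; rewrite scale0r.
  have bA : (\row_i b i) *m map_mx iota A = 0.
    apply/rowP => k; rewrite !mxE.
    apply: (ind (c := fun k => \sum_i (\row_i b i) 0 i * (map_mx iota A) i k)).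
      move=> k'; have FF0 : FF 0 by rewrite -(rmorph0 iota).
      by elim/big_ind: _ => // i _; rewrite !mxE; apply: FFM.
    rewrite -[RHS]e (eq_bigr (fun k => \sum_i b i * iota (A i k) * theta eX c1 c2 P ^+ k)); last first.
      by move=> k' _; rewrite mulr_suml; apply: eq_bigr => i _; rewrite !mxE.
    rewrite exchange_big; apply: eq_bigr => i _; rewrite vE rmorph_sum mulr_sumr.
    by apply: eq_bigr => k' _; rewrite jZ rmorphXn /= jth mulrA.
  have : \row_i b i == 0.
    by rewrite -(mulmx_free_eq0 _ (_ : row_free (map_mx iota A))) ?bA // row_free_map.
  by move=> /eqP/rowP h i; have := h i; rewrite !mxE.
- move=> g; exists (y g); last by rewrite hy; apply: norm_coordsP.
  by have := coords_neq0 (norm_coordsP g); rewrite -hy map_mx_eq0.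
move=> h; have [t _ eh] : exists2 t, t \in 'Gal({:L} / 1%AS)%g & phi t = h.
  have : h \in (f @* 'Gal({:L} / 1%AS))%g by rewrite fG inE.
  by move=> /morphimP[t tG _ ->]; exists t.
exists (conj_emb j t); first exact: conj_emb_extends.
by move=> g; rewrite -eh; case: (hphi t g).
Qed.
End GaloisAction.

(** * Ranks *)

Local Notation pZtoQ := (map_poly (intr : int -> rat)).

Lemma torsion_mulrz (A : zmodType) (a : A) (c : int) : c != 0 -> a *~ c = 0 -> torsion a.
Proof.
case: (intP c) => [|n|n] // _; first by exists n.+1.
by rewrite mulrNz => /eqP; rewrite oppr_eq0 => /eqP; exists n.+1.
Qed.

(** A common factor has a complex root, a primitive p-th root of unity, whose minimal polynomial is
    ['Phi_p]. *)
Lemma cyclotomic_coprime_or_dvd (p : nat) (q : {poly rat}) : prime p ->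
  coprimep (pZtoQ 'Phi_p) q \/ pZtoQ 'Phi_p %| q.
Proof.
move=> pp; have p0 := prime_gt0 pp.
have [|nc] := boolP (coprimep (pZtoQ 'Phi_p) q); [by left|right].
set g := gcdp (pZtoQ 'Phi_p) q; have sg : size (map_poly (ratr : rat -> algC) g) != 1%N.
  by rewrite size_map_poly.
have [x gx] := closed_rootP _ sg.
have zq (r : {poly int}) : map_poly ratr (pZtoQ r) = map_poly intr r :> {poly algC}.
  by rewrite -map_poly_comp; apply: eq_map_poly => a /=; rewrite ratr_int.
have rooted r : g %| r -> root (map_poly ratr r) x.
  by move=> /dvdpP[r' ->]; rewrite rmorphM rootM gx orbT.
have [z zp] := C_prim_root_exists p0.
have : root (map_poly ratr (pZtoQ 'Phi_p)) x by apply: rooted; apply: dvdp_gcdl.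
rewrite zq (Cintr_Cyclotomic zp) root_cyclotomic // => xp.
have [r [er mr hr]] := minCpolyP x.
suff <- : r = pZtoQ 'Phi_p by rewrite -hr; apply: rooted; apply: dvdp_gcdr.
by apply: (@map_poly_inj _ _ (@ratr algC)); rewrite zq (Cintr_Cyclotomic xp) -er (minCpoly_cyclotomic xp).
Qed.

(** * Integral relations in a periodic sequence *)

Section CyclicModule.
Variables (A : zmodType) (x : nat -> A) (p : nat).
Hypotheses (pp : prime p) (xp : forall k, x (k + p)%N = x k).

(* Z[T] acts on the sequence x by T x_k = x_(k+1). *)
Definition pact (q : {poly int}) k := \sum_(i < size q) x (k + i) *~ q`_i.
Definition kills (q : {poly int}) := forall k, pact q k = 0.

Lemma pact_wide n (q : {poly int}) k : (size q <= n)%N -> pact q k = \sum_(i < n) x (k + i) *~ q`_i.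
Proof.
move=> le; rewrite /pact (big_ord_widen n (fun i => x (k + i) *~ q`_i)) // big_mkcond /=.
apply: eq_bigr => i _; case: ltnP => // le'; by rewrite nth_default // mulr0z.
Qed.

Lemma pactD (q1 q2 : {poly int}) k : pact (q1 + q2) k = pact q1 k + pact q2 k.
Proof.
pose n := maxn (size (q1 + q2)) (maxn (size q1) (size q2)).
rewrite !(pact_wide (n := n)) ?leq_max ?leqnn ?orbT // -big_split /=.
by apply: eq_bigr => i _; rewrite coefD mulrzDr.
Qed.

Lemma pactC c (q : {poly int}) k : pact (c%:P * q) k = pact q k *~ c.
Proof.
pose n := maxn (size (c%:P * q)) (size q).
have le1 : (size (c%:P * q)%R <= n)%N by rewrite leq_maxl.
have le2 : (size q <= n)%N by rewrite leq_maxr.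
rewrite (pact_wide _ le1) (pact_wide _ le2); move: n {le1 le2} => n.
by rewrite mulrz_suml; apply: eq_bigr => i _; rewrite coefCM mulrC mulrzA.
Qed.

Lemma pactX (q : {poly int}) k : pact (q * 'X) k = pact q k.+1.
Proof.
rewrite (pact_wide (n := (size q).+1)); last first.
  by rewrite (leq_trans (size_polyMleq _ _)) // size_polyX addn2.
rewrite big_ord_recl coefMX mulr0z add0r; apply: eq_bigr => i _.
by rewrite coefMX /= addnS addSn.
Qed.

Lemma killsD q1 q2 : kills q1 -> kills q2 -> kills (q1 + q2).
Proof. by move=> h1 h2 k; rewrite pactD h1 h2 addr0. Qed.

Lemma kills_mul u q : kills q -> kills (u * q).
Proof.
move=> hq; elim/poly_ind: u => [|u c IH] k.
  by rewrite mul0r /pact size_poly0 big_ord0.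
by rewrite mulrDl mulrAC pactD pactX pactC IH hq mul0rz addr0.
Qed.

Lemma pact_X n k : pact 'X^n k = x (k + n)%N.
Proof.
rewrite (pact_wide (n := n.+1)) ?size_polyXn // big_ord_recr /= coefXn eqxx mulr1z.
by rewrite big1 ?add0r // => i _; rewrite coefXn (ltn_eqF (ltn_ord i)) mulr0z.
Qed.

Lemma kills_period : kills ('X^p - 1).
Proof.
move=> k; have -> : 'X^p - 1 = 'X^p + (- 1)%:P * 'X^0 :> {poly int} by rewrite polyCN mulN1r expr0.
by rewrite pactD pactC !pact_X xp addn0 mulrN1z subrr.
Qed.

Lemma prime_cyclotomic : ('X - 1) * 'Phi_p = 'X^p - 1 :> {poly int}.
Proof.
have p1 := prime_gt1 pp.
have -> : 'X - 1 = 'Phi_1 :> {poly int}.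
  by have := prod_Cyclotomic (ltn0Sn 0); rewrite big_seq1 expr1.
have pe : perm_eq (divisors p) [:: 1%N; p].
  apply: uniq_perm; rewrite ?divisors_uniq //= ?inE ?(ltn_eqF p1) // => m.
  rewrite -dvdn_divisors ?prime_gt0 // !inE; apply/idP/orP => [|[/eqP->|/eqP->]] //.
  by case/primeP: pp => _ h /h /orP[]; [left|right].
by rewrite -(prod_Cyclotomic (prime_gt0 pp)) (perm_big _ pe) big_cons big_seq1.
Qed.

(** Were [d] prime to ['Phi_p], a nonzero multiple of T - 1 would kill the sequence and x_0 - x_1
    would be torsion. So [d] is a multiple of ['Phi_p], a constant one by its degree. *)
Lemma kills_constant d : ~ torsion (x 0%N - x 1%N) -> kills d -> (size d <= p)%N ->
  forall i, (i.+1 < p)%N -> d`_i.+1 = d`_i.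
Proof.
move=> nt kd sd; have inj := @intr_inj rat.
have eXp : ('X - 1) * pZtoQ 'Phi_p = 'X^p - 1.
  have := congr1 pZtoQ prime_cyclotomic.
  by rewrite rmorphM !rmorphB /= map_polyX map_polyXn rmorph1.
have [/Bezout_eq1_coprimepP[[u v] /= euv]|dv] := cyclotomic_coprime_or_dvd (pZtoQ d) pp.
  case: nt; have [u' [a a0 eu]] := rat_poly_scale u; have [v' [b b0 ev]] := rat_poly_scale v.
  have a0' : a%:~R != 0 :> rat by rewrite intr_eq0.
  have b0' : b%:~R != 0 :> rat by rewrite intr_eq0.
  (* Denominators are cleared in the Bezout relation, and the factor T - 1 turns ['Phi_p] into T^p -
     1, which kills any sequence of period p. *)
  have e : b%:P * u' * ('X^p - 1) + a%:P * v' * ('X - 1) * d = (a * b)%:P * ('X - 1).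
    apply: (map_inj_poly inj (rmorph0 _)).
    rewrite rmorphD !rmorphM !rmorphB /= map_polyX map_polyXn rmorph1 !map_polyC /=.
    rewrite -eXp -[RHS]mulr1 -[X in _ = _ * X]euv eu ev -!mul_polyC ?intrM ?polyCM.
    have ha : (a%:~R : rat)%:P * (a%:~R^-1)%:P = 1 by rewrite -polyCM mulfV.
    have hb : (b%:~R : rat)%:P * (b%:~R^-1)%:P = 1 by rewrite -polyCM mulfV.
    transitivity (((a%:~R : rat)%:P * (a%:~R^-1)%:P) *
        ((b%:~R : rat)%:P * ('X - 1) * (pZtoQ u' * pZtoQ 'Phi_p)) + ((b%:~R : rat)%:P * (b%:~R^-1)%:P) *
        ((a%:~R : rat)%:P * ('X - 1) * (pZtoQ v' * pZtoQ d))).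
      by rewrite ha hb !mul1r; ring.
    by ring.
  have k1 : kills ((a * b)%:P * ('X - 1)).
    by rewrite -e; apply: killsD; apply: kills_mul => //; apply: kills_period.
  have := k1 0%N; rewrite pactC.
  have -> : 'X - 1 = 'X^1 + (- 1)%:P * 'X^0 :> {poly int} by rewrite polyCN mulN1r expr0 expr1.
  rewrite pactD pactC !pact_X !add0n mulrN1z => tx.
  have [N N0 tN] := torsion_mulrz (mulf_neq0 a0 b0) tx.
  by exists N => //; rewrite -opprB mulNrn tN oppr0.
move=> i lti; have /dvdpP[c ec] := dv.
have [c0 sc] : exists c0, c = c0%:P.
  exists c`_0; apply: size1_polyC; have [->|cn0] := eqVneq c 0; first by rewrite size_poly0.
  have Pn0 : pZtoQ 'Phi_p != 0 by rewrite monic_neq0 // monic_map // Cyclotomic_monic.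
  have : (size (pZtoQ d) <= p)%N by rewrite size_map_inj_poly.
  rewrite ec size_mul // [size (pZtoQ _)]size_map_inj_poly // size_Cyclotomic totient_prime //.
  by rewrite prednK ?prime_gt0 // -subn1 leq_subLR leq_add2r.
(* In (T - 1) d = c0 (T^p - 1) the coefficients of index strictly between 0 and p vanish:
   consecutive coefficients of [d] agree. *)
have e : ('X - 1) * pZtoQ d = c0%:P * ('X^p - 1) by rewrite ec sc -eXp; ring.
have := congr1 (fun q : {poly rat} => q`_i.+1) e.
rewrite mulrBl mul1r coefB coefXM /= !coef_map /= coefCM coefB coefXn coef1 /= (ltn_eqF lti) subrr mulr0.
by move=> /eqP; rewrite subr_eq0 => /eqP/inj.
Qed.
End CyclicModule.

(** * Rank gained from one orbit *)

Section Rank.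
Variables (K : fieldType) (C : fieldType) (iota : {rmorphism K -> C}).
Variables (A : zmodType) (m : nat) (eA : A -> pspace C m).
Hypothesis hA : abelian_variety iota eA.
Variables (L : fieldExtType K) (j : {rmorphism L -> C}).
Hypothesis ej : extends iota j.

Section Conj.
Variable j2 : {rmorphism L -> C}.
Hypothesis ej2 : extends iota j2.
Local Notation cj := (conj_points j j2 eA).

Lemma cj0 : cj 0 0. Proof. exact: (conj_points_base ej ej2 (av_zero hA)). Qed.

Lemma cjN a a' : cj a a' -> cj (- a) (- a').
Proof. exact: (conj_points_morphism ej ej2 (av_opp hA)). Qed.

Lemma cjD a a' b b' : cj a a' -> cj b b' -> cj (a + b) (a' + b').
Proof. by move=> ca cb; apply: (conj_points_morphism ej ej2 (av_add hA) (conj_points_pair ca cb)). Qed.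

Lemma cjMz a a' c : cj a a' -> cj (a *~ c) (a' *~ c).
Proof.
move=> ca; have h k : cj (a *+ k) (a' *+ k).
  by elim: k => [|k IH]; [rewrite !mulr0n; apply: cj0|rewrite !mulrS; apply: cjD].
by case: (intP c) => [|k|k]; [apply: (h 0%N)|apply: (h k.+1)|rewrite !mulrNz; apply/cjN/(h k.+1)].
Qed.

Lemma cj_sum r (a a' : 'I_r -> A) : (forall i, cj (a i) (a' i)) -> cj (\sum_i a i) (\sum_i a' i).
Proof. by move=> h; elim/big_ind2: _ => //; [apply: cj0|move=> *; apply: cjD]. Qed.

Lemma cj_zero a : cj 0 a -> a = 0.
Proof. move=> h; apply: (conj_points_inj (pv_inj (av_variety hA)) h cj0). Qed.
End Conj.

Variables (X : Type) (n : nat) (eX : X -> pspace C n) (gT : finGroupType) (act : gT -> X -> X).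
Hypothesis hG : automorphism_subgroup iota eX act.
Variables (f : X -> A).
Hypothesis mf : morphism_over iota eX eA f.
Hypothesis h_vanish : forall P : X, \sum_(g : gT) f (act g P) = 0.
Variables (P : X).
Hypothesis ratP : forall g, rational_point j eX (act g P).
Hypothesis conjP : forall h, exists2 j2 : {rmorphism L -> C}, extends iota j2 &
  forall g, conj_points j j2 eX (act g P) (act (g * h)%g P).
Variables (p : nat) (sigma : gT).
Hypotheses (pp : prime p) (h_sigma : #[sigma]%g = p).
Let x k := f (act (sigma ^+ k)%g P).

Lemma orbit_periodic k : x (k + p) = x k.
Proof. by rewrite /x expgD -h_sigma expg_order mulg1. Qed.

Lemma rank_gain r0 : (forall d, kills x d -> (size d <= r0)%N -> d = 0) ->
  rank_ge_add (rational_point j eA) (rational_point iota eA) r0.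
Proof.
move=> hk r [v [ratv indv]].
pose w (i : 'I_(r + r0)) := match split i with inl i' => v i' | inr i' => x i' end.
exists w; split=> [i|c].
  rewrite /w; case: (split i) => i'; apply/conj_points_rational.
    exact: (conj_points_base ej ej (ratv i')).
  by apply: (conj_points_morphism ej ej mf); apply/conj_points_rational.
rewrite big_split_ord /= => e.
pose V := \sum_i v i *~ c (lshift r0 i); pose dd i := c (rshift r i).
have e1 (h : gT) : V + \sum_(i < r0) f (act (sigma ^+ i * h)%g P) *~ dd i = 0.
  have [j2 ej2 hj2] := conjP h; apply: (cj_zero ej2); rewrite -{1}e.
  by apply: (cjD ej2); apply: (cj_sum ej2) => i;
    apply: (cjMz ej2); rewrite /w ?(unsplitK (inl i)) ?(unsplitK (inr i));
    [apply: (conj_points_base ej ej2)|apply: (conj_points_morphism ej ej2 mf)].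
(* Summing the conjugate relations over G multiplies the K-rational part by [#|gT|], a factor
   absorbed in the integer coefficients. *)
have V0 : forall i, c (lshift r0 i) = 0.
  have sV : V *+ #|gT| = 0.
    have : \sum_(h : gT) (V + \sum_(i < r0) f (act (sigma ^+ i * h)%g P) *~ dd i) = 0.
      by apply: big1 => h _; apply: e1.
    rewrite big_split /= sumr_const exchange_big /= [X in _ + X]big1 ?addr0 // => i _.
    rewrite -mulrz_suml (_ : \sum_h _ = 0) ?mul0rz // -[RHS](h_vanish P).
    rewrite (reindex_inj (mulgI (sigma ^+ i)^-1%g)) /=.
    by apply: eq_bigr => h _; rewrite mulKVg.
  move=> i; have := indv (fun i => c (lshift r0 i) * #|gT|%:Z) _ i.
  have -> : \sum_i v i *~ (c (lshift r0 i) * #|gT|%:Z) = V *+ #|gT|.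
    rewrite pmulrn mulrz_suml; apply: eq_bigr => i' _; by rewrite mulrzA.
  move=> /(_ sV)/eqP; rewrite mulf_eq0 => /orP[/eqP //|].
  by rewrite eqz_nat -leqn0 leqNgt -cardsT cardG_gt0.
have VV : V = 0 by apply: big1 => i _; rewrite V0 mulr0z.
pose d : {poly int} := \poly_(i < r0) (if insub i is Some i' then dd i' else 0).
have dE (i : 'I_r0) : d`_i = dd i by rewrite coef_poly ltn_ord valK.
have d0 : d = 0.
  apply: hk; last exact: size_poly.
  (* The conjugate relation for h = sigma^k says that [d] kills the sequence at k. *)
  move=> k; rewrite (pact_wide _ _ (n := r0)) ?size_poly //.
  rewrite -[RHS](e1 (sigma ^+ k)%g) VV add0r.
  apply: eq_bigr => i _; rewrite dE /x addnC expgD; congr (f (act _ P) *~ _).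
move=> i; case: (split_ordP i) => i' ->; first exact: V0.
by rewrite -/(dd i') -dE d0 coef0.
Qed.

Hypothesis nt2 : ~ torsion (f P - f (act sigma P)).

Let nt : ~ torsion (x 0%N - x 1%N).
Proof. by rewrite /x expg0 expg1 (aut_one hG). Qed.

Lemma kills_const d i : kills x d -> (size d <= p)%N -> (i < p)%N -> d`_i = d`_0.
Proof.
move=> kd sd; elim: i => // i IH lti.
by rewrite (kills_constant pp orbit_periodic nt kd sd lti) IH // ltnW.
Qed.

(** With only p - 1 points the coefficient of index p - 1 is absent, hence zero, and all the others
    are equal to it. *)
Lemma rank_gain_pred : rank_ge_add (rational_point j eA) (rational_point iota eA) (p - 1).
Proof.
apply: rank_gain => d kd sd; have sd' : (size d <= p)%N by apply: leq_trans sd (leq_subr _ _).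
have p0 := prime_gt0 pp; have ltp : (p - 1 < p)%N by rewrite ltn_subrL.
have l0 : d`_(p - 1) = 0 by apply: nth_default.
apply/polyP => i; rewrite coef0; have [lt|le] := ltnP i p; last first.
  by rewrite nth_default // (leq_trans sd').
by rewrite (kills_const kd sd' lt) -(kills_const kd sd' ltp).
Qed.

Lemma rank_gain_full : ~ torsion (\sum_(i < p) f (act (sigma ^+ i)%g P)) ->
  rank_ge_add (rational_point j eA) (rational_point iota eA) p.
Proof.
move=> nt1; apply: rank_gain => d kd sd.
have [d0|d0] := eqVneq (d`_0) 0.
  apply/polyP => i; rewrite coef0; have [lt|le] := ltnP i p; first by rewrite kills_const.
  by rewrite nth_default // (leq_trans sd).
case: nt1; apply: (torsion_mulrz d0); have := kd 0%N; rewrite (pact_wide _ _ sd) => e.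
by rewrite -[RHS]e mulrz_suml; apply: eq_bigr => i _; rewrite (kills_const kd sd (ltn_ord i)).
Qed.
End Rank.

Definition field_gen (K C : fieldType) (iota : {rmorphism K -> C}) (s : seq C) (x : C) :=
  forall S : {pred C}, divring_closed S -> (forall a, iota a \in S) ->
    (forall y, y \in s -> y \in S) -> x \in S.

Section CMorphismGroup.
Variables (C : fieldType) (A : zmodType) (m : nat) (eA : A -> pspace C m).
Hypotheses (addA : cmorphism (pair_emb eA eA) eA (fun PQ : A * A => PQ.1 + PQ.2))
  (oppA : cmorphism eA eA (fun P => - P)).
Variables (X : Type) (n : nat) (eX : X -> pspace C n).

Lemma cmorphismD f g : cmorphism eX eA f -> cmorphism eX eA g ->
  cmorphism eX eA (fun P => f P + g P).
Proof. by move=> mf mg; apply: (cmorphism_comp (cmorphism_pair mf mg) addA). Qed.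

Lemma cmorphismB f g : cmorphism eX eA f -> cmorphism eX eA g ->
  cmorphism eX eA (fun P => f P - g P).
Proof. by move=> mf mg; apply: cmorphismD => //; apply: (cmorphism_comp mg oppA). Qed.

Lemma cmorphism_sum I (r : seq I) (f : I -> X -> A) : (forall i, cmorphism eX eA (f i)) ->
  cmorphism eX eA (fun P => \sum_(i <- r) f i P).
Proof.
move=> mf; elim: r => [|i r IH].
  have -> : (fun P => \sum_(i <- [::]) f i P) = fun=> 0.
    by apply: boolp.funext => P; rewrite big_nil.
  exact: cmorphism_const.
have -> : (fun P => \sum_(j <- i :: r) f j P) = fun P => f i P + \sum_(j <- r) f j P.
  by apply: boolp.funext => P; rewrite big_cons.
exact: cmorphismD.
Qed.
End CMorphismGroup.

(** [D * y] is a root of an irreducible polynomial of degree N over F. Dividing the k-th coefficient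
    by [DF ^ k] turns a relation between powers of y into one between powers of [D * y]. *)
Lemma powers_independent (F C : fieldType) (kap : {rmorphism F -> C}) (N : nat) (q : {poly F}) (D y : C) (DF : F) :
  irreducible_poly q -> size q = N.+1 -> root (map_poly kap q) (D * y) -> kap DF = D -> D != 0 ->
  forall c : 'I_N -> C, (forall i, exists a, kap a = c i) ->
  \sum_i c i * y ^+ i = 0 -> forall i, c i = 0.
Proof.
move=> irq sq qy eD D0 c hc e i.
have [c' hc'] := boolp.choice hc.
pose r : {poly F} := \poly_(k < N) (if insub k is Some k' then c' k' / DF ^+ k else 0).
have rE (k : 'I_N) : r`_k = c' k / DF ^+ k by rewrite coef_poly ltn_ord valK.
have sr : (size r <= N)%N by apply: size_poly.
have ry : root (map_poly kap r) (D * y).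
  rewrite /root (horner_coef_wide _ (_ : (_ <= N)%N)); last by rewrite size_map_poly.
  apply/eqP; rewrite -[RHS]e; apply: eq_bigr => k _.
  rewrite coef_map /= rE fmorph_div rmorphXn /= hc' eD exprMn mulrA divfK //.
  by rewrite expf_neq0.
have r0 : r = 0.
  apply/eqP; apply: contraTT sr => rn0; rewrite -ltnNge -sq.
  apply: dvdp_leq => //; apply: dvdp_trans (dvdp_gcdr q r).
  have [_ /(_ (gcdp q r)) h] := irq.
  have : gcdp q r %= q.
    apply: h; last exact: dvdp_gcdl.
    have gy : root (map_poly kap (gcdp q r)) (D * y) by rewrite gcdp_map root_gcd qy ry.
    apply: contraL gy => /eqP s1; have [a eg] : exists a, gcdp q r = a%:P.
      by exists (gcdp q r)`_0; apply: size1_polyC; rewrite s1.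
    rewrite eg map_polyC rootC fmorph_eq0; apply: contraNneq rn0 => a0.
    by have /eqP := eg; rewrite a0 polyC0 gcdp_eq0 => /andP[].
  by case/andP.
have := rE i; rewrite r0 coef0 => /esym/eqP; rewrite mulf_eq0 invr_eq0 expf_eq0.
have DF0 : DF != 0 by rewrite -(fmorph_eq0 kap) eD.
by rewrite (negPf DF0) andbF orbF -hc' => /eqP ->; rewrite rmorph0.
Qed.

(** * One step of the construction *)

Section Step.
Variables (K : fieldExtType rat) (C : closedFieldType) (iota : {rmorphism K -> C}).
Hypothesis alg : integralRange iota.
Variables (A : zmodType) (m : nat) (eA : A -> pspace C m).
Hypothesis hA : abelian_variety iota eA.
Variables (X : Type) (n : nat) (eX : X -> pspace C n).
Hypothesis hX : projective_variety iota eX.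
Variables (G : finGroupType) (act : G -> X -> X).
Hypothesis hG : automorphism_subgroup iota eX act.
Variables (Y : Type) (q : nat) (eY : Y -> pspace C q).
Variable (pi : X -> Y).
Hypothesis hpi : group_quotient iota eX act eY pi.
Variables (d : nat).
Hypothesis hYd : isomorphic_over iota eY (@id (pspace C d.+1)).
Variables (g1 g2 : X -> A).
Hypotheses (mg1 : cmorphism eX eA g1) (mg2 : cmorphism eX eA g2).
Hypotheses (nc1 : ~ is_constant g1) (nc2 : ~ is_constant g2).

(* The list s stands for generators of the previously constructed extensions. *)
Lemma many_points (s : seq C) : exists (L : splittingFieldType K) (j : {rmorphism L -> C}) (P : X),
  [/\ [/\ is_G_extension L G, extends iota j & linearly_disjoint j (field_gen iota s)],
    forall g, rational_point j eX (act g P),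
    forall h, exists2 j2 : {rmorphism L -> C}, extends iota j2 &
      forall g, conj_points j j2 eX (act g P) (act (g * h)%g P) &
    ~ torsion (g1 P) /\ ~ torsion (g2 P)].
Proof.
have [u [v [mu mv uK vK]]] := hYd.
have algQ := integral_over_rat alg; set i0 : {rmorphism rat -> C} := iota \o in_alg K in algQ.
have c0 : [pchar C] =i pred0 := char0_C i0.
have cK := pchar_number_field K.
have injX := pv_inj hX; have irrX := pv_irreducible hX.
have cmu := morphism_over_cmorphism mu; have cmv := morphism_over_cmorphism mv.
have [c1 [c2 [D [E [chi [b [mchi schi [P0 [x0 [_ E0]]] hM irr]]]]]]] :=
  geometric_model c0 injX irrX hG hpi cmu cmv uK.
pose rho P := u (pi P).
have rho_surj Q : exists P, rho P = Q.
  by have [P eP] := quo_surjective hpi (v Q); exists P; rewrite /rho eP vK.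
have rho_orbit P P' : rho P = rho P' -> exists g, P' = act g P.
  by move=> /(can_inj uK)/(quo_orbits hpi).
have rho_act g P : rho (act g P) = rho P.
  by congr u; apply/esym/(quo_orbits hpi); exists g.
have rho_closed Z : zclosed eX Z -> (forall g P, Z P -> Z (act g P)) ->
    zclosed (@id (pspace C d.+1)) (fun Q => exists2 P, Z P & rho P = Q).
  move=> cZ iZ; pose W y := exists2 P, Z P & pi P = y.
  have cW : zclosed eY W.
    apply/(quo_topology hpi); have -> : (fun P => W (pi P)) = Z => //.
    apply: boolp.funext => P; apply: boolp.propext; split=> [[P' ZP' /(quo_orbits hpi)[g ->]]|ZP].
      exact: iZ.
    by exists P.
  have -> : (fun Q => exists2 P, Z P & rho P = Q) = fun Q => W (v Q).
    apply: boolp.funext => Q; apply: boolp.propext; split=> [[P ZP <-]|[P ZP e]].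
      by exists P => //; rewrite /rho uK.
    by exists P => //; rewrite /rho e vK.
  exact: preimage_closed cmv cW.
have crho (L : fieldExtType K) (j1 j2 : {rmorphism L -> C}) : extends iota j1 -> extends iota j2 ->
    forall P P', conj_points j1 j2 eX P P' -> conj_points j1 j2 (@id (pspace C d.+1)) (rho P) (rho P').
  move=> e1 e2 P P' cPP'; apply: (conj_points_morphism e1 e2 mu).
  exact: (conj_points_morphism e1 e2 (quo_morphism hpi)).
(* This prime only measures closeness on X and A. The auxiliary prime of [hilbert_irreducibility] is
   chosen separately, for each F. *)
have [O [vO _ _]] := valuation_ring_exists c0 (isT : prime 2)
  (fun x => algebraic_integral_multiple ((integral_algebraic i0 x).2 (algQ x))).
have hM' P x : coords (rho P) x -> meval_row E x != 0 ->
    evc x chi = \prod_g ('X - (meval_row D x * theta eX c1 c2 (act g P))%:P) /\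
    forall g, coords (eX (act g P)) (\row_i (evc x (b i)).[meval_row D x * theta eX c1 c2 (act g P)]).
  by move=> Px Ex; have [] := hM P x Px Ex.
have E_neq0 : E != 0 by apply: contraNneq E0 => ->; rewrite /meval_row meval0.
have cact g := morphism_over_cmorphism (aut_morphism hG g).
have cadd : cmorphism (pair_emb eA eA) eA (fun PQ : A * A => PQ.1 + PQ.2).
  exact: (morphism_over_cmorphism (av_add hA)).
have copp := morphism_over_cmorphism (av_opp hA).
have [t1 [k [[P1 P1t] hP1]]] := good_point vO (isT : prime 2) (pv_inj (av_variety hA)) cadd copp c0
  (aut_one hG) (aut_mul hG) cact hM' irrX rho_surj rho_orbit rho_act rho_closed E_neq0 ord0 mg1 mg2 nc1 nc2.
have near1 : nearv 2 O (\row_i (t1 i)%:R) k (\row_i (t1 i)%:R).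
  by move=> i; rewrite subrr; apply: (vdiv0 vO).
have [E1 _] := hP1 P1 _ near1 P1t.
have sep : separable_poly (evc (\row_i (t1 i)%:R) chi).
  have [_ _ inj1 -> _] := hM P1 _ P1t E1.
  rewrite -(big_map (fun g => meval_row D (\row_i (t1 i)%:R) * theta eX c1 c2 (act g P1)) xpredT (fun y => 'X - y%:P)).
  by rewrite separable_prod_XsubC map_inj_uniq // index_enum_uniq.
have schi1 : (1 < size chi)%N by rewrite schi ltnS -cardsT cardG_gt0.
(* A rational basis of K is included so that F contains K. *)
pose s' := map iota (vbasis {:K}) ++ s.
have [F [kap [t [chiF [DF [hs [nt let1] irF echiF eDF]]]]]] :=
  irreducible_specialization algQ vO (isT : prime 2) D mchi schi1 irr k s' sep.
(* The coordinates of [t] are at least those of [t1], which are not all zero. *)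
have [P' P't] : exists P', coords (rho P') (\row_i (t i)%:R).
  have [|Q Qt] := @coords_exists C _ (\row_i (t i)%:R).
    have [i ti] := rV0Pn _ (coords_neq0 P1t); apply/rV0Pn; exists i; move: ti.
    by rewrite !mxE !((pcharf0P C).1 c0) -!lt0n => /leq_trans; apply.
  by have [P' eP'] := rho_surj Q; exists P'; rewrite eP'.
have [Et [g [nt1 nt2]]] := hP1 P' _ nt P't.
set P := act g P' in nt1 nt2.
have Pt : coords (rho P) (\row_i (t i)%:R) by rewrite rho_act.
have [D0 lin1 injD echi _] := hM P _ Pt Et.
have inj_theta : injective (fun h => theta eX c1 c2 (act h P)).
  by move=> h h' e; apply: injD; rewrite /= e.
pose z : 'rV[K]_d.+1 := \row_i (t i)%:R.
have ez : map_mx iota z = \row_i (t i)%:R by apply/rowP => i; rewrite !mxE rmorph_nat.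
pose FF x := exists y, kap y = x.
have FF1 a : FF a -> FF (- a) by move=> [x <-]; exists (- x); rewrite rmorphN.
have FFD a c : FF a -> FF c -> FF (a + c) by move=> [x <-] [y <-]; exists (x + y); rewrite rmorphD.
have FFM a c : FF a -> FF c -> FF (a * c) by move=> [x <-] [y <-]; exists (x * y); rewrite rmorphM.
have FFQ (r : rat) : FF (iota r%:A).
  have hr (F1 F2 : {rmorphism rat -> C}) : F1 r = F2 r.
    rewrite -[r]divq_num_den !fmorph_div !rmorph_int //.
  by exists (in_alg F r); apply: (hr (kap \o in_alg F) i0).
have FFiota a : FF (iota a).
  rewrite (coord_vbasis (memvf a)) rmorph_sum; elim/big_ind: _ => //; first by exists 0; rewrite rmorph0.
  move=> i _; rewrite -mulr_algl rmorphM /=; apply: FFM => //; apply: hs.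
  by rewrite mem_cat map_f ?mem_nth // size_tuple.
have sF : size chiF = #|G|.+1.
  rewrite -(size_map_poly kap) echiF -schi size_map_poly_id0 //.
  by rewrite (monicP mchi) rmorph1 oner_eq0.
have rootF : root (map_poly kap chiF) (meval_row D (\row_i (t i)%:R) * theta eX c1 c2 P).
  rewrite echiF echi -[P in theta _ _ _ P](aut_one hG).
  by rewrite /root horner_prod (bigD1 1%g) //= hornerXsubC subrr mul0r.
have ind := powers_independent irF sF rootF eDF D0.
have [|L [j [isG ej ld rat conj]]] := 
  galois_specialization cK alg hX hG crho rho_orbit (z := z) _ lin1 inj_theta FFiota FFD FFM ind.
  by rewrite ez.
exists L, j, P; split=> //; split=> //.
(* [FF] is a subfield that contains K and [s], hence the field they generate. *)
move=> m' w fw bb hb; apply: ld fw _ _ => i.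
have := hb i [pred x | boolp.asbool (FF x)]; rewrite inE => /(_ _ _ _)/boolp.asboolP; apply.
- split=> [|x y|x y]; rewrite ?inE.
  + by apply/boolp.asboolP; exists 1; rewrite rmorph1.
  + by move=> /boolp.asboolP hx /boolp.asboolP hy; apply/boolp.asboolP/FFD => //; apply: FF1.
  move=> /boolp.asboolP[x' <-] /boolp.asboolP[y' <-]; apply/boolp.asboolP.
  by exists (x' / y'); rewrite fmorph_div.
- by move=> a; rewrite inE; apply/boolp.asboolP.
by move=> y ys; rewrite inE; apply/boolp.asboolP/hs; rewrite mem_cat ys orbT.
Qed.
End Step.

(** The list [s n] accumulates the images of K-bases of the first n fields. It generates their
    compositum, so each new field is disjoint from all the previous ones together. *)
Lemma disjoint_sequence (K C : fieldType) (iota : {rmorphism K -> C})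
    (Q : forall L : splittingFieldType K, {rmorphism L -> C} -> Prop) :
  (forall s : seq C, exists (L : splittingFieldType K) (j : {rmorphism L -> C}),
    [/\ Q L j, extends iota j & linearly_disjoint j (field_gen iota s)]) ->
  exists (L : nat -> splittingFieldType K) (j : forall i, {rmorphism L i -> C}),
    [/\ forall i, Q (L i) (j i), forall i, extends iota (j i) & linearly_disjoint_family iota j].
Proof.
move=> step; pose T := {L : splittingFieldType K & {rmorphism L -> C}}.
have H s : exists Lj : T, [/\ Q (projT1 Lj) (projT2 Lj), extends iota (projT2 Lj) &
    linearly_disjoint (projT2 Lj) (field_gen iota s)].
  by have [L [j h]] := step s; exists (existT _ L j).
have [f hf] := boolp.choice H.
pose bas (Lj : T) : seq C := map (projT2 Lj) (vbasis {:projT1 Lj}).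
pose s := fix s n := if n is k.+1 then s k ++ bas (f (s k)) else [::].
exists (fun i => projT1 (f (s i))), (fun i => projT2 (f (s i))); split.
- by move=> i; have [] := hf (s i).
- by move=> i; have [] := hf (s i).
move=> n m v fv b hb; have [_ _ ld] := hf (s n); apply: (ld m v fv b) => i.
move=> S clS Siota Ss; apply: (hb i S clS Siota) => k y ltkn.
have [S1 SB SV] := clS.
have S0 : 0 \in S by rewrite -(subrr 1); apply: SB.
have SD a c : a \in S -> c \in S -> a + c \in S.
  by move=> Sa Sc; rewrite -[c]opprK; apply: (SB _ _ Sa); rewrite -sub0r; apply: SB.
have SM a c : a \in S -> c \in S -> a * c \in S.
  by move=> Sa Sc; rewrite -[c]invrK; apply: (SV _ _ Sa); rewrite -[c^-1]mul1r; apply: SV.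
have sub a : a \in s k.+1 -> a \in s n.
  move=> sa; have: (k < n)%N by []; elim: (n) => // n' IH; rewrite ltnS leq_eqVlt => /predU1P[<- //|/IH hs].
  by rewrite /= mem_cat hs.
rewrite (coord_vbasis (memvf y)) rmorph_sum; elim/big_ind: _ => // i' _.
have [_ ejk _] := hf (s k).
rewrite -mulr_algl rmorphM /= ejk; apply: SM => //; apply: Ss; apply: sub.
by rewrite /= mem_cat /bas map_f ?orbT // mem_nth // size_tuple.
Qed.

Theorem theorem1p1
  (* K is a number field and Kbar an algebraic closure of K *)
  (K : fieldExtType rat) (Kbar : closedFieldType)
  (iota : {rmorphism K -> Kbar}) (h_algebraic : integralRange iota)
  (* the abelian variety A over K *)
  (A : zmodType) (m : nat) (eA : A -> pspace Kbar m)
  (hA : abelian_variety iota eA)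
  (* the smooth projective variety X over K and G inside Aut_K(X) *)
  (X : Type) (n : nat) (eX : X -> pspace Kbar n)
  (hX : projective_variety iota eX) (hX_smooth : smooth eX)
  (G : finGroupType) (act : G -> X -> X)
  (hG : automorphism_subgroup iota eX act)
  (f : X -> A) (hf : morphism_over iota eX eA f)
  (* the quotient Y = X/G, isomorphic over K to P^d *)
  (Y : Type) (q : nat) (eY : Y -> pspace Kbar q)
  (hY : projective_variety iota eY)
  (pi : X -> Y) (hpi : group_quotient iota eX act eY pi)
  (d : nat) (hd : (1 <= d)%N)
  (hYd : isomorphic_over iota eY (@id (pspace Kbar d.+1)))
  (h_vanish : forall P : X, \sum_(g : G) f (act g P) = 0)
  (p : nat) (hp : prime p) (sigma : G) (h_sigma : #[sigma]%g = p) :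
  let NC1 :=
    ~ is_constant (fun P : X => \sum_(i < p) f (act (sigma ^+ i)%g P)) in
  let NC2 := ~ is_constant (fun P : X => f P - f (act sigma P)) in
  (NC1 -> NC2 -> infinitely_many_rank_gains iota G eA p) /\
  (NC2 -> infinitely_many_rank_gains iota G eA (p - 1)).
Proof.
move=> NC1 NC2.
have cadd : cmorphism (pair_emb eA eA) eA (fun PQ : A * A => PQ.1 + PQ.2).
  exact: (morphism_over_cmorphism (av_add hA)).
have copp := morphism_over_cmorphism (av_opp hA).
have cf g : cmorphism eX eA (fun P => f (act g P)).
  exact: (cmorphism_comp (morphism_over_cmorphism (aut_morphism hG g)) (morphism_over_cmorphism hf)).
have cg1 : cmorphism eX eA (fun P => \sum_(i < p) f (act (sigma ^+ i)%g P)).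
  exact: (cmorphism_sum (f := fun (i : 'I_p) P => f (act (sigma ^+ i)%g P)) cadd _ (fun i => cf _)).
have cg2 : cmorphism eX eA (fun P => f P - f (act sigma P)).
  exact: (cmorphismB cadd copp (morphism_over_cmorphism hf) (cf sigma)).
have gain k : (forall s : seq Kbar, exists (L : splittingFieldType K) (j : {rmorphism L -> Kbar}),
    [/\ is_G_extension L G /\ rank_ge_add (rational_point j eA) (rational_point iota eA) k,
        extends iota j & linearly_disjoint j (field_gen iota s)]) ->
    infinitely_many_rank_gains iota G eA k.
  move=> /(disjoint_sequence (Q := fun L j => is_G_extension L G /\
    rank_ge_add (rational_point j eA) (rational_point iota eA) k))[L [j [h ej ld]]].
  by exists L, j; split=> // i; case: (h i).
split=> [nc1 nc2|nc2]; apply: gain => s.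
  have [L [j [P [[isG ej ld] rat cj [nt1 nt2]]]]] :=
    many_points h_algebraic hA hX hG hpi hYd cg1 cg2 nc1 nc2 s.
  exists L, j; split=> //; split=> //.
  exact: (rank_gain_full hA ej hG hf h_vanish rat cj hp h_sigma nt2 nt1).
(* Only (NC2) is available, so the same morphism fills both places of the pair. *)
have [L [j [P [[isG ej ld] rat cj [_ nt2]]]]] :=
  many_points h_algebraic hA hX hG hpi hYd cg2 cg2 nc2 nc2 s.
exists L, j; split=> //; split=> //.
exact: (rank_gain_pred hA ej hG hf h_vanish rat cj hp h_sigma nt2).
Qed.
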